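(* Let $k\ge 1$ be a fixed integer. Then $$\sum_{H\ \text{good}}\ \prod_{i\ge\eta(H)}G\bigl(d_i-d_{i+1}+\tau(i),\,d_{i+1}-d_{i+1+k}\bigr)_q\; q^{\chi(H)}\,t^{\sum d_i}=\prod_{i\ge 1}\frac{1}{1-qt^i},$$ where the sum is over all good sequences $H=(d_0,d_1,\ldots)$ and $$\chi(H)=\sum_{i\ge\eta(H)}\bigl(d_i-d_{i+1}+\tau(i)\bigr)\left(\frac{k}{2}\bigl(d_i-d_{i+1}+\tau(i)-1\bigr)+\sum_{j=1}^{k-1}(k-j)\bigl(d_{i+j}-d_{i+j+1}+\tau(i+j)\bigr)\right).$$
   Context: Sequences $H=(d_0,d_1,\ldots)$ consist of non-negative integers with finite sum $\sum_{i\ge0}d_i$. For integers $M,N\ge 0$, $G(M,N)_q=\dfrac{\prod_{i=1}^{M+N}(1-q^i)}{\prod_{i=1}^{M}(1-q^i)\prod_{i=1}^{N}(1-q^i)}$. The number $\eta(H)$ is the largest $i$ such that $d_i=\left[\frac{i}{k}\right]+1$, where $[\cdot]$ denotes the integer part (floor), with the conventions that $\eta(H)=-1$ if $H=(0,0,\ldots)$, and $d_{-1}=0$; more generally $d_i=0$ for $-k\le i\le -1$. The function $\tau$ is defined by $\tau(i)=1$ if $k\mid i+1$ and $\tau(i)=0$ if $k\nmid i+1$. A sequence $H=(d_0,d_1,\ldots)$ is called good if for every $i\ge\eta(H)$ one has $d_i-d_{i+1}+\tau(i)\ge 0$ and $d_{i+1}\le d_{i+1-k}$.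
   Formalization: η(H) is taken as the largest i such that d_j=[j/k]+1 for all -1≤j≤i, not just at i; with the literal η the identity fails (k=1: H=(0,2,0,…) would be good and add q^3t^2). For the good H that remain, both definitions of η agree. *)

(* Defs.v *)
From HB Require Import structures.
From mathcomp Require Import all_boot all_order all_algebra finmap.
From mathcomp Require Import all_classical.
From mathcomp Require Import zify ring lra.

Set Implicit Arguments.
Unset Strict Implicit.
Unset Printing Implicit Defensive.

Import Order.TTheory GRing.Theory Num.Theory.
Local Open Scope classical_set_scope.
Local Open Scope ring_scope.

(** * Formal power series *)

Record fps (K : Type) := Fps { fcoef : nat -> K }.

HB.instance Definition _ (K : Type) := gen_eqMixin (fps K).
HB.instance Definition _ (K : Type) := gen_choiceMixin (fps K).

Lemma fpsP (K : Type) (a b : fps K) : fcoef a =1 fcoef b <-> a = b.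
Proof. by split=> [|->//]; case: a b => [a] [b] /= /funext ->. Qed.

Section FpsRing.
Variable K : fieldType.
Implicit Types a b c : fps K.

Definition fps_add a b := Fps (fun n => fcoef a n + fcoef b n).
Definition fps_opp a := Fps (fun n => - fcoef a n).
Definition fps_mul a b :=
  Fps (fun n => \sum_(i < n.+1) fcoef a i * fcoef b (n - i)).
Definition fpsC (x : K) := Fps (fun n => if n == 0%N then x else 0).
Definition fpsX : fps K := Fps (fun n => (n == 1%N)%:R).

Fact fps_addA : associative fps_add.
Proof. by move=> a b c; apply/fpsP => n /=; rewrite addrA. Qed.
Fact fps_addC : commutative fps_add.
Proof. by move=> a b; apply/fpsP => n /=; rewrite addrC. Qed.
Fact fps_add0 : left_id (fpsC 0) fps_add.
Proof. by move=> a; apply/fpsP => n /=; case: eqP; rewrite add0r. Qed.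
Fact fps_addN : left_inverse (fpsC 0) fps_opp fps_add.
Proof. by move=> a; apply/fpsP => n /=; case: eqP; rewrite addNr. Qed.

HB.instance Definition _ :=
  GRing.isZmodule.Build (fps K) fps_addA fps_addC fps_add0 fps_addN.

Definition fps_trunc (m : nat) a : {poly K} := \poly_(i < m.+1) fcoef a i.

Lemma coef_fps_mul (m n : nat) a b : (n <= m)%N ->
  fcoef (fps_mul a b) n = (fps_trunc m a * fps_trunc m b)`_n.
Proof.
move=> nm; rewrite coefM /=; apply: eq_bigr => i _.
have im : (i <= m)%N := leq_trans (leq_ord i) nm.
by rewrite !coef_poly !ltnS im (leq_trans (leq_subr _ _) nm).
Qed.

Lemma fps_truncE (m n : nat) a : (n <= m)%N -> (fps_trunc m a)`_n = fcoef a n.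
Proof. by move=> nm; rewrite coef_poly ltnS nm. Qed.

Fact fps_mulA : associative fps_mul.
Proof.
move=> a b c; apply/fpsP => n.
transitivity ((fps_trunc n a * (fps_trunc n b * fps_trunc n c))`_n).
  rewrite coefM /=; apply: eq_bigr => i _.
  rewrite (fps_truncE _ (leq_ord i)); congr (_ * _).
  exact: coef_fps_mul (leq_subr i n).
rewrite mulrA coefM /=; apply: eq_bigr => i _.
by rewrite (fps_truncE _ (leq_subr i n)) -(coef_fps_mul _ _ (leq_ord i)).
Qed.

Fact fps_mulC : commutative fps_mul.
Proof.
by move=> a b; apply/fpsP => n; rewrite !(coef_fps_mul _ _ (leqnn n)) mulrC.
Qed.

Fact fps_mul1 : left_id (fpsC 1) fps_mul.
Proof.
move=> a; apply/fpsP => n /=; rewrite big_ord_recl /= mul1r subn0.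
by rewrite big1 ?addr0 // => i _; rewrite mul0r.
Qed.

Fact fps_mulDl : left_distributive fps_mul fps_add.
Proof.
move=> a b c; apply/fpsP => n /=; rewrite -big_split /=.
by apply: eq_bigr => i _; rewrite mulrDl.
Qed.

Fact fps_1_neq0 : fpsC 1 != 0.
Proof.
by apply/eqP => /(congr1 (fun a => fcoef a 0)) /eqP; rewrite /= oner_eq0.
Qed.

HB.instance Definition _ := GRing.Zmodule_isComNzRing.Build (fps K)
  fps_mulA fps_mulC fps_mul1 fps_mulDl fps_1_neq0.

Lemma fcoef0 n : fcoef (0 : fps K) n = 0. Proof. by rewrite /= if_same. Qed.
Lemma fcoef1 n : fcoef (1 : fps K) n = (n == 0%N)%:R.
Proof. by rewrite /=; case: eqP. Qed.
Lemma fcoefD a b n : fcoef (a + b) n = fcoef a n + fcoef b n.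
Proof. by []. Qed.
Lemma fcoefN a n : fcoef (- a) n = - fcoef a n. Proof. by []. Qed.
Lemma fcoefB a b n : fcoef (a - b) n = fcoef a n - fcoef b n.
Proof. by []. Qed.
Lemma fcoefM a b n :
  fcoef (a * b) n = \sum_(i < n.+1) fcoef a i * fcoef b (n - i).
Proof. by []. Qed.
Lemma fcoefCM x a n : fcoef (fpsC x * a) n = x * fcoef a n.
Proof.
rewrite fcoefM big_ord_recl /= subn0 big1 ?addr0 // => i _.
by rewrite mul0r.
Qed.
Lemma fcoef_sum (I : Type) (r : seq I) (P : pred I) (F : I -> fps K) n :
  fcoef (\sum_(i <- r | P i) F i) n = \sum_(i <- r | P i) fcoef (F i) n.
Proof.
exact: (big_morph (fun a => fcoef a n) (fun a b => fcoefD a b n) (fcoef0 n)).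
Qed.

Lemma fpsCM : {morph fpsC : x y / x * y}.
Proof.
by move=> x y; apply/fpsP => n; rewrite fcoefCM /=; case: eqP; rewrite ?mulr0.
Qed.

Lemma fcoefXr_small a m n : fcoef a 0 = 0 -> (n < m)%N -> fcoef (a ^+ m) n = 0.
Proof.
move=> a0; elim: m n => // m IHm n; rewrite ltnS => nm.
rewrite exprS fcoefM big_ord_recl a0 mul0r add0r big1 // => i _.
rewrite IHm ?mulr0 //= /bump /= add1n (leq_trans _ nm) //.
by case: n i nm => [[]//|n] i nm; rewrite subSS ltnS leq_subr.
Qed.

(* With x the constant coefficient of a, this is the coefficient of
   x^-1 * \sum_m (1 - x^-1 a) ^+ m. *)
Definition fps_inv a :=
  if fcoef a 0 == 0 then a else
  Fps (fun n => (fcoef a 0)^-1 *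
    \sum_(m < n.+1) fcoef ((1 - fpsC (fcoef a 0)^-1 * a) ^+ m) n).

Definition fps_unit : pred (fps K) := fun a => fcoef a 0 != 0.

Fact fps_mulVr : {in fps_unit, left_inverse 1 fps_inv *%R}.
Proof.
move=> a; rewrite unfold_in => a0; apply/fpsP => n.
rewrite /fps_inv (negPf a0).
set u := 1 - _.
have u0 : fcoef u 0 = 0.
  by rewrite fcoefB fcoefCM mulVf // fcoef1 subrr.
have trunc_geom j : (j <= n)%N ->
    \sum_(m < j.+1) fcoef (u ^+ m) j = fcoef (\sum_(m < n.+1) u ^+ m) j.
  move=> jn; rewrite fcoef_sum (big_ord_widen_cond n.+1 xpredT
    (fun m => fcoef (u ^+ m) j)) ?ltnS // [RHS](bigID (fun m : 'I__ => (m < j.+1)%N)) /=.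
  rewrite [X in _ = _ + X]big1 ?addr0 // => m.
  by rewrite -leqNgt => jm; rewrite fcoefXr_small.
transitivity (fcoef ((\sum_(m < n.+1) u ^+ m) * (fpsC (fcoef a 0)^-1 * a)) n).
  rewrite mulrCA fcoefCM !fcoefM big_distrr /=; apply: eq_bigr => i _.
  by rewrite (trunc_geom _ (leq_ord i)) mulrA.
have -> : fpsC (fcoef a 0)^-1 * a = 1 - u by rewrite /u opprB addrC subrK.
rewrite mulrC -opprB mulNr -subrX1 opprB fcoefB fcoefXr_small //.
by rewrite subr0.
Qed.

Fact fps_unitPl a b : b * a = 1 -> fps_unit a.
Proof.
move=> /(congr1 (fun c => fcoef c 0)); rewrite fcoefM big_ord1 fcoef1 /=.
move=> ba; apply/eqP => a0; move: ba; rewrite a0 mulr0 => /eqP.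
by rewrite eq_sym oner_eq0.
Qed.

Fact fps_inv_out : {in [predC fps_unit], fps_inv =1 id}.
Proof. by move=> a; rewrite inE negbK /fps_inv => ->. Qed.

HB.instance Definition _ := GRing.ComNzRing_hasMulInverse.Build (fps K)
  fps_mulVr fps_unitPl fps_inv_out.

End FpsRing.

Notation "''t'" := (fpsX _) (at level 0) : ring_scope.

(* The family (F i) indexed by A is summable in K[[t]], with sum S. *)
Definition fps_has_sum (K : fieldType) (I : choiceType) (A : set I)
    (F : I -> fps K) (S : fps K) : Prop :=
  forall n, finite_set [set i | A i /\ fcoef (F i) n <> 0] /\
            \sum_(i \in A) fcoef (F i) n = fcoef S n.

(* Convergence for the t-adic topology of K[[t]]. *)
Definition fps_cvg_to (K : fieldType) (u : nat -> fps K) (S : fps K) : Prop :=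
  forall n, exists N, forall m, (N <= m)%N -> fcoef (u m) n = fcoef S n.

(** * The field of rational functions in q *)

Definition Qq : fieldType := {fraction {poly rat}}.
Definition qvar : Qq := tofrac 'X.

Definition Gq (M N : nat) : Qq :=
  (\prod_(1 <= i < (M + N).+1) (1 - qvar ^+ i)) /
  ((\prod_(1 <= i < M.+1) (1 - qvar ^+ i)) *
   (\prod_(1 <= i < N.+1) (1 - qvar ^+ i))).

(** * Good sequences *)

Definition hseq := {fsfun nat -> nat with 0%N}.

Definition hsize (H : hseq) : nat := (\sum_(i <- finsupp H) H i)%N.

Definition dval (H : hseq) (i : int) : int :=
  if i is Posz n then (H n)%:Z else 0.

Definition tau (k : nat) (i : int) : int := ((k%:Z %| i + 1)%Z : nat)%:Z.

Definition adiff (k : nat) (H : hseq) (i : int) : int :=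
  dval H i - dval H (i + 1) + tau k i.

(* The equality d_j = [j/k] + 1 holds for all indices j up to i; it always does
   at j = -1. *)
Definition full_upto (k : nat) (H : hseq) (i : int) : Prop :=
  -1 <= i /\ forall j : int, -1 <= j <= i -> dval H j = (j %/ k%:Z)%Z + 1.

(* "The largest i such that d_i = [i/k] + 1" is read as the largest i up to
   which this equality holds, as it does for the Hilbert function of a
   quasihomogeneous ideal, where an equality at i forces the equality at every
   j <= i.  Otherwise (0, 2, 0, ...) would be good for k = 1, and would
   contribute a spurious q^3 t^2.  For good sequences both readings of eta
   agree: see good_eta_largest. *)
Definition is_eta (k : nat) (H : hseq) (e : int) : Prop :=
  full_upto k H e /\ forall i, full_upto k H i -> i <= e.

Definition eta (k : nat) (H : hseq) : int := xget (-1) [set e | is_eta k H e].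

Definition good (k : nat) (H : hseq) : Prop :=
  forall i : int, eta k H <= i ->
    0 <= adiff k H i /\ dval H (i + 1) <= dval H (i + 1 - k%:Z).

(* Rational because of the factor k/2, but integral: see chi_nat. *)
Definition chi (k : nat) (H : hseq) : rat :=
  \sum_(i \in [set i : int | eta k H <= i])
    ((adiff k H i)%:~R *
     (k%:R / 2 * ((adiff k H i)%:~R - 1) +
      \sum_(1 <= j < k) (k - j)%:R * (adiff k H (i + j%:Z))%:~R) : rat).

(* On a good sequence both arguments of Gq are nonnegative (see
   good_Gq_args_ge0), so that the absolute values are harmless. *)
Definition Gprod (k : nat) (H : hseq) : Qq :=
  \big[*%R/1]_(i \in [set i : int | eta k H <= i])
    Gq (absz (adiff k H i)) (absz (dval H (i + 1) - dval H (i + 1 + k%:Z))%R).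

Lemma full_uptoN1 k H : (0 < k)%N -> full_upto k H (-1).
Proof.
move=> k0; split=> // j; rewrite -eq_le => /eqP <- /=.
by rewrite -[-1 : int]/(Negz 0) divNz_nat // div0n.
Qed.

Lemma full_uptoS k H (i : int) : full_upto k H i ->
  dval H (i + 1) = ((i + 1) %/ k%:Z)%Z + 1 -> full_upto k H (i + 1).
Proof.
move=> [i1 fi] di; split=> [|j /andP[j1 ji]]; first by lia.
have [->//|ne] := eqVneq j (i + 1).
by apply: fi; rewrite j1 /=; lia.
Qed.

Lemma is_eta_eta k H : (0 < k)%N -> is_eta k H (eta k H).
Proof.
move=> k0; apply: (@xgetPex _ (-1) [set e | is_eta k H e]).
pose P n := H n != (n %/ k).+1.
have exP : exists n, P n.
  exists (\max_(n <- finsupp H) n).+1; rewrite /P fsfun_dflt //.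
  by apply/negP => /(@leq_bigmax_seq _ _ xpredT id) /(_ isT); rewrite ltnn.
case: (ex_minnP exP) => n Pn minn; exists (n%:Z - 1) => /=; split; last first.
  move=> i [_ /(_ n%:Z)] fi; rewrite leNgt; apply/negP => ni.
  have : dval H n%:Z = (n%:Z %/ k%:Z)%Z + 1 by apply: fi; lia.
  rewrite /= divz_nat; move: Pn; rewrite /P => /eqP Pn e; apply: Pn; lia.
split=> [|[j|j] /andP[j1 jn]]; first by lia.
- have : ~~ P j by apply/negP => /minn; lia.
  by rewrite negbK => /eqP /= ->; rewrite divz_nat; lia.
- have [_] := full_uptoN1 H k0; apply; rewrite j1 /=.
  by case: j {j1 jn}.
Qed.

Lemma divz_tau k (i : int) : (0 < k)%N ->
  ((i + 1) %/ k%:Z)%Z = (i %/ k%:Z)%Z + tau k i.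
Proof.
move=> k0; have kz : (k%:Z != 0) by lia.
have := ltz_mod i kz; have := modz_ge0 i kz.
have := divz_eq i k%:Z; rewrite /tau.
move: (i %/ k%:Z)%Z (i %% k%:Z)%Z => m r -> r0 rk.
rewrite -addrA divzMDl //; congr (_ + _).
have -> : (k%:Z %| m * k%:Z + (r + 1))%Z = (k%:Z %| r + 1)%Z.
  by apply/dvdz_mod0P/dvdz_mod0P; rewrite modzMDl.
have [->|rk1] := eqVneq (r + 1) k%:Z; first by rewrite divzz dvdzz kz.
have rlt : 0 <= r + 1 < `|k%:Z| by lia.
rewrite divz_small //.
suff /negPf -> : ~~ (k%:Z %| r + 1)%Z by [].
by apply/dvdz_mod0P; rewrite modz_small //; lia.
Qed.

Lemma good_eta_largest k H : (0 < k)%N -> good k H ->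
  dval H (eta k H) = (eta k H %/ k%:Z)%Z + 1 /\
  forall i : int, eta k H < i -> dval H i < (i %/ k%:Z)%Z + 1.
Proof.
move=> k0 gH; have [full_e max_e] := is_eta_eta H k0.
have [e1 fe] := full_e.
have de : dval H (eta k H) = (eta k H %/ k%:Z)%Z + 1 by apply: fe; rewrite e1 /=.
split=> // i ei.
have -> : i = eta k H + 1 + (absz (i - (eta k H + 1))%R)%:Z by lia.
elim: (absz _) => [|n IHn].
  rewrite addr0 lt_neqAle; apply/andP; split.
    by apply/eqP => /(full_uptoS full_e) /max_e; lia.
  have [+ _] := gH _ (lexx _); rewrite /adiff divz_tau //; lia.
move: IHn; set j := _ + n%:Z => dj.
have -> : eta k H + 1 + n.+1%:Z = j + 1 by rewrite /j; lia.
have [|+ _] := gH j; first by rewrite /j; lia.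
by rewrite /adiff divz_tau //; lia.
Qed.

Lemma good_Gq_args_ge0 k H (i : int) : good k H -> eta k H <= i ->
  0 <= adiff k H i /\ 0 <= dval H (i + 1) - dval H (i + 1 + k%:Z).
Proof.
move=> gH ei; split; first by have [] := gH i ei.
have [|_] := gH (i + k%:Z); first by lia.
by rewrite addrAC addrK subr_ge0.
Qed.

Lemma chi_nat k H : good k H -> chi k H \is a Num.nat.
Proof.
move=> gH; rewrite /chi big_seq; apply: rpred_sum => i.
case: finite_supportP => // X XA _ _ /XA /= ei.
have a_ge0 j : (eta k H <= j)%R -> exists n : nat, adiff k H j = n%:Z.
  by move=> /gH[+ _]; case: (adiff k H j) => // n _; exists n.
rewrite mulrDr; apply: rpredD; last first.
  have [n ->] := a_ge0 i ei; apply: rpredM; first exact: natr_nat.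
  apply: rpred_sum => j _; apply: rpredM; first exact: natr_nat.
  by have [|m ->] := a_ge0 (i + j%:Z); [lia|exact: natr_nat].
have [[|n] ->] := a_ge0 i ei; first by rewrite mul0r rpred0.
suff -> : n.+1%:~R * (k%:R / 2 * (n.+1%:~R - 1)) = (k * 'C(n.+1, 2))%:R :> rat.
  exact: natr_nat.
have e2 : 2 * ('C(n.+1, 2))%:R = n.+1%:R * n%:R :> rat.
  by rewrite -!natrM -mul_bin_diag bin1.
have -> : n.+1%:~R - 1 = n%:R :> rat by rewrite -pmulrn -natr1 addrK.
rewrite -pmulrn natrM; apply: (@mulfI _ 2) => //.
by rewrite [RHS]mulrCA e2; field.
Qed.

(* Main.v *)
(** The boundary of a Young diagram is a word in vertical and horizontal steps.
    Give vertical steps the effect [+s] and horizontal steps the effect [-r] on a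
    level, and call class the set of words whose steps of each kind start at the
    same levels, with multiplicity.  A word of a class is an Eulerian trail in a
    multigraph on the levels, so a q-analogue of the BEST theorem evaluates, as a
    determinant, the sum over a class of [q] to the number of pairs (vertical
    step, later horizontal step) starting at the same level; these pairs are the
    boxes with [r a = s (l + 1)], where [a] and [l] are the arm and the leg.
    Reversing the words replaces them by the boxes with [s l = r (a + 1)], and
    the Laplacian by a matrix which is diagonally conjugate to its transpose:
    both statistics have the same distribution on each class.  The area and the
    number of boxes with [a / (l + 1) < s / r < (a + 1) / l] are constant on
    classes, hence the numbers of boxes with [a / (l + 1) <= s / r < (a + 1) / l]
    and with [a / (l + 1) < s / r <= (a + 1) / l] are equidistributed among the
    diagrams of area [n].  Since the former count at a slope is the latter count
    at the next fraction with bounded terms, the distribution does not depend on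
    the slope, and for small slopes only the boxes with [a = 0], one in each row,
    are counted.  This gives the product.

    For [r = 1] and [s = k] the level sets of a diagram define a Hilbert function,
    which is a good sequence, and the good sequences correspond to the classes.
    The constant statistic is [chi], and the determinant, which a unitriangular
    change of basis makes triangular, gives the product of the [Gq]. *)

Require Import Defs.
From HB Require Import structures.
From mathcomp Require Import all_boot all_order all_algebra finmap.
From mathcomp Require Import all_classical.
From mathcomp Require Import zify ring.

Set Implicit Arguments.
Unset Strict Implicit.
Unset Printing Implicit Defensive.

Import Order.TTheory GRing.Theory Num.Theory.
Local Open Scope ring_scope.

(** * Walks and a q-analogue of the BEST theorem *)

Fixpoint words n : seq bitseq :=
  if n is m.+1 then map (cons true) (words m) ++ map (cons false) (words m)
  else [:: [::]].

Lemma mem_words n w : (w \in words n) = (size w == n).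
Proof.
elim: n w => [|n IHn] w /=; first by rewrite inE size_eq0.
rewrite mem_cat; case: w => [|b w].
  by rewrite [RHS]/=; apply/orP => -[] /mapP[].
rewrite eqSS -IHn; case: b; rewrite ?mem_map; try by move=> ? ? [].
- by case: mapP => [[? _ []]//|]; rewrite orbF.
- by case: mapP => [[? _ []]//|].
Qed.

Lemma uniq_words n : uniq (words n).
Proof.
elim: n => //= n IHn; rewrite cat_uniq !map_inj_uniq ?IHn ?andbT /=; last 2 first.
- by move=> ? ? [].
- by move=> ? ? [].
by apply/hasPn => w /mapP[u _ ->]; apply/mapP => -[].
Qed.

Section Walk.
Variables (T : eqType) (a b : T -> T).

(* A word is read as a walk: the letter [true] moves along [a] and [false]
   along [b]; [atails] and [btails] list the points where these letters are
   read, and [tailinv] counts the pairs of a letter [true] and a later letter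
   [false] read at the same point. *)
Fixpoint atails (w : bitseq) (x : T) : seq T :=
  if w is c :: w' then
    if c then x :: atails w' (a x) else atails w' (b x)
  else [::].
Fixpoint btails (w : bitseq) (x : T) : seq T :=
  if w is c :: w' then
    if c then btails w' (a x) else x :: btails w' (b x)
  else [::].
Fixpoint endp (w : bitseq) (x : T) : T :=
  if w is c :: w' then endp w' (if c then a x else b x) else x.
Fixpoint tailinv (w : bitseq) (x : T) : nat :=
  if w is c :: w' then
    if c then (count_mem x (btails w' (a x)) + tailinv w' (a x))%N
    else tailinv w' (b x)
  else 0%N.
End Walk.

(** The q-Pochhammer symbol (q; q)_n, which is the q-factorial times [(1 - q) ^+ n]; it keeps the
    identities free of denominators. *)
Definition qfac (F : comNzRingType) (q : F) n := \prod_(1 <= i < n.+1) (1 - q ^+ i).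

Lemma qfacS (F : comNzRingType) (q : F) n : qfac q n.+1 = qfac q n * (1 - q ^+ n.+1).
Proof. by rewrite /qfac big_nat_recr. Qed.

Lemma qfac_pred (F : comNzRingType) (q : F) n : (0 < n)%N -> qfac q n = qfac q n.-1 * (1 - q ^+ n).
Proof. by case: n => // n _; rewrite qfacS. Qed.

Section BEST.
Variables (F : fieldType) (q : F) (N : nat) (a b : 'I_N -> 'I_N).
Implicit Types (A B : 'I_N -> nat) (x y v : 'I_N).

(** The words of a class are the trails from [x] using all of the [A v] parallel edges from [v] to
    [a v] and [B v] edges from [v] to [b v], parallel edges being indistinguishable. *)
Definition incls A B (w : bitseq) x :=
  [forall v, (count_mem v (atails a b w x) == A v)
          && (count_mem v (btails a b w x) == B v)].

Definition clsum n A B x : F :=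
  \sum_(w <- words n | incls A B w x) q ^+ tailinv a b w x.

Definition decr A x v := (A v - (x == v))%N.

Lemma incls_true A B w x : (0 < A x)%N ->
  incls A B (true :: w) x = incls (decr A x) B w (a x).
Proof.
move=> Ax; apply: eq_forallb => v; congr (_ && _).
by rewrite /= /decr; have [<-|] := eqVneq x v; lia.
Qed.

Lemma incls_false A B w x : (0 < B x)%N ->
  incls A B (false :: w) x = incls A (decr B x) w (b x).
Proof.
move=> Ax; apply: eq_forallb => v; congr (_ && _).
by rewrite /= /decr; have [<-|] := eqVneq x v; lia.
Qed.

Lemma incls_true0 A B w x : A x = 0%N -> incls A B (true :: w) x = false.
Proof.
by move=> Ax; apply/negP => /forallP/(_ x)/andP[]; rewrite Ax /= eqxx.
Qed.

Lemma incls_false0 A B w x : B x = 0%N -> incls A B (false :: w) x = false.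
Proof.
by move=> Ax; apply/negP => /forallP/(_ x)/andP[]; rewrite Ax /= eqxx.
Qed.

(** Split on the first letter. A first letter [true] at [x] precedes all [B x] letters [false] read
    at [x], whence the factor [q ^+ B x]. *)
Lemma clsumS n A B x :
  clsum n.+1 A B x =
    (if (0 < A x)%N then q ^+ B x * clsum n (decr A x) B (a x) else 0) +
    (if (0 < B x)%N then clsum n A (decr B x) (b x) else 0).
Proof.
rewrite /clsum /= big_cat !big_map /=; congr (_ + _).
- case: posnP => [A0|Apos].
    by rewrite big1 // => w; rewrite incls_true0.
  rewrite [RHS]big_distrr; apply: eq_big => [w|w]; first exact: incls_true.
  by move=> /forallP/(_ x)/andP[_ /eqP /= ->]; rewrite exprD.
- case: posnP => [A0|Apos].
    by rewrite big1 // => w; rewrite incls_false0.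
  by apply: eq_bigl => w; exact: incls_false.
Qed.

Definition indeg A B v :=
  (\sum_(u | a u == v) A u + \sum_(u | b u == v) B u)%N.

Definition balanced A B x y :=
  forall v, (indeg A B v + (x == v) = A v + B v + (y == v))%N.

Definition nedges A B := (\sum_v (A v + B v))%N.

Lemma sum_decr (P : pred 'I_N) A x : (0 < A x)%N ->
  (\sum_(u | P u) decr A x u + P x = \sum_(u | P u) A u)%N.
Proof.
move=> Ax; case Px: (P x); last first.
  rewrite addn0; apply: eq_bigr => u Pu; rewrite /decr.
  by have [xu|] := eqVneq x u; [rewrite xu Pu in Px|rewrite subn0].
rewrite (bigD1 x) //= [RHS](bigD1 x) //= /decr eqxx.
rewrite (eq_bigr (fun i => A i)); first by lia.
by move=> i /andP[_ /negPf]; rewrite eq_sym => ->; rewrite subn0.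
Qed.

Lemma balanced_a A B x y : (0 < A x)%N -> balanced A B x y ->
  balanced (decr A x) B (a x) y.
Proof.
move=> Ax H v; have := H v; rewrite /indeg -(sum_decr _ Ax) /decr.
by have [<-|] := eqVneq x v; have [|] := eqVneq (a x) v; lia.
Qed.

Lemma balanced_b A B x y : (0 < B x)%N -> balanced A B x y ->
  balanced A (decr B x) (b x) y.
Proof.
move=> Ax H v; have := H v; rewrite /indeg -(sum_decr (fun u => b u == v) Ax) /decr.
by have [<-|] := eqVneq x v; have [|] := eqVneq (b x) v; lia.
Qed.

Lemma nedges_a A B x : (0 < A x)%N -> nedges A B = (nedges (decr A x) B).+1.
Proof.
move=> Ax; rewrite /nedges !big_split /=.
by have := sum_decr xpredT Ax; rewrite /=; lia.
Qed.

Lemma nedges_b A B x : (0 < B x)%N -> nedges A B = (nedges A (decr B x)).+1.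
Proof.
move=> Ax; rewrite /nedges !big_split /=.
by have := sum_decr xpredT Ax; rewrite /=; lia.
Qed.

(* Laplacian with the root [y] removed. Points without outgoing edges are
   removed as well, by giving them the row of the identity matrix. *)
Definition lap A B y : 'M[F]_N :=
  \matrix_(v, u)
    if (v == y) || (u == y) || (A v + B v == 0)%N then (v == u)%:R else
    (1 - q ^+ (A v + B v)) * (v == u)%:R
    - (1 - q ^+ A v) * (a v == u)%:R
    - q ^+ A v * (1 - q ^+ B v) * (b v == u)%:R.

Lemma lap_row A B A' B' y (x : 'I_N) : (forall v, v != x -> A v = A' v) ->
  (forall v, v != x -> B v = B' v) ->
  row' x (lap A B y) = row' x (lap A' B' y).
Proof.
move=> eA eB; apply/matrixP => i j; rewrite !mxE.
by rewrite eA ?eB // eq_sym neq_lift.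
Qed.

Lemma decr_ne A x v : v != x -> decr A x v = A v.
Proof. by rewrite /decr eq_sym => /negPf ->; rewrite subn0. Qed.

Lemma decr_xx A x : decr A x x = (A x).-1.
Proof. by rewrite /decr eqxx subn1. Qed.

(** Vertex factor of the BEST theorem. Away from the root the last exit belongs to the arborescence
    counted by the determinant, whence the predecessor; its truncation gives 1 at vertices without
    outgoing edges. *)
Definition vfac A B y : F :=
  qfac q (A y + B y) * \prod_(v | v != y) qfac q (A v + B v).-1.

(** Up to powers of [1 - q], the q-analogue of the number of permutations of parallel edges, by
    which trails with labelled edges overcount words. *)
Definition efac A B : F := \prod_v (qfac q (A v) * qfac q (B v)).

Lemma efac_a A B x : (0 < A x)%N ->
  efac A B = efac (decr A x) B * (1 - q ^+ A x).
Proof.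
move=> Ax; rewrite /efac (bigD1 x) //= [X in _ = X * _](bigD1 x) //=.
rewrite (qfac_pred _ Ax) decr_xx.
have -> : \prod_(i | i != x) (qfac q (decr A x i) * qfac q (B i)) =
   \prod_(i | i != x) (qfac q (A i) * qfac q (B i)).
  by apply: eq_bigr => i ix; rewrite decr_ne.
by ring.
Qed.

Lemma efac_b A B x : (0 < B x)%N ->
  efac A B = efac A (decr B x) * (1 - q ^+ B x).
Proof.
move=> Ax; rewrite /efac (bigD1 x) //= [X in _ = X * _](bigD1 x) //=.
rewrite (qfac_pred _ Ax) decr_xx.
have -> : \prod_(i | i != x) (qfac q (A i) * qfac q (decr B x i)) =
   \prod_(i | i != x) (qfac q (A i) * qfac q (B i)).
  by apply: eq_bigr => i ix; rewrite decr_ne.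
by ring.
Qed.

Lemma det_col0 (M : 'M[F]_N) (x : 'I_N) : (forall i, M i x = 0) -> \det M = 0.
Proof. by move=> M0; rewrite (expand_det_col _ x) big1 // => i _; rewrite M0 mul0r. Qed.

Definition setrow (M : 'M[F]_N) (x : 'I_N) (r : 'I_N -> F) : 'M[F]_N :=
  \matrix_(i, j) if i == x then r j else M i j.

Lemma row'_setrow M x r : row' x (setrow M x r) = row' x M.
Proof. by apply/matrixP => i j; rewrite !mxE eq_sym (negPf (neq_lift _ _)). Qed.

Lemma det_eq0_ker (M : 'M[F]_N) (th : 'I_N -> F) (z : 'I_N) : th z != 0 ->
  (forall i, \sum_j M i j * th j = 0) -> \det M = 0.
Proof.
move=> thz M0; apply/eqP; rewrite -det_tr; apply/det0P.
exists (\row_j th j).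
  by apply/eqP => /matrixP/(_ ord0 z); rewrite !mxE => /eqP; rewrite (negPf thz).
apply/matrixP => i j; rewrite !mxE -[RHS](M0 j); apply: eq_bigr => k _.
by rewrite !mxE mulrC.
Qed.

(* A vertex all of whose outgoing edges have been used no longer receives
   edges, so its column is trivial. *)
Lemma det_lap_last A B A' B' (x y : 'I_N) :
  x != y -> (A x + B x = 1)%N -> (A' x + B' x = 0)%N ->
  (forall v, v != x -> A v = A' v) -> (forall v, v != x -> B v = B' v) ->
  indeg A B x = 0%N ->
  \det (lap A B y) = (1 - q) * \det (lap A' B' y).
Proof.
move=> xy n1 n0 eA eB in0.
have inA v : A v != 0%N -> a v != x.
  move=> Av; apply/eqP => avx; move: in0 => /eqP; rewrite addn_eq0 => /andP[].
  by rewrite sum_nat_eq0 => /forallP/(_ v); rewrite avx eqxx /= (negPf Av).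
have inB v : B v != 0%N -> b v != x.
  move=> Av; apply/eqP => avx; move: in0 => /eqP; rewrite addn_eq0 => /andP[_].
  by rewrite sum_nat_eq0 => /forallP/(_ v); rewrite avx eqxx /= (negPf Av).
(* Row [x] is [1 - q] times the identity row plus a remainder [r] vanishing in column [x]. With [r]
   as row [x] the whole column [x] is zero, as no edge enters [x], and the determinant vanishes. *)
pose r j : F := lap A B y x j - (1 - q) * (x == j)%:R.
rewrite (@determinant_multilinear _ _ (lap A B y) (lap A' B' y)
  (setrow (lap A B y) x r) x (1 - q) 1); last 3 first.
- apply/matrixP => i j; rewrite !mxE eqxx n0 eqxx orbT /r !mxE n1.
  by ring.
- by apply/esym/lap_row.
- by rewrite row'_setrow.
rewrite (@det_col0 (setrow _ _ _) x) ?mulr0 ?addr0 // => i.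
have colx v : A v != 0%N \/ A v = 0%N by case: eqP; [right|left].
have cA v : (1 - q ^+ A v) * (a v == x)%:R = 0.
  case: (colx v) => [/inA/negPf ->|->]; first by rewrite mulr0.
  by rewrite expr0 subrr mul0r.
have cB v : q ^+ A v * (1 - q ^+ B v) * (b v == x)%:R = 0.
  have [->|/inB/negPf ->] := eqVneq (B v) 0%N; last by rewrite mulr0.
  by rewrite expr0 subrr mulr0 mul0r.
rewrite mxE; case: (eqVneq i x) => [ix|ix].
  rewrite /r !mxE (negPf xy) n1 /= eqxx !cA !cB; ring.
by rewrite !mxE (negPf ix) cA cB mulr0 !subr0 if_same.
Qed.

(** Only row [x] depends on [A x] and [B x], and its entries satisfy the same linear relation; the
    determinant is linear in this row. *)
Lemma det_lap_step A B x y : x != y -> (1 < A x + B x)%N ->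
  (1 - q ^+ (A x + B x).-1) * \det (lap A B y) =
   q ^+ B x * (1 - q ^+ A x) * \det (lap (decr A x) B y) +
   (1 - q ^+ B x) * \det (lap A (decr B x) y).
Proof.
move=> xy n2.
set c := 1 - q ^+ _.
set R := setrow (lap A B y) x (fun j => c * lap A B y x j).
transitivity (\det R).
  rewrite (@determinant_multilinear _ _ R (lap A B y) (lap A B y) x c 0) //.
  - by rewrite mul0r addr0.
  - by apply/matrixP => i j; rewrite !mxE eqxx; ring.
  - by rewrite row'_setrow.
  - by rewrite row'_setrow.
apply: (@determinant_multilinear _ _ R _ _ x).
- apply/matrixP => i j; rewrite !mxE eqxx /decr eqxx (negPf xy) /=.
  case: (eqVneq j y) => [jy|jy] /=.
    by rewrite jy (negPf xy) !mulr0 addr0.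
  have -> : (A x + B x == 0)%N = false by lia.
  rewrite /c.
  case EA: (A x) n2 => [|A'] n2.
    case EB: (B x) n2 => [|B'] n2; first by [].
    rewrite !add0n /= ?subn1 /= !expr0.
    have -> : (B' == 0)%N = false by lia.
    by ring.
  case EB: (B x) n2 => [|B'] n2.
    rewrite !addn0 !expr0 ?subn1 /=.
    have -> : (A' == 0)%N = false by lia.
    by ring.
  rewrite !subn1 /= !addSn !addnS /=.
  by rewrite !exprS !exprD; ring.
- by rewrite row'_setrow; apply/esym/lap_row => // v vx; rewrite decr_ne.
- by rewrite row'_setrow; apply/esym/lap_row => // v vx; rewrite decr_ne.
Qed.

Lemma vfac_decr A B A' B' x y : x != y ->
  (A x + B x = (A' x + B' x).+1)%N ->
  (forall v, v != x -> A v = A' v) -> (forall v, v != x -> B v = B' v) ->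
  vfac A B y = vfac A' B' y * (if (A x + B x == 1)%N then 1 else 1 - q ^+ (A x + B x).-1).
Proof.
move=> xy nx eA eB.
have yx : y != x by rewrite eq_sym.
rewrite /vfac -(eA y yx) -(eB y yx) (bigD1 x) //=.
rewrite [X in _ = _ * X * _](bigD1 x) //=.
rewrite (eq_bigr (fun v => qfac q (A' v + B' v).-1)); last first.
  by move=> v /andP[_ vx]; rewrite eA ?eB.
rewrite nx /= eqSS; case: (posnP (A' x + B' x)) => [->|p].
  by rewrite /=; ring.
by rewrite (qfac_pred _ p); ring.
Qed.

Lemma vfac_ext A B A' B' y : (forall v, A v + B v = A' v + B' v)%N ->
  vfac A B y = vfac A' B' y.
Proof. by move=> e; rewrite /vfac e; congr (_ * _); apply: eq_bigr => v _; rewrite e. Qed.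

Lemma vfac_root A B A' B' y :
  (A y + B y = (A' y + B' y).+1)%N ->
  (forall v, v != y -> A v = A' v) -> (forall v, v != y -> B v = B' v) ->
  vfac A B y = vfac A' B' y * (1 - q ^+ (A y + B y)).
Proof.
move=> nx eA eB; rewrite /vfac nx qfacS.
rewrite (eq_bigr (fun v => qfac q (A' v + B' v).-1)); first by ring.
by move=> v vx; rewrite eA ?eB.
Qed.

Lemma det_lap_root A B A' B' y :
  (forall v, v != y -> A v = A' v) -> (forall v, v != y -> B v = B' v) ->
  lap A B y = lap A' B' y.
Proof.
move=> eA eB; apply/matrixP => i j; rewrite !mxE.
by case: (eqVneq i y) => //= iy; rewrite eA ?eB.
Qed.

(** Induction on the number of edges: the first letter removes an edge at [x], and the right-hand
    side obeys the recursion of [clsumS], by [det_lap_step] in the generic case. Stated without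
    division, the formula holds for every [q]. *)
Theorem q_best n A B x y : balanced A B x y -> nedges A B = n ->
  clsum n A B x * efac A B = vfac A B y * \det (lap A B y).
Proof.
elim: n A B x => [|n IHn] A B x bal tot.
  have AB0 v : A v = 0%N /\ B v = 0%N.
    move/eqP: tot; rewrite sum_nat_eq0 => /forallP/(_ v)/=.
    by rewrite addn_eq0 => /andP[/eqP -> /eqP ->].
  have -> : lap A B y = 1%:M.
    apply/matrixP => i j; rewrite !mxE.
    by have [-> ->] := AB0 i; rewrite orbT.
  rewrite det1 mulr1 /efac /vfac !big1.
  - rewrite /clsum /= big_cons big_nil.
    have -> : incls A B [::] x.
      by apply/forallP => v; have [-> ->] := AB0 v.
    by have [-> ->] := AB0 y; rewrite /qfac big_geq //= expr0 addr0.
  - by move=> v _; have [-> ->] := AB0 v; rewrite /qfac big_geq.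
  - by move=> v _; have [-> ->] := AB0 v; rewrite /qfac big_geq // mulr1.
have stepE : clsum n.+1 A B x * efac A B =
   q ^+ B x * (1 - q ^+ A x) * (vfac (decr A x) B y * \det (lap (decr A x) B y)) +
   (1 - q ^+ B x) * (vfac A (decr B x) y * \det (lap A (decr B x) y)).
  rewrite clsumS mulrDl; congr (_ + _).
    case: posnP => [->|p]; first by rewrite expr0 subrr; ring.
    rewrite (efac_a _ p) -(IHn _ _ (a x)); first by ring.
      exact: balanced_a.
    by move: tot; rewrite (nedges_a _ p) => -[].
  case: posnP => [->|p]; first by rewrite expr0 subrr; ring.
  rewrite (efac_b _ p) -(IHn _ _ (b x)); first by ring.
    exact: balanced_b.
  by move: tot; rewrite (nedges_b _ p) => -[].
have dA v : v != x -> A v = decr A x v by move=> vx; rewrite decr_ne.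
have dB v : v != x -> B v = decr B x v by move=> vx; rewrite decr_ne.
(* If no edge leaves [x] although edges remain, then [x = y] by balance and the class is empty: the
   determinant has to vanish. *)
have [nx0|nx0] := posnP (A x + B x).
  have xy : x = y.
    by have := bal x; have [//|] := eqVneq y x; rewrite eqxx; lia.
  subst y; have [A0 B0] : A x = 0%N /\ B x = 0%N by lia.
  rewrite stepE A0 B0 expr0 subrr; set d := \det (lap A B x).
  suff -> : d = 0 by ring.
  have [z nz] : exists z, (0 < A z + B z)%N.
    apply/existsP; rewrite -[X in is_true X]negbK negb_exists; apply/negP.
    move=> /forallP H; move: tot; rewrite /nedges big1 // => v _.
    by have := H v; lia.
  (* The indicator of the vertices with outgoing edges is in the kernel: by balance a used edge
     leads to such a vertex, and the coefficients of its row sum to zero. *)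
  apply: (@det_eq0_ker _ (fun v => (0 < A v + B v)%N%:R) z).
    by rewrite nz oner_eq0.
  move=> i.
  have inA v : (0 < A v -> 0 < A (a v) + B (a v))%N.
    move=> Av; have := bal (a v); rewrite /indeg (bigD1 v) //=; lia.
  have inB v : (0 < B v -> 0 < A (b v) + B (b v))%N.
    move=> Av; have := bal (b v); rewrite /indeg.
    by rewrite (bigD1 (P := fun u => b u == b v) v) //=; lia.
  case: (eqVneq i x) => [iy|iy].
    rewrite (bigD1 i) //= !mxE iy nx0 mulr0 add0r big1 // => j.
    by rewrite mxE eqxx /= eq_sym => /negPf ->; rewrite mul0r.
  have [ni|ni] := posnP (A i + B i).
    rewrite (bigD1 i) //= !mxE ni mulr0 add0r big1 // => j.
    by rewrite mxE ni eqxx orbT eq_sym => /negPf ->; rewrite mul0r.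
  have pt (u : 'I_N) (c : F) : \sum_j c * (u == j)%:R * (0 < A j + B j)%N%:R = c * (0 < A u + B u)%N%:R.
    rewrite (bigD1 u) //= eqxx mulr1 big1 ?addr0 // => j.
    by rewrite eq_sym => /negPf ->; rewrite mulr0 mul0r.
  rewrite (eq_bigr (fun j => (1 - q ^+ (A i + B i)) * (i == j)%:R * (0 < A j + B j)%N%:R
    + (- (1 - q ^+ A i) * (a i == j)%:R * (0 < A j + B j)%N%:R
    + (- (q ^+ A i * (1 - q ^+ B i)) * (b i == j)%:R * (0 < A j + B j)%N%:R)))); last first.
    move=> j _; rewrite mxE (negPf iy) gtn_eqF //=.
    case: (eqVneq j x) => [->|_] /=; last by ring.
    by rewrite nx0 ltnn !mulr0 !addr0.
  rewrite !big_split /= !pt ni !mulNr.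
  have -> : (1 - q ^+ A i) * (0 < A (a i) + B (a i))%N%:R = 1 - q ^+ A i.
    case: (posnP (A i)) => [->|/inA ->]; first by rewrite expr0 subrr mul0r.
    by rewrite mulr1.
  have -> : q ^+ A i * (1 - q ^+ B i) * (0 < A (b i) + B (b i))%N%:R =
      q ^+ A i * (1 - q ^+ B i).
    case: (posnP (B i)) => [->|/inB ->]; first by rewrite expr0 subrr mulr0 mul0r.
    by rewrite mulr1.
  by rewrite exprD mulr1n; ring.
have eAB : (0 < A x)%N -> (0 < B x)%N ->
    vfac (decr A x) B y = vfac A (decr B x) y.
  move=> p p'; apply: vfac_ext => v; rewrite /decr.
  by have [<-|] := eqVneq x v; lia.
(* At the root the Laplacian ignores [A x] and [B x], so that only the vertex factor changes. *)
case: (eqVneq x y) => [xy|xy].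
  subst y; rewrite stepE.
  have -> : lap (decr A x) B x = lap A B x by apply: det_lap_root => // v /decr_ne ->.
  have -> : lap A (decr B x) x = lap A B x by apply: det_lap_root => // v /decr_ne ->.
  have ha : (0 < A x)%N -> vfac A B x = vfac (decr A x) B x * (1 - q ^+ (A x + B x)).
    by move=> p; apply: vfac_root => //; rewrite decr_xx; lia.
  have hb : (0 < B x)%N -> vfac A B x = vfac A (decr B x) x * (1 - q ^+ (A x + B x)).
    by move=> p; apply: vfac_root => //; rewrite decr_xx; lia.
  have [A0|Ap] := posnP (A x).
    by rewrite hb ?A0 ?expr0 ?add0n; [ring|lia].
  rewrite ha //; have [B0|Bp] := posnP (B x).
    by rewrite B0 expr0 addn0; ring.
  by rewrite eAB // exprD; ring.
(* For the last exit from [x], balance shows that no remaining edge enters [x], as [det_lap_last]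
   requires. *)
have [n1|n2] := eqVneq (A x + B x)%N 1%N.
  have in0 : indeg A B x = 0%N.
    by have := bal x; rewrite eqxx n1 eq_sym (negPf xy); lia.
  have [[A1 B0]|[A0 B1]] : (A x = 1 /\ B x = 0)%N \/ (A x = 0 /\ B x = 1)%N by lia.
    rewrite stepE A1 B0 (det_lap_last (A := A) (B := B) (A' := decr A x) (B' := B) xy) //.
      rewrite (@vfac_decr A B (decr A x) B x y) ?decr_xx ?A1 ?B0 //=.
      by rewrite expr0 expr1; ring.
    by rewrite decr_xx A1 B0.
  rewrite stepE A0 B1 (det_lap_last (A := A) (B := B) (A' := A) (B' := decr B x) xy) //.
    rewrite (@vfac_decr A B A (decr B x) x y) ?decr_xx ?A0 ?B1 //=.
    by rewrite expr0 expr1; ring.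
  by rewrite decr_xx A0 B1.
have n3 : (1 < A x + B x)%N by lia.
have := det_lap_step xy n3.
have ha : (0 < A x)%N -> vfac A B y = vfac (decr A x) B y * (1 - q ^+ (A x + B x).-1).
  move=> p; rewrite (@vfac_decr A B (decr A x) B x y) ?(negPf n2) //.
  by rewrite decr_xx; lia.
have hb : (0 < B x)%N -> vfac A B y = vfac A (decr B x) y * (1 - q ^+ (A x + B x).-1).
  move=> p; rewrite (@vfac_decr A B A (decr B x) x y) ?(negPf n2) //.
  by rewrite decr_xx; lia.
rewrite stepE; have [A0|Ap] := posnP (A x).
  move=> e; rewrite hb; last by lia.
  by rewrite -[RHS]mulrA e A0 expr0; ring.
move=> e; rewrite ha // -[RHS]mulrA e; have [B0|Bp] := posnP (B x).
  by rewrite B0 expr0; ring.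
by rewrite eAB //; ring.
Qed.
End BEST.

(** * Reversal of walks *)

(** The boxes of one row: each letter [false] of [w] bounds a box, whose arm and leg are the
    counters [a] and [l] of the letters [false] and [true] already passed. *)
Fixpoint invs1 (c : nat -> nat -> nat) a l (w : bitseq) : nat :=
  if w is x :: w' then
    if x then invs1 c a l.+1 w' else (c a l + invs1 c a.+1 l w')%N
  else 0%N.

(* A word is the boundary of a Young diagram, read with [true] for vertical
   steps; the boxes are the occurrences of [true] before [false], and the
   letters strictly in between give the arm and the leg of the box. *)
Fixpoint invs (c : nat -> nat -> nat) (w : bitseq) : nat :=
  if w is x :: w' then ((if x then invs1 c 0 0 w' else 0) + invs c w')%N
  else 0%N.

(** The transposed diagram: its boundary is read from the other end, with the two kinds of steps
    exchanged. *)
Definition conj (w : bitseq) : bitseq := map negb (rev w).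

Lemma conjK : involutive conj.
Proof.
move=> w; rewrite /conj -map_rev revK -map_comp -[RHS]map_id.
by apply: eq_map => x /=; rewrite negbK.
Qed.

Lemma conj_cons b w : conj (b :: w) = rcons (conj w) (~~ b).
Proof. by rewrite /conj rev_cons map_rcons. Qed.

Lemma size_conj w : size (conj w) = size w.
Proof. by rewrite size_map size_rev. Qed.

Lemma count_conj b w : count_mem b (conj w) = count_mem (~~ b) w.
Proof.
rewrite /conj count_map -count_rev revK; apply: eq_count => x /=.
by case: b; case: x.
Qed.

Lemma perm_conj_words n : perm_eq (map conj (words n)) (words n).
Proof.
have inj := inv_inj conjK.
apply: uniq_perm; rewrite ?(map_inj_uniq inj) ?uniq_words // => w.
 rewrite -[w in LHS]conjK (mem_map inj).
by rewrite !mem_words size_conj.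
Qed.

Lemma invs1_rcons c a l w b : invs1 c a l (rcons w b) =
  (invs1 c a l w + (~~ b) * c (a + count_mem false w) (l + count_mem true w))%N.
Proof.
elim: w a l => [|x w IHw] a l /=; first by case: b; rewrite /= ?addn0 ?mul1n.
by case: x; rewrite /= IHw ?add0n ?add1n ?addSnnS ?addnA.
Qed.

(** A final horizontal step adds a column, which is a row of the transposed diagram with arm and leg
    exchanged. *)
Lemma invs_rcons c w b : invs c (rcons w b) =
  (invs c w + (~~ b) * invs1 (fun a l => c l a) 0 0 (conj w))%N.
Proof.
elim: w => [|x w IHw] /=; first by case: b.
rewrite {}IHw conj_cons !invs1_rcons negbK !add0n !count_conj.
by case: x; case: b => /=; lia.
Qed.

Lemma invs_conj c w : invs c (conj w) = invs (fun a l => c l a) w.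
Proof.
elim: w => [|x w IHw] //=.
rewrite conj_cons invs_rcons IHw negbK conjK.
by case: x => /=; lia.
Qed.

Lemma eq_invs1 c c' a l w : c =2 c' -> invs1 c a l w = invs1 c' a l w.
Proof. by move=> e; elim: w a l => //= x w IHw a l; rewrite e !IHw. Qed.

Lemma eq_invs c c' w : c =2 c' -> invs c w = invs c' w.
Proof. by move=> e; elim: w => //= x w ->; rewrite (eq_invs1 _ _ _ e). Qed.

Lemma invsD c c' w :
  invs (fun a l => c a l + c' a l)%N w = (invs c w + invs c' w)%N.
Proof.
have D1 u a l : invs1 (fun a l => c a l + c' a l)%N a l u = (invs1 c a l u + invs1 c' a l u)%N.
  by elim: u a l => //= x u IHu a l; rewrite !IHu; case: x; lia.
by elim: w => //= x w ->; rewrite D1; case: x; lia.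
Qed.

Section WalkTheory.
Variables (T : eqType) (a b : T -> T).

Lemma atails_rcons w c x : atails a b (rcons w c) x =
  atails a b w x ++ (if c then [:: endp a b w x] else [::]).
Proof. by elim: w x => [|d w IHw] x /=; [case: c|case: d; rewrite IHw]. Qed.

Lemma btails_rcons w c x : btails a b (rcons w c) x =
  btails a b w x ++ (if c then [::] else [:: endp a b w x]).
Proof. by elim: w x => [|d w IHw] x /=; [case: c|case: d; rewrite IHw]. Qed.

Lemma endp_rcons w c x : endp a b (rcons w c) x =
  (if c then a else b) (endp a b w x).
Proof. by elim: w x => [|d w IHw] x /=; [case: c|case: d; rewrite IHw]. Qed.

Lemma size_atails w x : size (atails a b w x) = count_mem true w.
Proof. by elim: w x => //= -[] w IHw x /=; rewrite IHw. Qed.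

Lemma size_btails w x : size (btails a b w x) = count_mem false w.
Proof. by elim: w x => //= -[] w IHw x /=; rewrite IHw. Qed.

Lemma walk_balance w x v :
  (count_mem v (map a (atails a b w x)) + count_mem v (map b (btails a b w x))
   + (x == v) =
   count_mem v (atails a b w x) + count_mem v (btails a b w x)
   + (endp a b w x == v))%N.
Proof. by elim: w x => //= -[] w IHw x /=; have := IHw; [move=> /(_ (a x))|move=> /(_ (b x))]; lia. Qed.

End WalkTheory.

Section WalkConj.
Variables (T : eqType) (a b a' b' : T -> T).
Hypotheses (aK : cancel a a') (bK : cancel b b').

Lemma endp_conj w x : endp b' a' (conj w) (endp a b w x) = x.
Proof.
by elim: w x => //= c w IHw x; rewrite conj_cons endp_rcons IHw; case: c.
Qed.

(** Backwards, a step starts at its former head, and a horizontal step becomes a letter [true]. *)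
Lemma atails_conj w x :
  atails b' a' (conj w) (endp a b w x) = rev (map b (btails a b w x)).
Proof.
elim: w x => //= c w IHw x; rewrite conj_cons atails_rcons IHw endp_conj.
by case: c; rewrite /= ?cats0 ?rev_cons -?cats1.
Qed.

Lemma btails_conj w x :
  btails b' a' (conj w) (endp a b w x) = rev (map a (atails a b w x)).
Proof.
elim: w x => //= c w IHw x; rewrite conj_cons btails_rcons IHw endp_conj.
by case: c; rewrite /= ?cats0 ?rev_cons -?cats1.
Qed.

End WalkConj.

Section WalkMap.
Variables (T U : eqType) (a b : T -> T) (a' b' : U -> U) (f : T -> U).
Hypotheses (fa : forall x, f (a x) = a' (f x)) (fb : forall x, f (b x) = b' (f x)).

Lemma atails_map w x : atails a' b' w (f x) = map f (atails a b w x).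
Proof. by elim: w x => //= -[] w IHw x /=; rewrite -?fa -?fb IHw. Qed.

Lemma btails_map w x : btails a' b' w (f x) = map f (btails a b w x).
Proof. by elim: w x => //= -[] w IHw x /=; rewrite -?fa -?fb IHw. Qed.

Lemma endp_map w x : endp a' b' w (f x) = f (endp a b w x).
Proof. by elim: w x => //= -[] w IHw x /=; rewrite -?fa -?fb IHw. Qed.

Lemma tailinv_map (D : {pred T}) w x : {in D &, injective f} ->
  all [in D] (atails a b w x) -> all [in D] (btails a b w x) ->
  tailinv a' b' w (f x) = tailinv a b w x.
Proof.
move=> inj; elim: w x => //= -[] w IHw x /=.
  move=> /andP[xD h1] h2; rewrite -fa IHw // btails_map; congr (_ + _)%N.
  rewrite count_map; apply: eq_in_count => y /(allP h2) yD /=.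
  by apply/eqP/eqP => [/inj|->//]; apply.
by move=> h1 /andP[_ h2]; rewrite -fb IHw.
Qed.
End WalkMap.

Section Duality.
Variables (F : fieldType) (q : F) (N : nat) (a b a' b' : 'I_N -> 'I_N).
Hypotheses (aK : cancel a a') (aK' : cancel a' a).
Hypotheses (bK : cancel b b') (bK' : cancel b' b).
Implicit Types (A B : 'I_N -> nat).

Lemma indegE A B v : indeg a b A B v = (A (a' v) + B (b' v))%N.
Proof.
rewrite /indeg (eq_bigl (pred1 (a' v))) ?big_pred1_eq; last first.
  by move=> u /=; rewrite -{1}(aK' v) (can_eq aK).
congr (_ + _)%N; rewrite (eq_bigl (pred1 (b' v))) ?big_pred1_eq // => u /=.
by rewrite -{1}(bK' v) (can_eq bK).
Qed.

(** In-degree equals out-degree: as [a] and [b] are invertible, the edges entering [v] come from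
    [a' v] and [b' v]. *)
Definition closed_cls A B := forall v, (A (a' v) + B (b' v) = A v + B v)%N.

Lemma incls_balanced A B w x : incls a b A B w x ->
  forall v, (A (a' v) + B (b' v) + (x == v) = A v + B v + (endp a b w x == v))%N.
Proof.
move=> /forallP H v; have [/eqP <- /eqP <-] := andP (H v).
have [/eqP <- _] := andP (H (a' v)); have [_ /eqP <-] := andP (H (b' v)).
rewrite -walk_balance; congr (_ + _ + _)%N.
  by rewrite count_map; apply: eq_count => u /=; rewrite -{2}(aK' v) (can_eq aK).
by rewrite count_map; apply: eq_count => u /=; rewrite -{2}(bK' v) (can_eq bK).
Qed.

Lemma incls_endp A B w x : closed_cls A B -> incls a b A B w x -> endp a b w x = x.
Proof.
move=> cl /incls_balanced/(_ x); rewrite cl eqxx.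
by case: eqVneq => //; lia.
Qed.

Lemma incls_conj A B w x : closed_cls A B -> incls a b A B w x ->
  incls b' a' (B \o b') (A \o a') (conj w) x.
Proof.
move=> cl iw; have ew := incls_endp cl iw; apply/forallP => v.
have := atails_conj aK bK w x; have := btails_conj aK bK w x.
rewrite ew => -> ->; rewrite !count_rev !count_map /=.
have [/eqP <- _] := andP (forallP iw (a' v)); have [_ /eqP <-] := andP (forallP iw (b' v)).
apply/andP; split; apply/eqP; apply: eq_count => u /=.
  by rewrite -{1}(bK' v) (can_eq bK).
by rewrite -{1}(aK' v) (can_eq aK).
Qed.
End Duality.

Section ConjWalk.
Variables (F : fieldType) (q : F) (N : nat) (a b a' b' : 'I_N -> 'I_N).
Hypotheses (aK : cancel a a') (aK' : cancel a' a).
Hypotheses (bK : cancel b b') (bK' : cancel b' b).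
Implicit Types (A B : 'I_N -> nat).

Lemma closed_cls_conj A B : closed_cls a' b' A B -> closed_cls b a (B \o b') (A \o a').
Proof. by move=> cl v; rewrite /= bK aK [RHS]addnC cl addnC. Qed.

Lemma clsum_conj_walk n A B x : closed_cls a' b' A B ->
  \sum_(w <- words n | incls a b A B w x) q ^+ tailinv b' a' (conj w) x =
  clsum q b' a' n (B \o b') (A \o a') x.
Proof.
move=> cl; rewrite /clsum -[RHS](perm_big _ (perm_conj_words n)) big_map /=.
apply: eq_bigl => w; apply/idP/idP; first exact: (incls_conj aK aK' bK bK').
move=> /(incls_conj bK' bK aK' aK (closed_cls_conj cl)); rewrite conjK; congr (is_true (incls _ _ _ _ _ _)); apply/funext => v /=; by rewrite ?aK ?bK.
Qed.
End ConjWalk.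

(** * Comparison of the Laplacians of a walk and of its reversal *)

Section Gauge.
Variables (F : fieldType) (q : F) (N : nat) (a b a' b' : 'I_N -> 'I_N).
Hypotheses (aK : cancel a a') (aK' : cancel a' a).
Hypotheses (bK : cancel b b') (bK' : cancel b' b).
Hypothesis q0 : q != 0.
Hypothesis q1 : forall n, (0 < n)%N -> 1 - q ^+ n != 0.
Variables (A B : 'I_N -> nat) (g : 'I_N -> nat).
Hypothesis cl : closed_cls a' b' A B.
(** [g] is a potential whose increments along used edges absorb the powers of [q] by which
    corresponding entries of the two Laplacians differ. *)
Hypothesis gA : forall v, (0 < A (a' v))%N -> g (a' v) = (g v + B (b' v))%N.
Hypothesis gB : forall v, (0 < B (b' v))%N -> g v = (g (b' v) + A (b' v))%N.

Let A' := B \o b'.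
Let B' := A \o a'.

(* The matrix of the reversed walk is conjugate to the transpose of that of the
   walk by the diagonal matrix of the [q ^+ g v]. *)
Lemma det_lap_conj y : \det (lap q b' a' A' B' y) = \det (lap q a b A B y).
Proof.
pose D : 'M[F]_N := diag_mx (\row_v q ^+ g v).
have D0 : \det D != 0.
  rewrite det_diag; apply/prodf_neq0 => v _.
  by rewrite mxE expf_neq0.
apply: (mulfI D0); rewrite -!det_mulmx -[in RHS]det_tr; congr (\det _).
apply/matrixP => v u; rewrite !mxE.
rewrite (bigD1 v) //= [X in _ + X]big1 ?addr0; last first.
  by move=> i iv; rewrite !mxE eq_sym (negPf iv) mul0r.
rewrite (bigD1 u) //= [X in _ = _ + X]big1 ?addr0; last first.
  by move=> i iv; rewrite !mxE eq_sym (negPf iv) mul0r.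
rewrite !mxE !eqxx !mulr1n /A' /B' /=.
have n' : (B (b' v) + A (a' v) = A v + B v)%N by rewrite -cl addnC.
rewrite n'.
case: (eqVneq v y) => [->|vy] /=.
  by rewrite orbT eq_sym; case: eqVneq => [->|]; rewrite ?mulr0.
case: (eqVneq u y) => [->|uy] /=.
  by rewrite eq_sym; case: eqVneq => [->|]; rewrite ?mulr0.
have eV : (a' v == u) = (a u == v) by rewrite -{2}(aK' v) (can_eq aK) eq_sym.
have eH : (b' v == u) = (b u == v) by rewrite -{2}(bK' v) (can_eq bK) eq_sym.
rewrite eV eH (eq_sym u v).
have tA : q ^+ g v * (q ^+ B (b' v) * (1 - q ^+ A (a' v)) * (a u == v)%:R) =
   q ^+ g u * ((1 - q ^+ A u) * (a u == v)%:R).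
  case: (eqVneq (a u) v) => [au|_]; last by rewrite !mulr0.
  have e : a' v = u by rewrite -au aK.
  have := gA (v := v); rewrite e; case: (posnP (A u)) => [-> _|_ /(_ isT) ->].
    by rewrite expr0 subrr; ring.
  by rewrite exprD; ring.
have tB : q ^+ g v * ((1 - q ^+ B (b' v)) * (b u == v)%:R) =
   q ^+ g u * (q ^+ A u * (1 - q ^+ B u) * (b u == v)%:R).
  case: (eqVneq (b u) v) => [au|_]; last by rewrite !mulr0.
  have e : b' v = u by rewrite -au bK.
  have := gB (v := v); rewrite e; case: (posnP (B u)) => [-> _|_ /(_ isT) ->].
    by rewrite expr0 subrr; ring.
  by rewrite exprD; ring.
move: tA tB.
set tA1 := q ^+ B (b' v) * _ * _; set tA2 := (1 - q ^+ A u) * _.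
set tB1 := (1 - q ^+ B (b' v)) * _; set tB2 := q ^+ A u * _ * _ => tA tB.
have [uv|uv] := eqVneq v u.
  rewrite -uv in tA tB *; case: eqP => // _.
  by rewrite 2!mulrBr tA tB; ring.
rewrite !mulr0 !sub0r.
have tA0 n : (n = 0)%N -> n = A u -> tA2 = 0.
  by move=> n0 nA; rewrite /tA2 -nA n0 expr0 subrr mul0r.
have tB0 n : (n = 0)%N -> n = B u -> tB2 = 0.
  by move=> n0 nA; rewrite /tB2 -nA n0 expr0 subrr mulr0 mul0r.
have sA0 n : (n = 0)%N -> n = A (a' v) -> tA1 = 0.
  by move=> n0 nA; rewrite /tA1 -nA n0 expr0 subrr mulr0 mul0r.
have sB0 n : (n = 0)%N -> n = B (b' v) -> tB1 = 0.
  by move=> n0 nA; rewrite /tB1 -nA n0 expr0 subrr mul0r.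
(* By closedness a point without outgoing edges has no incoming ones, so that when only one of the
   two rows is replaced by an identity row, the other entry vanishes too. *)
case: (posnP (A v + B v)%N) => nv; case: (posnP (A u + B u)%N) => nu.
- by rewrite !mulr0.
- have h : q ^+ g u * (- tA2 - tB2) = - (q ^+ g v * tA1) - (q ^+ g v * tB1).
    by rewrite tA tB; ring.
  by rewrite h (sA0 (A (a' v))) ?(sB0 (B (b' v))) //; [rewrite mulr0n; ring|lia|lia].
- have h : q ^+ g v * (- tB1 - tA1) = - (q ^+ g u * tA2) - (q ^+ g u * tB2).
    by rewrite -tA -tB; ring.
  by rewrite h (tA0 (A u)) ?(tB0 (B u)) //; [rewrite mulr0n; ring|lia|lia].
- have -> : q ^+ g v * (- tB1 - tA1) = - (q ^+ g v * tA1) - (q ^+ g v * tB1) by ring.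
  by rewrite tA tB; ring.
Qed.

Lemma qfac_neq0 n : qfac q n != 0.
Proof.
elim: n => [|n IHn]; first by rewrite /qfac big_geq ?oner_neq0.
by rewrite qfacS mulf_neq0 ?q1.
Qed.

Lemma efac_neq0 : efac q A B != 0.
Proof. by apply/prodf_neq0 => v _; rewrite mulf_neq0 ?qfac_neq0. Qed.

Lemma closed_balanced x : balanced a b A B x x.
Proof. by move=> v; rewrite (indegE aK aK' bK bK') cl. Qed.

(** The BEST formula is applied to both walks: the determinants agree by [det_lap_conj], the vertex
    factor depends on total degrees only, and the edge factor is reindexed. Cancelling the latter
    requires [q] not to be a root of unity. *)
Theorem clsum_conj n x : nedges A B = n ->
  \sum_(w <- words n | incls a b A B w x) q ^+ tailinv b' a' (conj w) x =
  clsum q a b n A B x.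
Proof.
move=> tot.
have cl' := closed_cls_conj aK bK cl.
have tot' : nedges A' B' = n.
  by rewrite -tot /nedges; apply: eq_bigr => v _; rewrite /A' /B' /= addnC cl.
rewrite (clsum_conj_walk q aK aK' bK bK') //.
have e1 := q_best q (closed_balanced x) tot.
have bal' : balanced b' a' A' B' x x.
  by move=> v; rewrite (indegE bK' bK aK' aK) cl'.
have := q_best q bal' tot'.
rewrite det_lap_conj (@vfac_ext _ q _ A' B' A B); last first.
  by move=> v; rewrite /A' /B' /= addnC cl.
rewrite -e1; have -> : efac q A' B' = efac q A B; last exact: (mulIf efac_neq0).
rewrite /efac !big_split /= mulrC /A' /B' /=.
congr (_ * _); last first.
  by rewrite [RHS](reindex_inj (can_inj bK')).
by rewrite [RHS](reindex_inj (can_inj aK')).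
Qed.
End Gauge.

(** * Statistics of boundary words *)

Lemma perm_eq_count (T : eqType) (s1 s2 : seq T) :
  (forall x, count_mem x s1 = count_mem x s2) -> perm_eq s1 s2.
Proof. by move=> e; apply/allP => x _ /=; rewrite e. Qed.

Lemma divzBr1 (d : nat) (x : int) : (0 < d)%N ->
  ((x - d%:Z) %/ d%:Z)%Z = (x %/ d%:Z)%Z - 1.
Proof. by move=> d0; rewrite addrC -[- d%:Z]mulN1r divzMDl; lia. Qed.

Section Levels.
Variables r s : nat.
Definition up (x : int) : int := x + s%:Z.
Definition down (x : int) : int := x - r%:Z.

Lemma endpE w (x : int) :
  endp up down w x = x + s%:Z * (count_mem true w)%:Z - r%:Z * (count_mem false w)%:Z.
Proof. by elim: w x => [|[] w IHw] x /=; rewrite ?IHw /up /down ?add0n ?add1n ?intS; ring. Qed.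

Lemma sum_telescope (th : int -> int) w (x : int) :
  \sum_(j <- atails up down w x) (th (up j) - th j) +
  \sum_(m <- btails up down w x) (th (down m) - th m) = th (endp up down w x) - th x.
Proof.
elim: w x => [|[] w IHw] x /=; first by rewrite !big_nil; lia.
  by rewrite big_cons -addrA IHw addrC addrA subrK.
by rewrite big_cons addrCA IHw addrC addrA subrK.
Qed.

(** For a vertical step starting at [x], the later horizontal step bounding the box with arm [a] and
    leg [l] ends at [x + s (l + 1) - r (a + 1)]: a function of this difference can be read off the
    levels. *)
Lemma invs1_kernel (c : nat -> nat -> nat) (K : int -> int) a l w (x : int) :
  (forall a l, (c a l)%:Z = K (s%:Z * l.+1%:Z - r%:Z * a.+1%:Z)) ->
  (invs1 c a l w)%:Z =
  \sum_(m <- btails up down w (x + s%:Z * l.+1%:Z - r%:Z * a%:Z)) K (down m - x).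
Proof.
move=> cK; elim: w a l => [|[] w IHw] a l /=; first by rewrite big_nil.
  by rewrite IHw; have -> : x + s%:Z * l.+2%:Z - r%:Z * a%:Z =
    up (x + s%:Z * l.+1%:Z - r%:Z * a%:Z) by rewrite /up !intS; ring.
rewrite big_cons PoszD IHw cK.
have -> : x + s%:Z * l.+1%:Z - r%:Z * a.+1%:Z =
    down (x + s%:Z * l.+1%:Z - r%:Z * a%:Z) by rewrite /down !intS; ring.
by congr (K _ + _); rewrite /down !intS; ring.
Qed.

Section Kernel.
Variables (c : nat -> nat -> nat) (K phi : int -> int).
Hypothesis cK : forall a l, (c a l)%:Z = K (s%:Z * l.+1%:Z - r%:Z * a.+1%:Z).
Hypothesis symK : forall d, K d = K (s%:Z - r%:Z - d).
Hypothesis phiK : forall d, phi d - phi (d - s%:Z) = K d.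

(* For a kernel symmetric around the middle of the window of differences of
   levels, the pairs (vertical step, later horizontal step) can be counted from
   the levels alone. *)
Lemma invs_levels w (x : int) :
  2 * (invs c w)%:Z =
  \sum_(m <- btails up down w x) (\sum_(j <- atails up down w x) K (down m - j)
    + (phi (down m - x) - phi (endp up down w x - m))).
Proof.
elim: w x => [|[] w IHw] x /=; first by rewrite big_nil.
  rewrite PoszD mulrDr (IHw (up x)) (invs1_kernel _ _ _ x cK).
  rewrite mulr1 mulr0 subr0 -/(up x) mulr_sumr -big_split /=.
  apply: eq_bigr => m _; rewrite big_cons -(phiK (down m - x)) /up.
  have -> : down m - (x + s%:Z) = down m - x - s%:Z by ring.
  by ring.
rewrite add0n (IHw (down x)) big_cons.
(* A first horizontal step adds its pairs with all later vertical steps, which are not boxes;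
   telescoping [phi] along the walk trades them for boundary terms. *)
have := sum_telescope (fun v => phi (v - x)) w (down x).
have -> : \sum_(j <- atails up down w (down x)) (phi (up j - x) - phi (j - x)) =
          \sum_(j <- atails up down w (down x)) K (down x - j).
  apply: eq_bigr => j _; rewrite [RHS]symK -[RHS]phiK.
  by congr (phi _ - phi _); rewrite /up /down; ring.
set e := endp _ _ _ _; set SK := \sum_(j <- _) K _; set SP := \sum_(m <- _) _.
set ST := (X in SK + X); move=> tel.
rewrite [X in _ = _ + X](_ : _ = SP + ST); last first.
  rewrite -big_split; apply: eq_bigr => m _ /=.
  have -> : down m - down x = m - x by rewrite /down; ring.
  by ring.
have -> : SK = phi (e - x) - phi (down x - x) - ST by rewrite -tel addrK.
by ring.
Qed.

Lemma invs_class w w' (x y : int) : endp up down w x = y -> endp up down w' x = y ->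
  perm_eq (atails up down w x) (atails up down w' x) ->
  perm_eq (btails up down w x) (btails up down w' x) -> invs c w = invs c w'.
Proof.
move=> ew ew' pa pb; suff : 2 * (invs c w)%:Z = 2 * (invs c w')%:Z by lia.
rewrite !(invs_levels _ x) ew ew' (perm_big _ pb) /=; apply: eq_bigr => m _.
by rewrite (perm_big _ pa).
Qed.
End Kernel.

(** With [d = s (l + 1) - r (a + 1)], the end of the horizontal step minus the start of the vertical
    one, [midc] means [- r < d < s], [tailc] means [d = - r] (equal starting levels) and [headc]
    means [d = s] (equal final levels). *)
Definition midc (a l : nat) : nat := ((r * a < s * l.+1) && (s * l < r * a.+1))%N.
Definition tailc (a l : nat) : nat := (r * a == s * l.+1)%N.
Definition headc (a l : nat) : nat := (s * l == r * a.+1)%N.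

Lemma tailinv_tailc w (x : int) : tailinv up down w x = invs tailc w.
Proof.
have cK a l : (tailc a l)%:Z = (s%:Z * l.+1%:Z - r%:Z * a.+1%:Z == - r%:Z)%:Z.
  by rewrite /tailc; congr (Posz (nat_of_bool _)); lia.
elim: w x => [|[] w IHw] x //=; rewrite IHw //; congr (_ + _)%N.
have := @invs1_kernel _ (fun d => (d == - r%:Z)%:Z) 0 0 w x cK.
rewrite mulr1 mulr0 subr0 -/(up x) => e.
suff : (count_mem x (btails up down w (up x)))%:Z = (invs1 tailc 0 0 w)%:Z by case.
have h (m : int) : (m == x) = (down m - x == - r%:Z) by rewrite /down; lia.
rewrite {}e; elim: btails => [|m l IHl]; first by rewrite big_nil.
by rewrite big_cons -IHl /= PoszD h.
Qed.

Lemma tails_range w (x lo hi : int) : lo <= x - r%:Z * (count_mem false w)%:Z ->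
  x + s%:Z * (count_mem true w)%:Z <= hi ->
  [/\ all (fun y => lo <= y <= hi) (atails up down w x),
      all (fun y => lo <= up y <= hi) (atails up down w x),
      all (fun y => lo <= y <= hi) (btails up down w x)
    & all (fun y => lo <= down y <= hi) (btails up down w x)].
Proof.
elim: w x => [|[] w IHw] x //= h1 h2.
- have [||? ? ? ?] := IHw (up x); rewrite /up /=; [lia|lia|].
  by split=> //; apply/andP; split=> //; rewrite /up; lia.
- have [||? ? ? ?] := IHw (down x); rewrite /down /=; [lia|lia|].
  by split=> //; apply/andP; split=> //; rewrite /down; lia.
Qed.

Hypotheses (r_gt0 : (0 < r)%N) (s_gt0 : (0 < s)%N).

(** The number of multiples of [s] from 0 to [e]: a primitive, for differences with step [s], of the
    indicator of [0 <= e]. *)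
Definition floorS (e : int) : int := if e < 0 then 0 else (e %/ s%:Z)%Z + 1.

Lemma floorS_step e : floorS e - floorS (e - s%:Z) = (0 <= e)%R%:Z.
Proof.
rewrite /floorS.
rewrite divzBr1 //.
have [e0|e0] := ltP e 0; first by have -> : e - s%:Z < 0 by lia.
have [es|es] := ltP (e - s%:Z) 0; last by lia.
by rewrite divz_small //; lia.
Qed.

Definition midK (d : int) : int := ((- r%:Z < d) && (d < s%:Z))%R%:Z.

Definition midphi (d : int) : int := floorS (d + r%:Z - 1) - floorS (d - s%:Z).

Lemma midcE a l : (midc a l)%:Z = midK (s%:Z * l.+1%:Z - r%:Z * a.+1%:Z).
Proof. by rewrite /midc /midK; congr (Posz (nat_of_bool _)); lia. Qed.

Lemma midK_sym d : midK d = midK (s%:Z - r%:Z - d).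
Proof. by rewrite /midK; congr (Posz (nat_of_bool _)); lia. Qed.

Lemma midphi_step d : midphi d - midphi (d - s%:Z) = midK d.
Proof.
have := floorS_step (d + r%:Z - 1); have := floorS_step (d - s%:Z).
rewrite /midphi; have -> : d - s%:Z + r%:Z - 1 = d + r%:Z - 1 - s%:Z by ring.
by rewrite /midK; lia.
Qed.

Definition area := invs (fun _ _ => 1%N).

Lemma area_class w w' (x y : int) : endp up down w x = y -> endp up down w' x = y ->
  perm_eq (atails up down w x) (atails up down w' x) ->
  perm_eq (btails up down w x) (btails up down w' x) -> area w = area w'.
Proof.
apply: (@invs_class _ (fun=> 1) (fun d => (d %/ s%:Z)%Z)) => // d.
by rewrite divzBr1 //; lia.
Qed.

(** This will be the gauge. Vertical steps preserve the residue class of a level modulo [s]. *)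
Definition above (u : int) (l : seq int) :=
  count (fun m : int => (u < down m) && (s%:Z %| down m - u)%Z) l.

Lemma dvdzBr_self (z : int) : (s%:Z %| z - s%:Z)%Z = (s%:Z %| z)%Z.
Proof. by rewrite rpredBr ?dvdzz. Qed.

Lemma dvdz_gt0_le (z : int) : (s%:Z %| z)%Z -> 0 < z -> s%:Z <= z.
Proof.
have s0 : 0 < s%:Z by lia.
by move=> /dvdzP[c ->]; rewrite pmulr_lgt0 // => c0; rewrite ler_peMl //; lia.
Qed.

Lemma above_up (u : int) l :
  above u l = (above (up u) l + count_mem (up u + r%:Z)%R l)%N.
Proof.
rewrite /above; elim: l => //= m l ->.
suff -> : (u < down m) && (s%:Z %| down m - u)%Z =
  ((up u < down m) && (s%:Z %| down m - up u)%Z) || (m == up u + r%:Z) :> bool.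
  have : ~~ (((up u < down m) && (s%:Z %| down m - up u)%Z) && (m == up u + r%:Z)).
    by rewrite /down; apply/negP => /andP[/andP[? _] /eqP ?]; lia.
  by case: ((up u < _) && _); case: (m == _) => //= _; rewrite ?add0n ?addn0 // addnCA.
have -> : down m - up u = down m - u - s%:Z by rewrite /up; ring.
rewrite dvdzBr_self; have [mu|mu] := eqVneq m (up u + r%:Z).
  rewrite orbT mu; have -> : down (up u + r%:Z) - u = s%:Z by rewrite /up /down; ring.
  by rewrite dvdzz /up /down; lia.
rewrite orbF; case dv : (_ %| _)%Z; rewrite ?andbF // !andbT.
have := dvdz_gt0_le dv; move: mu; rewrite /up /down => mu h.
by apply/idP/idP => h'; lia.
Qed.

(** Flux of a closed walk through the set of levels above [u + r] and congruent to it modulo [s]: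
    vertical steps enter it only from [u + r] and never leave it, while the horizontal steps
    starting and ending in it give the two values of [above]. *)
Lemma above_down w (x u : int) : endp up down w x = x ->
  above u (btails up down w x) =
  (above (u + r%:Z)%R (btails up down w x) + count_mem (u + r%:Z)%R (atails up down w x))%N.
Proof.
move=> closed.
pose th (v : int) : int := ((u + r%:Z < v) && (s%:Z %| v - (u + r%:Z))%Z)%:Z.
have := sum_telescope th w x.
rewrite closed subrr.
have sc (p : pred int) l : \sum_(m <- l) (p m)%:Z = (count p l)%:Z :> int.
  by elim: l => [|m l IHl]; rewrite ?big_nil ?big_cons //= IHl.
have -> : \sum_(j <- atails up down w x) (th (up j) - th j) =
    (count_mem (u + r%:Z) (atails up down w x))%:Z.
  rewrite -sc; apply: eq_bigr => j _; rewrite /th /=.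
  have -> : up j - (u + r%:Z) = j - (u + r%:Z) + s%:Z by rewrite /up; ring.
  rewrite -[in X in X - _]dvdzBr_self addrK.
  have [->|ju] := eqVneq j (u + r%:Z).
    by rewrite subrr dvdz0 /up; lia.
  case dv: (_ %| _)%Z; rewrite ?andbF // !andbT /up.
  suff -> : (u + r%:Z < j + s%:Z) = (u + r%:Z < j) by rewrite subrr.
  apply/idP/idP => h; last by lia.
  rewrite ltNge; apply/negP => ju'.
  by have := @dvdz_gt0_le (u + r%:Z - j); rewrite -rpredN opprB dv; lia.
have -> : \sum_(m <- btails up down w x) (th (down m) - th m) =
   (above (u + r%:Z) (btails up down w x))%:Z - (above u (btails up down w x))%:Z.
  rewrite sumrB !sc; congr (Posz _ - Posz _).
  apply: eq_count => m /=; congr (_ && (_ %| _)%Z); rewrite /down; first by lia.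
  by ring.
by lia.
Qed.

End Levels.

(** * Equidistribution at a fixed slope *)

Lemma sum_count_mem (T : finType) (l : seq T) : (\sum_v count_mem v l = size l)%N.
Proof.
elim: l => [|x l IHl] /=; first by rewrite big1.
by rewrite big_split IHl (bigD1 x) //= eqxx big1 // => v; rewrite eq_sym => /negPf ->.
Qed.

(** Levels modulo [P] form a finite type on which both kinds of steps are bijections, so that
    determinants and reversal make sense. *)
Definition lev P (y : int) : 'I_(Zp_trunc P).+2 := (y%:~R : 'Z_P).
Definition levD P c (v : 'I_(Zp_trunc P).+2) : 'I_(Zp_trunc P).+2 :=
  (v : 'Z_P) + c%:R.
Definition levB P c (v : 'I_(Zp_trunc P).+2) : 'I_(Zp_trunc P).+2 :=
  (v : 'Z_P) - c%:R.

Lemma levDK P c : cancel (@levD P c) (@levB P c).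
Proof. by move=> v; rewrite /levD /levB addrK. Qed.

Lemma levBK P c : cancel (@levB P c) (@levD P c).
Proof. by move=> v; rewrite /levD /levB subrK. Qed.

Lemma lev_up P c y : lev P (up c y) = levD c (lev P y).
Proof. by rewrite /lev /levD /up rmorphD. Qed.

Lemma lev_down P c y : lev P (down c y) = levB c (lev P y).
Proof. by rewrite /lev /levB /down rmorphB. Qed.

Lemma levK P y : (1 < P)%N -> 0 <= y < P%:Z -> (lev P y : nat)%:Z = y.
Proof.
move=> P1; case: y => // n /andP[_ nP].
by rewrite /lev -pmulrn val_Zp_nat ?modn_small.
Qed.

(* All levels reached in a box lie below this bound, so that they can be
   treated modulo it. *)
Definition period r s N : nat := (2 * (r * s * N) + r + s + 2)%N.

Section Equidistribution.
Variables (r s N : nat).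
Hypotheses (r_gt0 : (0 < r)%N) (s_gt0 : (0 < s)%N).

(** With these numbers of steps the walk is closed; started at [r * s * N], it stays between 0 and
    twice that level. *)
Definition isbox (w : bitseq) :=
  (count_mem true w == (r * N)%N) && (count_mem false w == (s * N)%N).

Let x0 : int := (r * s * N)%:Z.
Let P : nat := period r s N.
Let T := 'I_(Zp_trunc P).+2.
Let f : int -> T := lev P.
Let aT := @levD P s.
Let aT' := @levB P s.
Let bT := @levB P r.
Let bT' := @levD P r.
Let upS : int -> int := up s.
Let downR : int -> int := down r.
Let D : {pred int} := [pred y : int | 0 <= y < P%:Z].

Let aK : cancel aT aT'. Proof. exact: levDK. Qed.
Let aK' : cancel aT' aT. Proof. exact: levBK. Qed.
Let bK : cancel bT bT'. Proof. exact: levBK. Qed.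
Let bK' : cancel bT' bT. Proof. exact: levDK. Qed.

Let fa y : f (upS y) = aT (f y). Proof. exact: lev_up. Qed.
Let fb y : f (downR y) = bT (f y). Proof. exact: lev_down. Qed.

Let fK y : y \in D -> (f y : nat)%:Z = y.
Proof. by rewrite inE => yD; apply: levK; rewrite // /P /period addn2. Qed.

Let f_inj : {in D &, injective f}.
Proof. by move=> y z yD zD e; rewrite -(fK yD) e fK. Qed.

Let count_f l y : all [in D] l -> y \in D -> count_mem (f y) (map f l) = count_mem y l.
Proof.
move=> lD yD; rewrite count_map; apply: eq_in_count => z /(allP lD) zD /=.
by apply/eqP/eqP => [/f_inj|->//]; apply.
Qed.

Lemma box_endp w : isbox w -> endp upS downR w x0 = x0.
Proof. by case/andP=> /eqP h1 /eqP h2; rewrite endpE h1 h2 !PoszM; ring. Qed.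

Let small (y : int) : 0 <= y <= 2 * (r * s * N)%N%:Z + r%:Z + s%:Z -> y \in D.
Proof. by rewrite inE /P /period; lia. Qed.

Let box_tails w : isbox w ->
  [/\ all [in D] (atails upS downR w x0), all [in D] (map upS (atails upS downR w x0)),
   all [in D] (btails upS downR w x0)
   & all [in D] (map downR (btails upS downR w x0))].
Proof.
case/andP=> /eqP h1 /eqP h2.
have [||t1 t2 t3 t4] := @tails_range r s w x0 0 (2 * (r * s * N)%N%:Z).
- by rewrite h2 -PoszM mulnA /x0 subrr.
- by rewrite h1 -PoszM mulnCA mulnA /x0; lia.
rewrite !all_map; split.
- by apply: sub_all t1 => y /= /andP[lo hi]; apply: small; rewrite lo (le_trans hi) //; lia.
- by apply: sub_all t2 => y /= /andP[lo hi]; apply: small; rewrite lo (le_trans hi) //; lia.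
- by apply: sub_all t3 => y /= /andP[lo hi]; apply: small; rewrite lo (le_trans hi) //; lia.
- by apply: sub_all t4 => y /= /andP[lo hi]; apply: small; rewrite lo (le_trans hi) //; lia.
Qed.

Let box_up w j : isbox w -> j \in atails upS downR w x0 ->
  0 <= upS j <= 2 * (r * s * N)%N%:Z.
Proof.
case/andP=> /eqP h1 /eqP h2.
have [||_ + _ _] := @tails_range r s w x0 0 (2 * (r * s * N)%N%:Z).
- by rewrite h2 -PoszM mulnA /x0 subrr.
- by rewrite h1 -PoszM mulnCA mulnA /x0; lia.
by move=> /allP; apply.
Qed.

Lemma count_atails_lev w (y : int) : isbox w ->
  0 <= y < P%:Z ->
  count_mem (lev P y) (atails aT bT w (f x0)) = count_mem y (atails upS downR w x0).
Proof.
by move=> bw yD; rewrite (atails_map fa fb) count_f //; have [] := box_tails bw.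
Qed.

Lemma count_btails_lev w (y : int) : isbox w ->
  0 <= y < P%:Z ->
  count_mem (lev P y) (btails aT bT w (f x0)) = count_mem y (btails upS downR w x0).
Proof.
by move=> bw yD; rewrite (btails_map fa fb) count_f //; have [] := box_tails bw.
Qed.

Lemma tailinv_box w : isbox w -> tailinv aT bT w (f x0) = invs (tailc r s) w.
Proof.
move=> bw; rewrite -(tailinv_tailc r s w x0).
by have [d1 _ d3 _] := box_tails bw; rewrite (tailinv_map fa fb f_inj).
Qed.

(** Equal starting levels in the reversed walk are equal final levels in the walk itself. *)
Lemma tailinv_conj_box w : isbox w ->
  tailinv bT' aT' (conj w) (f x0) = invs (headc r s) w.
Proof.
move=> bw.
have fa' y : f (up r y) = bT' (f y) by exact: lev_up.
have fb' y : f (down s y) = aT' (f y) by exact: lev_down.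
have upK (t : nat) : cancel (up t) (down t) by move=> y; rewrite /down /up addrK.
have downK (t : nat) : cancel (down t) (up t) by move=> y; rewrite /down /up subrK.
have [_ d2 _ d4] := box_tails bw.
rewrite (tailinv_map fa' fb' f_inj) ?tailinv_tailc ?invs_conj //.
  by rewrite -{1}(box_endp bw) (atails_conj (upK s) (downK r)) all_rev.
by rewrite -{1}(box_endp bw) (btails_conj (upK s) (downK r)) all_rev.
Qed.

(* Boxes with [a / (l + 1) <= s / r < (a + 1) / l] and with
   [a / (l + 1) < s / r <= (a + 1) / l]. *)
Definition hplus (a l : nat) : nat := ((r * a <= s * l.+1) && (s * l < r * a.+1))%N.
Definition hminus (a l : nat) : nat := ((r * a < s * l.+1) && (s * l <= r * a.+1))%N.

Lemma invs_hplus w : invs hplus w = (invs (midc r s) w + invs (tailc r s) w)%N.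
Proof.
rewrite -invsD; apply: eq_invs => a l; rewrite /hplus /midc /tailc leq_eqVlt.
rewrite !mulnS; case: eqP => [e|_]; last by rewrite addn0.
by rewrite e ltnn /= ltn_addl //; lia.
Qed.

Lemma invs_hminus w : invs hminus w = (invs (midc r s) w + invs (headc r s) w)%N.
Proof.
rewrite -invsD; apply: eq_invs => a l; rewrite /hminus /midc /headc (leq_eqVlt (s * l)).
rewrite !mulnS; case: eqP => [e|_]; last by rewrite addn0.
by rewrite e ltnn andbF /= andbT; case: leqP => //; lia.
Qed.

Lemma isboxE w : size w = (r * N + s * N)%N -> isbox w = (count_mem true w == (r * N)%N).
Proof.
rewrite /isbox => sw; have := count_predC (pred1 true) w; rewrite sw.
have -> : count (predC (pred1 true)) w = count_mem false w by apply: eq_count => -[].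
by case: eqP => //= -> /addnI ->; rewrite eqxx.
Qed.

Variables (F : fieldType) (q : F).
Hypothesis q0 : q != 0.
Hypothesis q1 : forall n, (0 < n)%N -> 1 - q ^+ n != 0.

Section Class.
Variable w0 : bitseq.
Hypothesis w0_box : isbox w0.

Let A v := count_mem v (atails aT bT w0 (f x0)).
Let B v := count_mem v (btails aT bT w0 (f x0)).

Let cls w := incls aT bT A B w (f x0).

Let AE y : y \in D -> A (f y) = count_mem y (atails upS downR w0 x0).
Proof.
by move=> yD; rewrite /A (atails_map fa fb) count_f //; have [] := box_tails w0_box.
Qed.
Let BE y : y \in D -> B (f y) = count_mem y (btails upS downR w0 x0).
Proof.
by move=> yD; rewrite /B (btails_map fa fb) count_f //; have [] := box_tails w0_box.
Qed.

(** The class is defined modulo the period, but all levels of a box lie below the period, so that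
    the lists of integer levels agree too. *)
Lemma cls_perm w : cls w -> isbox w /\
  perm_eq (atails upS downR w x0) (atails upS downR w0 x0) /\
  perm_eq (btails upS downR w x0) (btails upS downR w0 x0).
Proof.
move=> /forallP clw.
have pa : perm_eq (atails aT bT w (f x0)) (atails aT bT w0 (f x0)).
  by apply: perm_eq_count => v; have /andP[/eqP -> _] := clw v.
have pb : perm_eq (btails aT bT w (f x0)) (btails aT bT w0 (f x0)).
  by apply: perm_eq_count => v; have /andP[_ /eqP ->] := clw v.
have bw : isbox w.
  have := w0_box; rewrite /isbox -(size_atails aT bT w (f x0)) -(size_btails aT bT w (f x0)).
  by rewrite (perm_size pa) (perm_size pb) size_atails size_btails.
have back l : all [in D] l -> map (fun v : T => (v : nat)%:Z) (map f l) = l.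
  by move=> lD; rewrite -map_comp map_id_in // => y /(allP lD) /fK.
have [d1 _ d3 _] := box_tails bw; have [e1 _ e3 _] := box_tails w0_box.
split=> //; split.
  rewrite -(back _ d1) -(back _ e1); apply: perm_map.
  by rewrite -!(atails_map fa fb).
rewrite -(back _ d3) -(back _ e3); apply: perm_map.
by rewrite -!(btails_map fa fb).
Qed.

Let above_w0 u := above r s u (btails upS downR w0 x0).
Let g (v : T) := above_w0 (v : nat)%:Z.

Let val_mem v l : (0 < count_mem v (map f l))%N -> exists2 j, j \in l & v = f j.
Proof. by rewrite -has_count has_pred1 => /mapP. Qed.

Let gA v : (0 < A (aT' v))%N -> g (aT' v) = (g v + B (bT' v))%N.
Proof.
rewrite /A (atails_map fa fb) => /val_mem[j jl vj].
have [d1 d2 _ _] := box_tails w0_box.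
have jD := allP d1 _ jl; have ujD := allP d2 _ (map_f upS jl).
have vE : v = f (upS j) by rewrite fa -vj aK'.
have -> : bT' v = f (upS j + r%:Z) by rewrite vE /bT' /f [RHS]rmorphD.
rewrite BE; last first.
  have /andP[lo hi] := box_up w0_box jl.
  apply: small; rewrite addr_ge0 //=; apply: le_trans (lerD hi (lexx _)) _.
  by rewrite lerDl.
by rewrite /g vj vE !fK //; apply: above_up.
Qed.

Let gB v : (0 < B (bT' v))%N -> g v = (g (bT' v) + A (bT' v))%N.
Proof.
rewrite /B (btails_map fa fb) => /val_mem[m ml vm].
have [_ _ d1 d2] := box_tails w0_box.
have mD := allP d1 _ ml; have dmD := allP d2 _ (map_f downR ml).
have vE : v = f (downR m) by rewrite fb -vm bK'.
rewrite vm AE // /g vE !fK // /above_w0.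
by rewrite (above_down r_gt0 s_gt0 _ (box_endp w0_box)) /downR subrK.
Qed.

Let A_closed : closed_cls aT' bT' A B.
Proof.
move=> v; have := @incls_balanced _ aT bT aT' bT' aK aK' bK bK' A B w0 (f x0).
have -> : endp aT bT w0 (f x0) = f x0.
  by rewrite (endp_map fa fb) box_endp.
move=> /(_ _ v) h; apply/eqP; rewrite -(eqn_add2r (f x0 == v)); apply/eqP; apply: h.
by apply/forallP => u; rewrite !eqxx.
Qed.

Theorem class_equidistribution :
  \sum_(w <- words (r * N + s * N) | cls w) q ^+ invs (tailc r s) w =
  \sum_(w <- words (r * N + s * N) | cls w) q ^+ invs (headc r s) w.
Proof.
have tot : nedges A B = (r * N + s * N)%N.
  have /andP[/eqP h1 /eqP h2] := w0_box.
  by rewrite /nedges big_split !sum_count_mem size_atails size_btails h1 h2.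
have := clsum_conj aK aK' bK bK' q0 q1 A_closed gA gB (f x0) tot.
rewrite /clsum => e; rewrite -/(cls _) in e.
transitivity (\sum_(w <- words (r * N + s * N) | cls w) q ^+ tailinv aT bT w (f x0)).
  by apply: eq_bigr => w /cls_perm[bw _]; rewrite tailinv_box.
by rewrite -e; apply: eq_bigr => w /cls_perm[bw _]; rewrite tailinv_conj_box.
Qed.
End Class.

Theorem box_equidistribution n :
  \sum_(w <- words (r * N + s * N) | isbox w && (area w == n)) q ^+ invs hplus w =
  \sum_(w <- words (r * N + s * N) | isbox w && (area w == n)) q ^+ invs hminus w.
Proof.
set L := (r * N + s * N)%N.
pose cntA w := fun v => count_mem v (atails aT bT w (f x0)).
pose cntB w := fun v => count_mem v (btails aT bT w (f x0)).
(* The class of a word as an element of a finite type: no count exceeds the length [L]. *)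
pose key w : {ffun T -> 'I_L.+1} * {ffun T -> 'I_L.+1} :=
  ([ffun v => inord (cntA w v)], [ffun v => inord (cntB w v)]).
have keyP w0 w : size w0 = L -> size w = L ->
    (key w == key w0) = incls aT bT (cntA w0) (cntB w0) w (f x0).
  have small_cnt u : size u = L -> forall v, (cntA u v < L.+1)%N /\ (cntB u v < L.+1)%N.
    move=> su v; rewrite !ltnS; split; apply: leq_trans (count_size _ _) _.
      by rewrite size_atails -su count_size.
    by rewrite size_btails -su count_size.
  move=> s0 sw; apply/eqP/forallP => [[e1 e2] v|H].
    have := congr1 (fun h : {ffun _ -> _} => val (h v)) e1.
    have := congr1 (fun h : {ffun _ -> _} => val (h v)) e2.
    have [? ?] := small_cnt w sw v; have [? ?] := small_cnt w0 s0 v.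
    by rewrite /= !ffunE !inordK // => h2 h1; apply/andP; split; apply/eqP.
  by congr pair; apply/ffunP => v; rewrite !ffunE; have /andP[/eqP e1 /eqP e2] := H v; congr inord.
rewrite (partition_big key xpredT) //= [RHS](partition_big key xpredT) //=.
apply: eq_bigr => kap _.
(* Either the class contains a word of area [n], and then all its words have this area, or both sums
   are empty. *)
have [/hasP[w0 w0in /andP[/andP[w0b /eqP w0a] /eqP kw0]]|no] :=
    boolP (has (fun w => isbox w && (area w == n) && (key w == kap)) (words L)); last first.
  rewrite big_seq_cond big1; last first.
    by move=> w /andP[wi ww]; case/negP: no; apply/hasP; exists w.
  rewrite big_seq_cond big1 // => w /andP[wi ww].
  by case/negP: no; apply/hasP; exists w.
have sw0 : size w0 = L by apply/eqP; rewrite -mem_words.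
have clsE w : w \in words L ->
    isbox w && (area w == n) && (key w == kap) = incls aT bT (cntA w0) (cntB w0) w (f x0).
  rewrite mem_words => /eqP sw; rewrite -kw0 keyP //.
  case cw: (incls _ _ _ _ _ _); rewrite ?andbF // andbT.
  have [bw [pa pb]] := cls_perm w0b cw.
  rewrite bw /= -w0a; apply/eqP.
  exact: (area_class r_gt0 s_gt0 (box_endp bw) (box_endp w0b)).
have midE w : incls aT bT (cntA w0) (cntB w0) w (f x0) -> invs (midc r s) w = invs (midc r s) w0.
  move=> cw; have [bw [pa pb]] := cls_perm w0b cw.
  exact: (invs_class (midcE r_gt0 s_gt0) (midK_sym r_gt0 s_gt0) (midphi_step r_gt0 s_gt0)
    (box_endp bw) (box_endp w0b)).
rewrite big_seq_cond [RHS]big_seq_cond.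
transitivity (q ^+ invs (midc r s) w0 *
   \sum_(w <- words L | incls aT bT (cntA w0) (cntB w0) w (f x0)) q ^+ invs (tailc r s) w).
  rewrite big_distrr [RHS]big_seq_cond; apply: eq_big => [w|w /andP[wi]].
    by apply: andb_id2l => /clsE.
  by rewrite clsE // => /midE <-; rewrite invs_hplus exprD.
rewrite (class_equidistribution w0b).
apply/esym; rewrite [RHS]big_distrr [RHS]big_seq_cond; apply: eq_big => [w|w /andP[wi]].
  by apply: andb_id2l => /clsE.
by rewrite clsE // => /midE <-; rewrite invs_hminus exprD.
Qed.
End Equidistribution.

(** * Varying the slope *)

Lemma invs1_const a l w : invs1 (fun _ _ => 1%N) a l w = count_mem false w.
Proof. by elim: w a l => //= -[] w IHw a l; rewrite IHw. Qed.

Lemma area_rcons w b : area (rcons w b) = (area w + (~~ b) * count_mem true w)%N.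
Proof. by rewrite /area invs_rcons invs1_const count_conj. Qed.

Lemma area_cons w b : area (b :: w) = (b * count_mem false w + area w)%N.
Proof. by rewrite /area /= invs1_const; case: b; rewrite ?mul1n. Qed.

Lemma perm_words_rcons n :
  perm_eq (words n.+1) (map (rcons^~ true) (words n) ++ map (rcons^~ false) (words n)).
Proof.
have inj b : injective (rcons^~ b : bitseq -> bitseq) by move=> u v /rcons_inj[].
apply: uniq_perm; first exact: uniq_words.
  rewrite cat_uniq !map_inj_uniq ?uniq_words ?andbT //=.
  by apply/hasPn => w /mapP[u _ ->]; apply/mapP => -[v _ /rcons_inj[]].
move=> w; rewrite mem_words mem_cat; case/lastP: w => [|w b].
  by rewrite [LHS]/=; apply/esym/orP => -[] /mapP[[|? ?] _ //].
have same (u : bitseq) c (s : seq bitseq) : (rcons u c \in map (rcons^~ c) s) = (u \in s)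
  by apply/mapP/idP => [[v vs /rcons_inj[-> //]]|us]; exists u.
have diff (u : bitseq) c (s : seq bitseq) : (rcons u c \in map (rcons^~ (~~ c)) s) = false.
  by apply/mapP => -[v _ /rcons_inj[_]]; case: c.
rewrite size_rcons eqSS -mem_words; case: b; rewrite same.
  by rewrite (diff _ true) orbF.
by rewrite (diff _ false).
Qed.

Lemma count_words n w : w \in words n -> (count_mem true w + count_mem false w = n)%N.
Proof.
rewrite mem_words => /eqP <-; rewrite -(count_predC (pred1 true)); congr (_ + _)%N.
by apply: eq_count => -[].
Qed.

(** The two displayed steps bound a box, whose hook has one more box than arm plus leg. *)
Lemma area_hook u m v :
  (count_mem false m + count_mem true m < area (u ++ true :: m ++ false :: v))%N.
Proof.
have h1 : (count_mem true m <= area (m ++ false :: v))%N.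
  elim: m => //= b m IHm; rewrite area_cons; case: b => /=; last by lia.
  by rewrite count_cat /=; lia.
  elim: u => [|b u IHu] /=; last by rewrite area_cons; apply: leq_trans IHu (leq_addl _ _).
by rewrite /= area_cons mul1n count_cat /= -!addnA ltn_add2l add1n ltnS (leq_trans h1) ?leq_addl.
Qed.

Lemma eq_invs_hook c c' n w : (area w <= n)%N ->
  (forall a l, (a + l < n)%N -> c a l = c' a l) -> invs c w = invs c' w.
Proof.
move=> aw cc.
have D1 u a l : (forall m v, u = m ++ false :: v -> c (a + count_mem false m)%N (l + count_mem true m)%N =
    c' (a + count_mem false m)%N (l + count_mem true m)%N) -> invs1 c a l u = invs1 c' a l u.
  elim: u a l => //= b u IHu a l H; case: b H => H.
    by apply: IHu => m v uE; have := H (true :: m) v; rewrite uE /= !add0n !add1n !addnS !addSn; apply.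
  have := H [::] u erefl; rewrite !addn0 => ->; congr addn; apply: IHu => m v uE.
  by have := H (false :: m) v; rewrite uE /= !add0n !add1n !addnS !addSn; apply.
suff H u v : w = u ++ v -> invs c v = invs c' v by exact: (H [::]).
elim: v u => //= b v IHv u wE; congr addn; last first.
  by apply: (IHv (rcons u b)); rewrite cat_rcons.
case: b wE => // wE; apply: D1 => m v' vE; rewrite !add0n; apply: cc.
by apply: leq_trans aw; rewrite wE vE area_hook.
Qed.

Section Chain.
Variables (F : fieldType) (q : F).

Definition wsum (c : nat -> nat -> nat) M L n : F :=
  \sum_(w <- words (M + L) | (count_mem true w == M) && (area w == n)) q ^+ invs c w.

(** A final horizontal step would create a column of [M.+1 > n] boxes, so the last step is vertical
    and bounds an empty row. *)
Lemma wsum_true c M L n : (n <= M)%N -> wsum c M.+1 L n = wsum c M L n.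
Proof.
move=> nM; rewrite /wsum addSn (perm_big _ (perm_words_rcons _)) big_cat !big_map /=.
rewrite [X in _ + X]big1 ?addr0; last first.
  move=> w /andP[]; rewrite -cats1 count_cat /= cats1 area_rcons /=.
  by rewrite !addn0 mul1n => /eqP -> /eqP; lia.
apply: eq_big => w; first by rewrite area_rcons -cats1 count_cat /= addn1 eqSS addn0.
by rewrite invs_rcons addn0.
Qed.

(** A first vertical step would create a row of [L.+1 > n] boxes. *)
Lemma wsum_false c M L n : (n <= L)%N -> wsum c M L.+1 n = wsum c M L n.
Proof.
move=> nM; rewrite /wsum addnS [words _.+1]/= big_cat !big_map /=.
rewrite big_seq_cond [X in X + _]big1 ?add0r; last first.
  move=> w /andP[/count_words cw]; rewrite area_cons => /andP[/eqP h /eqP].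
  by move: cw h; rewrite /= mul1n; lia.
by apply: eq_big.
Qed.

Lemma wsum_large c M L n : (n <= M)%N -> (n <= L)%N -> wsum c M L n = wsum c n n n.
Proof.
move=> /subnK <- /subnK <-; elim: (M - n)%N => [|m IHm]; last first.
  by rewrite addSn wsum_true // leq_addl.
by elim: (L - n)%N => // l IHl; rewrite addSn wsum_false // leq_addl.
Qed.

Lemma eq_wsum c c' M L n : (forall a l, (a + l < n)%N -> c a l = c' a l) ->
  wsum c M L n = wsum c' M L n.
Proof.
move=> cc; apply: eq_bigr => w /andP[_ /eqP aw].
by rewrite (@eq_invs_hook c c' n w) // aw.
Qed.

Lemma wsum_box (r s N n : nat) (c : nat -> nat -> nat) :
  \sum_(w <- words (r * N + s * N) | isbox r s N w && (area w == n)) q ^+ invs c w =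
  wsum c (r * N) (s * N) n.
Proof.
rewrite big_seq_cond [RHS]big_seq_cond; apply: eq_bigl => w.
by apply: andb_id2l; rewrite mem_words => /eqP sw; rewrite isboxE.
Qed.

Hypothesis q0 : q != 0.
Hypothesis q1 : forall n, (0 < n)%N -> 1 - q ^+ n != 0.

Lemma wsum_slope r s n : (0 < r)%N -> (0 < s)%N ->
  wsum (hplus r s) n n n = wsum (hminus r s) n n n.
Proof.
move=> r0 s0; have := box_equidistribution n r0 s0 q0 q1 n.
by rewrite !wsum_box !(@wsum_large _ (r * n) (s * n)) //; rewrite leq_pmull.
Qed.

(** Boxes at the end of their row: this statistic counts the nonempty rows. *)
Definition rowc (a l : nat) : nat := (a == 0)%N.

Section Slopes.
Variables (n K : nat).
Hypotheses (nK : (n <= K)%N) (K0 : (0 < K)%N).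

Let ratio (x : 'I_K * 'I_K) : rat := x.1.+1%:R / x.2.+1%:R.

Let ratio_lt x y : (ratio x < ratio y) = (x.1.+1 * y.2.+1 < y.1.+1 * x.2.+1)%N.
Proof.
rewrite /ratio ltr_pdivrMr ?ltr0Sn // mulrAC ltr_pdivlMr ?ltr0Sn //.
by rewrite -!natrM ltr_nat.
Qed.

(* A box of a diagram of area [n] has [a + l < n], so for [K >= n] the fractions
   it is compared with have terms at most [K], and [hminus] at a slope is [hplus]
   at the preceding such fraction. *)
Lemma wsum_hminus_ratio (x : 'I_K * 'I_K) : wsum (hminus x.2.+1 x.1.+1) n n n = wsum rowc n n n.
Proof.
have [m] := ubnP #|[set y | ratio y < ratio x]|; elim: m x => // m IHm x.
rewrite ltnS => xm; case: (pickP (fun y => ratio y < ratio x)) => [y0 y0x|no].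
  case: (@arg_maxP _ _ _ y0 (fun y => ratio y < ratio x) ratio y0x) => y yx ymax.
  have ym : (#|[set z | (ratio z < ratio y)%R]| < m)%N.
    apply: leq_trans xm; apply: proper_card; apply/properP; split.
      by apply/fintype.subsetP => z; rewrite !inE => zy; exact: (lt_trans zy yx).
    by exists y; rewrite !inE ?ltxx.
  rewrite -(IHm y ym) -[RHS]wsum_slope //; apply: eq_wsum => a l aln.
  (* No grid fraction lies strictly between [y] and [x], so being below [x] is the same as being at
     most [y]. *)
  have key p t : (0 < p <= K)%N -> (0 < t <= K)%N ->
      (x.2.+1 * p < x.1.+1 * t)%N = (y.2.+1 * p <= y.1.+1 * t)%N.
    case: p t => // p [|t] //= pK tK.
    pose z : 'I_K * 'I_K := (Ordinal pK, Ordinal tK).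
    have := ratio_lt z x; have := ratio_lt y z.
    rewrite /= => e1 e2; rewrite mulnC -e2 [RHS]leqNgt [(y.2.+1 * _)%N]mulnC -e1 -leNgt.
    by apply/idP/idP => [/ymax //|/le_lt_trans]; apply.
  rewrite /hminus /hplus; congr (nat_of_bool (_ && _)).
    case: a aln => [|a] aln; first by rewrite !muln0 !muln_gt0.
    by rewrite key //; lia.
  case: l aln => [|l] aln; first by rewrite !muln0 leq0n !muln_gt0.
  by rewrite leqNgt key -?ltnNge //; lia.
(* The smallest grid fraction is [1 / K], and [a + l < n <= K] then leaves exactly the boxes with
   [a = 0]. *)
apply: eq_wsum => a l aln.
have Kx : (x.1.+1 * K <= x.2.+1)%N.
  have p0 : (0 < K)%N by [].
  have pK : (K.-1 < K)%N by lia.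
  have := no (Ordinal p0, Ordinal pK); rewrite ratio_lt /= => /negbT.
  by rewrite -leqNgt mul1n prednK.
have x2 : x.2.+1 = K by have := ltn_ord x.2; nia.
have x1 : x.1.+1 = 1%N by have := ltn_ord x.2; nia.
rewrite /hminus /rowc x1 x2 !mul1n; congr nat_of_bool; case: a aln => [|a] aln.
  by rewrite muln0 muln1 /=; lia.
by apply/negbTE; rewrite negb_and -leqNgt mulnS; apply/orP; left; lia.
Qed.

Lemma wsum_hminus r s : (0 < r <= K)%N -> (0 < s <= K)%N ->
  wsum (hminus r s) n n n = wsum rowc n n n.
Proof.
case: r s => // r [|s] //= rK sK.
by have := wsum_hminus_ratio (Ordinal sK, Ordinal rK).
Qed.
End Slopes.
End Chain.

(** * Counting the rows of diagrams *)

Section RowGeneratingFunction.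
Variables (F : fieldType) (q : F).

Lemma fcoefXn (m n : nat) : fcoef ('t ^+ m : fps F) n = (n == m)%:R.
Proof.
elim: m n => [|m IHm] n; first by rewrite expr0 fcoef1.
rewrite exprS fcoefM; case: n => [|n].
  by rewrite big_ord1 /= mul0r.
rewrite big_ord_recl /= mul0r add0r big_ord_recl /= mul1r IHm subSS subn0 eqSS.
by rewrite big1 ?addr0 // => i _; rewrite mul0r.
Qed.

Lemma fcoefMXn (a : fps F) m n :
  fcoef (a * 't ^+ m) n = if (m <= n)%N then fcoef a (n - m) else 0.
Proof.
rewrite fcoefM; case: leqP => mn.
  have lt : (n - m < n.+1)%N by rewrite ltnS leq_subr.
  rewrite (bigD1 (Ordinal lt)) //= fcoefXn subKn // eqxx mulr1.
  rewrite big1 ?addr0 // => i; rewrite -val_eqE /= => im.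
  by rewrite fcoefXn; case: eqP => [e|_]; rewrite ?mulr0 //; have := ltn_ord i; lia.
by rewrite big1 // => i _; rewrite fcoefXn; case: eqP => [e|_]; rewrite ?mulr0 //; lia.
Qed.

(** Generating function of the partitions with parts at most [L], where [q] marks the number of
    parts. *)
Definition partition_fps L : fps F :=
  \prod_(1 <= i < L.+1) (1 / (1 - fpsC q * 't ^+ i)).

Lemma fcoef_partition L n : fcoef (partition_fps L.+1) n =
  fcoef (partition_fps L) n +
  if (L.+1 <= n)%N then q * fcoef (partition_fps L.+1) (n - L.+1)%N else 0.
Proof.
have e : partition_fps L.+1 * (1 - fpsC q * 't ^+ L.+1) = partition_fps L.
  rewrite {1}/partition_fps big_nat_recr //= -mulrA divrK ?mulr1 //.
  change (is_true (fcoef (1 - fpsC q * 't ^+ L.+1) 0 != 0)).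
  rewrite fcoefB fcoef1 fcoefCM fcoefXn.
  by rewrite mulr0 subr0 oner_eq0.
rewrite -[in RHS]e mulrBr mulr1 fcoefB mulrA fcoefMXn [_ * fpsC q]mulrC fcoefCM.
by case: ifP => _; rewrite ?subr0 ?addr0 // subrK.
Qed.

Lemma invs1_rowc a l w : invs1 rowc a l w = ((a == 0) && (0 < count_mem false w))%N.
Proof.
elim: w a l => [|[] w IHw] a l /=; first by rewrite andbF.
  by rewrite IHw.
by rewrite IHw /rowc /= addn0 andbT.
Qed.

(** A first horizontal step means that no row has length [L.+1]; a first vertical step is such a
    row, contributing [q] and [L.+1] boxes. This is the recursion of [fcoef_partition]. *)
Lemma wsum_rowcS M L n : wsum q rowc M.+1 L.+1 n = wsum q rowc M.+1 L n +
  if (L.+1 <= n)%N then q * wsum q rowc M L.+1 (n - L.+1)%N else 0.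
Proof.
rewrite {1}/wsum addSn [words _.+1]/= big_cat !big_map [LHS]addrC; congr (_ + _).
  have e : (M + L.+1 = M.+1 + L)%N by rewrite addnS.
  by rewrite /wsum e; apply: eq_big.
have ct w : w \in words (M + L.+1) -> count_mem true w = M -> count_mem false w = L.+1.
  by move=> /count_words cw h; move: cw; rewrite h => /addnI.
case: ifPn => [Ln|nL]; last first.
  rewrite big_seq_cond big1 // => w /andP[wi]; rewrite area_cons /= eqSS.
  by case/andP=> /eqP /(ct _ wi) ->; rewrite mul1n => /eqP; lia.
rewrite big_distrr big_seq_cond [RHS]big_seq_cond; apply: eq_big => [w|w /andP[wi]].
  apply: andb_id2l => wi; rewrite area_cons /= eqSS; apply: andb_id2l => /eqP /(ct _ wi) ->.
  by rewrite mul1n; apply/eqP/eqP; lia.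
rewrite /= eqSS => /andP[/eqP /(ct _ wi) cw _].
by rewrite invs1_rowc cw /= exprS.
Qed.

Lemma wsum_rowc0 L n : wsum q rowc 0 L.+1 n = wsum q rowc 0 L n.
Proof.
by rewrite {1}/wsum add0n [words _.+1]/= big_cat !big_map /= [X in X + _]big1 ?add0r //.
Qed.

Lemma wsum_col0 M n : wsum q rowc M 0 n = (n == 0%N)%:R.
Proof.
elim: M => [|M IHM].
  by rewrite /wsum /= big_cons big_nil /= eq_sym; case: eqP; rewrite ?addr0.
rewrite -IHM /wsum addSn [words _.+1]/= big_cat !big_map /=.
have ct w : w \in words (M + 0) -> (count_mem true w <= M)%N.
  by move=> /count_words; rewrite addn0 => <-; apply: leq_addr.
rewrite [X in _ + X]big_seq_cond [X in _ + X]big1 ?addr0; last first.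
  by move=> w /andP[/ct h /andP[/eqP e _]]; move: e h; rewrite add0n => ->; rewrite ltnn.
rewrite big_seq_cond [RHS]big_seq_cond; apply: eq_big => [w|w /andP[/count_words]].
  apply: andb_id2l => /count_words cw; rewrite area_cons /= eqSS; apply: andb_id2l => /eqP e.
  by move: cw; rewrite e => /addnI ->.
by rewrite /= eqSS => cw /andP[/eqP e _]; move: cw; rewrite e invs1_rowc => /addnI ->.
Qed.

Lemma wsum_rowc M L n : (n <= M)%N -> wsum q rowc M L n = fcoef (partition_fps L) n.
Proof.
elim: L M n => [|L IHL] M n nM.
  by rewrite wsum_col0 /partition_fps big_geq // fcoef1.
elim: M n nM => [|M IHM] n nM.
  by rewrite wsum_rowc0 IHL // fcoef_partition; case: n nM => //; rewrite addr0.
rewrite wsum_rowcS IHL // fcoef_partition; congr (_ + _).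
by case: leqP => // Ln; rewrite IHM //; lia.
Qed.
End RowGeneratingFunction.

(** * Steps of a good sequence *)

Lemma fsbig_seq_support (T : choiceType) (R : Type) (idx : R) (op : Monoid.com_law idx)
    (P : set T) (r : seq T) (f : T -> R) : uniq r ->
  (forall i, P i -> i \notin r -> f i = idx) ->
  (forall i, i \in r -> ~ P i -> f i = idx) ->
  \big[op/idx]_(i \in P) f i = \big[op/idx]_(i <- r) f i.
Proof.
move=> ur Pr rP; pose Q : set T := fun i => P i /\ i \in r.
rewrite [RHS]fsbig_seq // -(@fsbig_widen _ _ _ _ Q P).
- apply: fsbig_widen; first by move=> i [].
  by move=> i [/= ir nQ]; apply: rP => // Pi; apply: nQ.
- by move=> i [].
- by move=> i [/= Pi nQ]; apply: Pr => //; apply/negP => ir; apply: nQ.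
Qed.

Lemma hsize_geq (H : hseq) m : (\sum_(0 <= i < m) H i <= hsize H)%N.
Proof.
rewrite /hsize /index_iota subn0.
rewrite (bigID (fun i => i \in finsupp H)) /= [X in (_ + X)%N]big1 ?addn0; last first.
  by move=> i; apply: fsfun_dflt.
rewrite [X in (_ <= X)%N](bigID (fun i => i < m)%N) /= -big_filter -[X in (_ <= X + _)%N]big_filter.
rewrite (perm_big [seq i <- finsupp H | (i < m)%N]) ?leq_addr //.
apply: uniq_perm; rewrite ?filter_uniq ?iota_uniq ?fset_uniq // => i.
by rewrite !mem_filter mem_iota andbC.
Qed.

Lemma hsizeE (H : hseq) m : (forall i, (m <= i)%N -> H i = 0%N) ->
  hsize H = (\sum_(0 <= i < m) H i)%N.
Proof.
move=> H0; apply/eqP; rewrite eqn_leq hsize_geq andbT.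
rewrite /hsize /index_iota subn0 (bigID (fun i => i < m)%N) /= [X in (_ + X)%N]big1 ?addn0; last first.
  by move=> i; rewrite -leqNgt; apply: H0.
rewrite -big_filter (perm_big [seq i <- iota 0 m | i \in finsupp H]) /=; last first.
  apply: uniq_perm; rewrite ?filter_uniq ?iota_uniq ?fset_uniq // => i.
  by rewrite !mem_filter mem_iota andbC.
by rewrite big_filter [X in (_ <= X)%N](bigID (fun i => i \in finsupp H)) /= leq_addr.
Qed.

Lemma sum_shift_support (f : nat -> nat) c M : (forall i, (i < c)%N -> f i = 0%N) ->
  (forall i, (M <= i)%N -> f i = 0%N) ->
  (\sum_(0 <= j < M) f (j + c) = \sum_(0 <= j < M) f j)%N.
Proof.
move=> f0 fM; transitivity (\sum_(0 <= j < M + c) f j)%N.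
  rewrite [RHS](@big_cat_nat _ _ _ c) ?leq_addl //= -{3}[c]add0n big_addn addnK.
  by rewrite [X in _ = (X + _)%N]big_nat [X in _ = (X + _)%N]big1 // => i /f0.
rewrite (@big_cat_nat _ _ _ M) ?leq_addr //= [X in (_ + X)%N]big_nat [X in (_ + X)%N]big1 ?addn0 //.
by move=> i /andP[/fM].
Qed.

(** A product [f j * f (j + d)] is seen by [w - d] windows of width [w]. Since [f] vanishes below
    [k], shifting an index by less than [k] loses no term. *)
Lemma window_sq (f : nat -> nat) k M w : (forall i, (i < k)%N -> f i = 0%N) ->
  (forall i, (M <= i)%N -> f i = 0%N) -> (w <= k)%N ->
  (\sum_(0 <= j < M) (\sum_(0 <= c < w) f (j + c)) ^ 2 =
   w * \sum_(0 <= j < M) f j ^ 2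
   + 2 * \sum_(1 <= d < w) (w - d) * \sum_(0 <= j < M) f j * f (j + d))%N.
Proof.
move=> f0 fM; elim: w => [|w IHw] wk.
  by rewrite (big_geq (leq0n 1)) big1 // => j _; rewrite big_geq.
pose R d := (\sum_(0 <= j < M) f j * f (j + d))%N.
have shift c d : (c < k)%N -> (\sum_(0 <= j < M) f (j + c) * f (j + c + d) = R d)%N.
  move=> ck; apply: (sum_shift_support (f := fun j => (f j * f (j + d))%N)) => i hi.
    by rewrite f0 // (ltn_trans hi).
  by rewrite fM.
have -> : (\sum_(0 <= j < M) (\sum_(0 <= c < w.+1) f (j + c)) ^ 2 =
    \sum_(0 <= j < M) (\sum_(0 <= c < w) f (j + c)) ^ 2
    + (2 * \sum_(0 <= c < w) R (w - c) + R 0))%N.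
  under eq_bigr do rewrite big_nat_recr //= sqrnD -addnA.
  rewrite big_split /=; congr addn; rewrite addnC big_split /=; congr addn.
    by rewrite -(shift w 0%N) //; apply: eq_bigr => j _; rewrite addn0 mulnn.
  rewrite -big_distrr /=; congr muln.
  under eq_bigr do rewrite big_distrl /=.
  rewrite exchange_big /= big_nat [RHS]big_nat; apply: eq_bigr => c /andP[_ cw].
  rewrite -(shift c) ?(ltn_trans cw) //; apply: eq_bigr => j _.
  by rewrite -addnA subnKC // ltnW.
rewrite IHw; last exact: ltnW.
have -> : (\sum_(0 <= c < w) R (w - c) = \sum_(1 <= d < w.+1) R d)%N.
  by rewrite big_add1 big_nat_rev /= add0n big_nat [RHS]big_nat; apply: eq_bigr => c cw; congr R; lia.
have -> : (\sum_(1 <= d < w.+1) (w.+1 - d) * R d =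
   \sum_(1 <= d < w) (w - d) * R d + \sum_(1 <= d < w.+1) R d)%N.
  have -> : (\sum_(1 <= d < w) (w - d) * R d = \sum_(1 <= d < w.+1) (w - d) * R d)%N.
    have [->|w0] := posnP w; first by rewrite !big_geq.
    by rewrite [RHS]big_nat_recr //= subnn mul0n addn0.
  rewrite -big_split /= big_nat [RHS]big_nat; apply: eq_bigr => d dw.
  by rewrite subSn ?mulSn 1?addnC //; lia.
have -> : R 0%N = (\sum_(0 <= j < M) f j ^ 2)%N by apply: eq_bigr => j _; rewrite addn0 mulnn.
by rewrite -/R; ring.
Qed.

Section Good.
Variables (k : nat) (H : hseq).
Hypotheses (k_gt0 : (0 < k)%N) (gH : good k H).

Let e := Defs.eta k H.

Lemma eta_geN1 : -1 <= e.
Proof. by have [[]] := is_eta_eta H k_gt0. Qed.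

Lemma dval_full j : -1 <= j <= e -> dval H j = (j %/ k%:Z)%Z + 1.
Proof. by have [[_ + _]] := is_eta_eta H k_gt0; apply. Qed.

Lemma tau_ge0 i : 0 <= tau k i. Proof. by []. Qed.

Lemma dval_ge0 j : 0 <= dval H j. Proof. by case: j. Qed.

Lemma dval_lt0 j : j < 0 -> dval H j = 0. Proof. by case: j. Qed.

Lemma adiff_full (i : int) : -1 <= i < e -> adiff k H i = 0.
Proof.
move=> ie; rewrite /adiff !dval_full; try lia.
by rewrite divz_tau //; lia.
Qed.

Lemma adiff_ge0 (i : int) : -1 <= i -> 0 <= adiff k H i.
Proof.
move=> i1; have [ie|ei] := ltP i e; first by rewrite adiff_full ?i1.
by have [] := gH ei.
Qed.

Lemma dval_back (i : int) : e < i -> dval H i <= dval H (i - k%:Z).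
Proof.
move=> ei; have ei' : e <= i - 1 by lia.
by have [_] := gH ei'; rewrite !subrK.
Qed.

Lemma dval_back_gt0 i : (k <= i)%N -> (0 < H i)%N -> (0 < H (i - k))%N.
Proof.
move=> ki Hi; suff : 0 < dval H (i%:Z - k%:Z) by rewrite subzn.
have [ie|ei] := leP i%:Z e; last first.
  by apply: lt_le_trans (dval_back ei); rewrite /= ltz_nat.
rewrite subzn // dval_full; last by have := eta_geN1; lia.
by rewrite divz_nat -PoszD ltz_nat addn1.
Qed.

(** By [dval_back_gt0] the values at [i], [i - k], [i - 2 k] and so on are positive, which gives
    [i %/ k + 1] positive terms. *)
Lemma gt0_size i : (0 < H i)%N -> (i %/ k < hsize H)%N.
Proof.
move=> Hi; apply: leq_trans (hsize_geq H i.+1).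
elim/ltn_ind: i Hi => i IHi Hi.
rewrite big_nat_recr //=; have [ik|ki] := ltnP i k.
  by rewrite divn_small //; lia.
have Hk := IHi (i - k)%N _ (dval_back_gt0 ki Hi).
have -> : (i %/ k = ((i - k) %/ k).+1)%N by rewrite -{1}(subnK ki) divnDr // divnn k_gt0 addn1.
have le : (\sum_(0 <= j < (i - k).+1) H j <= \sum_(0 <= j < i) H j)%N.
  rewrite [X in (_ <= X)%N](@big_cat_nat _ _ _ (i - k).+1) ?leq_addr //; lia.
by have := Hk _; lia.
Qed.

Lemma dval_large (i : int) : (k * hsize H)%N%:Z <= i -> dval H i = 0.
Proof.
case: i => // i /= hi; have [->//|Hi] := posnP (H i).
by have := gt0_size Hi; rewrite ltn_divLR // => h; move: hi; rewrite mulnC; lia.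
Qed.

Lemma eta_lt : e < (k * hsize H)%N%:Z.
Proof.
rewrite ltNge; apply/negP => he.
have := dval_large he; rewrite dval_full ?lexx ?eta_geN1 //.
by case: (e) he => // m _; rewrite divz_nat; lia.
Qed.

Let n := hsize H.
(** The support of [H] lies below [k * n]. Two further periods leave room for levels where the steps
    are those of the empty diagram, including the last multiple [k * N - k]. *)
Let N := n.+2.

(* Numbers of vertical steps starting, and of horizontal steps ending, at a
   given level, for a boundary word whose diagram has Hilbert function [H]. *)
Definition vsteps (j : nat) : nat :=
  if (j < k * N)%N then absz (adiff k H (j%:Z - 1)) else 0.
Definition hsteps (m : nat) : nat :=
  if (m < k * N)%N then absz (dval H (m%:Z - k%:Z) - dval H m%:Z + 1)%R else 0.
Definition htails (v : nat) : nat := if v is v'.+1 then hsteps v' else 0%N.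

Lemma vstepsE j : (j < k * N)%N ->
  (vsteps j)%:Z = dval H (j%:Z - 1) - dval H j%:Z + (k %| j)%N%:Z.
Proof.
move=> jN; rewrite /vsteps jN gez0_abs; last by apply: adiff_ge0; lia.
by rewrite /adiff /tau subrK.
Qed.

Lemma hstepsE m : (m < k * N)%N ->
  (hsteps m)%:Z = dval H (m%:Z - k%:Z) - dval H m%:Z + 1.
Proof.
move=> mN; rewrite /hsteps mN gez0_abs //.
have [em|me] := ltP e m%:Z; first by have := dval_back em; lia.
rewrite [dval H m%:Z]dval_full; last by lia.
have [mk|km] := ltnP m k.
  by rewrite dval_lt0 ?divz_nat ?divn_small //; lia.
rewrite dval_full; last by lia.
by rewrite divzBr1 //; lia.
Qed.

Lemma vsteps_small j : j%:Z <= e -> vsteps j = 0%N.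
Proof.
move=> je; rewrite /vsteps; case: ifP => // _.
by rewrite adiff_full //; lia.
Qed.

Lemma vsteps_big j : (k * n < j)%N -> vsteps j = ((k %| j) && (j < k * N))%N.
Proof.
move=> nj; have [jN|jN] := ltnP j (k * N); last by rewrite /vsteps ltnNge jN andbF.
have := vstepsE jN; rewrite andbT !(@dval_large j) ?(@dval_large (j%:Z - 1)) //; lia.
Qed.

Lemma hsteps_small m : m%:Z <= e -> hsteps m = 0%N.
Proof.
move=> me; have := eta_lt => eN.
have mN : (m < k * N)%N by move: eN; rewrite -/e -/n /N !mulnS; lia.
suff : (hsteps m)%:Z = 0 by lia.
rewrite hstepsE // [dval H m%:Z]dval_full; last by lia.
have [mk|km] := ltnP m k.
  by rewrite dval_lt0 ?divz_nat ?divn_small //; lia.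
rewrite dval_full; last by lia.
by rewrite divzBr1 //; lia.
Qed.

Lemma hsteps_gt0 m : e < m%:Z -> (m < k * N)%N -> (0 < hsteps m)%N.
Proof.
move=> em mN; suff : 0 < (hsteps m)%:Z by [].
by rewrite hstepsE //; have := dval_back em; lia.
Qed.

(** As many steps end at level [u] as start there. Below [k * N] both sides are the same differences
    of values of [H]; the levels affected by the cutoff are treated apart. *)
Lemma steps_balance u :
  ((if (k <= u)%N then vsteps (u - k) else 0) + hsteps u = vsteps u + htails u)%N.
Proof.
have kn : (k * n + k + k = k * N)%N by rewrite /N !mulnS; lia.
have [uN|uN] := ltnP u (k * N).
  have hu := hstepsE uN; have vu := vstepsE uN.
  case: leqP => ku.
    have ukN : (u - k < k * N)%N by lia.
    have u1N : (u.-1 < k * N)%N by lia.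
    have hu1 := hstepsE u1N; have vk := vstepsE ukN.
    have -> : htails u = hsteps u.-1 by case: (u) ku => //; lia.
    have dv : (k %| u - k)%N = (k %| u)%N by rewrite dvdn_subl.
    suff : (vsteps (u - k))%:Z + (hsteps u)%:Z = (vsteps u)%:Z + (hsteps u.-1)%:Z by lia.
    rewrite hu vu hu1 vk dv.
    have -> : (u.-1)%:Z = u%:Z - 1 by lia.
    have -> : (u - k)%N%:Z = u%:Z - k%:Z by lia.
    have -> : u%:Z - 1 - k%:Z = u%:Z - k%:Z - 1 by ring.
    by ring.
  suff : (hsteps u)%:Z = (vsteps u)%:Z + (htails u)%:Z by lia.
  rewrite hu vu; case: u uN ku hu vu => [|u] uN ku hu vu.
    by rewrite /= !dval_lt0 ?dvdn0; lia.
  rewrite [htails _]/= hstepsE; last by lia.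
  have -> : (k %| u.+1)%N = false by apply/negbTE/negP => /dvdn_leq; lia.
  rewrite !(@dval_lt0 (_ - k%:Z)); try lia.
  have -> : u.+1%:Z - 1 = u%:Z by lia.
  by rewrite addr0; ring.
have -> : (k <= u)%N by lia.
have -> : hsteps u = 0%N by rewrite /hsteps ltnNge uN.
have -> : vsteps u = 0%N by rewrite /vsteps ltnNge uN.
(* At the top level [k * N] a single vertical step arrives, from [k * N - k], and a single
   horizontal step leaves. *)
rewrite addn0 add0n; have [->|uneq] := eqVneq u (k * N)%N.
  rewrite vsteps_big; last by lia.
  have -> : (k %| k * N - k)%N by rewrite dvdn_sub // dvdn_mulr.
  have -> : (k * N - k < k * N)%N by lia.
  case uE: (k * N)%N => [|u'] /=; first by lia.
  suff : (hsteps u')%:Z = 1 by lia.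
  rewrite hstepsE; last by lia.
  by rewrite !dval_large //; lia.
have -> : htails u = 0%N.
  case: u uN uneq => //= u uN uneq; rewrite /hsteps ltnNge.
  by have -> : (k * N <= u)%N by lia.
rewrite vsteps_big; last by lia.
case: ltnP => uk; rewrite ?andbF // andbT; apply/eqP; rewrite eqb0; apply/negP.
move=> /dvdnP[c cE].
have : (k * N.-1 < k * c < k * N)%N by rewrite [(k * c)%N]mulnC -cE /N !mulnS; move: uneq uN; rewrite /N !mulnS; lia.
by rewrite !ltn_pmul2l // /N /=; lia.
Qed.

Definition vsteps_shift j := if (k <= j)%N then vsteps (j - k) else 0%N.

(** A closed walk crosses from [m + 1] down to [m] as often as upwards, and the upward crossings are
    the vertical steps ending at one of the levels from [m + 1] to [m + k]. *)
Lemma hsteps_window m : hsteps m = (\sum_(0 <= c < k) vsteps_shift (m.+1 + c))%N.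
Proof.
have vsE u : vsteps_shift (u + k) = vsteps u by rewrite /vsteps_shift leq_addl addnK.
have bal u : (vsteps_shift u + hsteps u = vsteps_shift (u + k) + htails u)%N.
  by rewrite vsE -steps_balance.
elim: m => [|m IHm].
  have /= := bal 0%N; rewrite addn0 => h.
  have h0 : hsteps 0 = vsteps_shift k.
    by rewrite -h /vsteps_shift leqNgt k_gt0.
  rewrite h0 -(prednK k_gt0) big_nat_recr //= big_nat big1 ?add1n // => c cP.
  by rewrite /vsteps_shift add1n; case: ifP => //; lia.
have := bal m.+1; rewrite /= IHm.
have := erefl (\sum_(0 <= c < k.+1) vsteps_shift (m.+1 + c))%N.
rewrite {1}big_nat_recl // big_nat_recr //= addn0.
have -> : (\sum_(0 <= i < k) vsteps_shift (m.+1 + i.+1) = \sum_(0 <= i < k) vsteps_shift (m.+2 + i))%N.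
  by apply: eq_bigr => i _; rewrite addnS addSn.
by lia.
Qed.

End Good.

(** * Hilbert functions of diagrams *)

Definition at_most (z : int) : pred int := fun t => t <= z.

Section WordHilbert.
Variables k N : nat.
Hypothesis k_gt0 : (0 < k)%N.

Let top : int := (1 * k * N)%N%:Z.
Let tails (w : bitseq) : seq int := atails (up k) (down 1) w top.
Let hts (w : bitseq) : seq int := btails (up k) (down 1) w top.
Definition tails_le (w : bitseq) (z : int) : nat :=
  count (at_most z) (atails (up k) (down 1) w (1 * k * N)%N%:Z).

(* The quadrant has [m %/ k + 1] boxes of level [m], one in each of the first
   rows, and the diagram misses those in the rows whose vertical step starts at a
   level at most [m]. *)
Definition word_hseq (w : bitseq) : hseq :=
  [fsfun m in seq_fset tt (iota 0 (k * N)) => ((m %/ k).+1 - tails_le w m%:Z)%N | 0%N].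

Lemma word_hseqE w m : word_hseq w m =
  if (m < k * N)%N then ((m %/ k).+1 - tails_le w m%:Z)%N else 0%N.
Proof. by rewrite /word_hseq fsfun_fun seq_fsetE mem_iota. Qed.

(** With [p] vertical steps already taken, the next one starts at level at least [k * p], as each
    remaining horizontal step lowers the level by one only. So only the vertical steps numbered from
    [p] to [m %/ k] can start at level at most [m]. *)
Lemma count_tails_bound w (x : int) p (m : nat) : (k * p)%N%:Z + (count_mem false w)%:Z <= x ->
  (count (at_most m%:Z) (atails (up k) (down 1%N) w x) <= (m %/ k).+1 - p)%N.
Proof.
elim: w x p => [|[] w IHw] x p //= xp.
  have h : (count (at_most m%:Z) (atails (up k) (down 1%N) w (up k x)) <= (m %/ k).+1 - p.+1)%N.
    by apply: IHw; rewrite /up mulnS PoszD -addrA addrC lerD2r.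
  rewrite {1}/at_most; have [xm|mx] := leP x m%:Z; last by rewrite (leq_trans h) // leq_sub2l.
  have pm : (p <= m %/ k)%N.
    by rewrite leq_divRL // mulnC -lez_nat (le_trans _ xm) // (le_trans _ xp) // lerDl.
  by rewrite subSn // add1n ltnS.
by apply: (IHw (down 1 x) p); rewrite /down lerBrDr -addrA -PoszD addn1 -add1n.
Qed.

Lemma tails_ge0 w : isbox 1 k N w -> all (fun t : int => 0 <= t) (tails w).
Proof.
case/andP=> /eqP h1 /eqP h2.
have [||t1 _ _ _] := @tails_range 1 k w top 0 (2 * (k * N)%N%:Z); rewrite ?h1 ?h2 /top.
- by lia.
- by lia.
by apply: sub_all t1 => t /andP[].
Qed.

Lemma tails_le_bound w (m : nat) : isbox 1 k N w -> (tails_le w m%:Z <= (m %/ k).+1)%N.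
Proof.
case/andP=> /eqP h1 /eqP h2; rewrite -[X in (_ <= X)%N]subn0.
by apply: count_tails_bound; rewrite h2; lia.
Qed.

Lemma tails_le_lt0 w (z : int) : isbox 1 k N w -> z < 0 -> tails_le w z = 0%N.
Proof.
move=> bw z0; apply/eqP; rewrite -leqn0 leqNgt -has_count; apply/hasPn => t tw.
by rewrite /at_most -ltNge (lt_le_trans z0) // (allP (tails_ge0 bw)).
Qed.

Lemma tails_leS w (z : int) :
  (tails_le w z + count_mem (z + 1)%R (tails w) = tails_le w (z + 1))%N.
Proof.
rewrite /tails_le -/(tails w); elim: (tails w) => //= t l IHl.
rewrite -IHl; suff -> : (at_most (z + 1)%R t = at_most z t + (t == (z + 1)%R) :> nat)%N.
  by rewrite addnACA.
by rewrite /at_most; lia.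
Qed.

(** A closed walk crosses between [z] and [z + 1] equally often in both directions: upwards by the
    vertical steps starting above [z - k] and not above [z], downwards by the horizontal steps from
    [z + 1]. *)
Lemma heads_count w (z : int) : isbox 1 k N w ->
  (tails_le w (z - k%:Z) + count_mem (z + 1)%R (hts w) = tails_le w z)%N.
Proof.
move=> bw; pose th (v : int) : int := (v <= z)%R%:Z.
have sc (p : pred int) l : \sum_(m <- l) (p m)%:Z = (count p l)%:Z :> int.
  by elim: l => [|m l IHl]; rewrite ?big_nil ?big_cons //= IHl.
have := sum_telescope 1 k th w top.
rewrite (box_endp bw) subrr.
have -> : \sum_(j <- tails w) (th (up k j) - th j) =
   (tails_le w (z - k%:Z))%:Z - (tails_le w z)%:Z.
  rewrite sumrB !sc; congr (Posz _ - Posz _); apply: eq_count => t /=.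
  by rewrite /up /at_most lerBrDr.
have -> : \sum_(m <- hts w) (th (down 1 m) - th m) = (count_mem (z + 1)%R (hts w))%:Z.
  have h (t : int) : th (down 1 t) - th t = (t == z + 1)%R%:Z by rewrite /th /down; lia.
  by rewrite -sc; apply: eq_bigr => t _; exact: h.
by lia.
Qed.

(** Horizontal steps go down by one, so the walk cannot skip a level on its way down. *)
Lemma crossing (w : bitseq) (x m : int) : m < x ->
  has (at_most m) (atails (up k) (down 1%N) w x) ->
  (m + 1)%R \in btails (up k) (down 1%N) w x.
Proof.
elim: w x => [|[] w IHw] x //= mx.
  by rewrite {1}/at_most leNgt mx /=; apply: IHw; rewrite (lt_le_trans mx) // lerDl.
move=> h; rewrite inE; have [->//|mx1] := eqVneq (m + 1) x.
by apply: IHw h; rewrite /down ltrBrDr lt_neqAle mx1 lezD1.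
Qed.

Lemma tail_split w (x t : int) : t \in atails (up k) (down 1%N) w x ->
  exists u v, w = u ++ true :: v /\
    t = x + (k * count_mem true u)%N%:Z - (count_mem false u)%:Z.
Proof.
elim: w x => [|[] w IHw] x //=.
  rewrite inE => /orP[/eqP->|/IHw[u [v [-> ->]]]].
    by exists [::], w; split=> //=; lia.
  by exists (true :: u), v; split=> //=; rewrite /up; lia.
move=> /IHw[u [v [-> ->]]].
by exists (false :: u), v; split=> //=; rewrite /down; lia.
Qed.

Lemma area_cat_true u v :
  ((count_mem true u).+1 * count_mem false v <= area (u ++ true :: v))%N.
Proof.
elim: u => [|b u IHu].
  by rewrite /= area_cons !mul1n leq_addr.
rewrite cat_cons area_cons; case: b => /=; last by rewrite add0n.
by rewrite mul1n count_cat /= add0n add1n mulSn; apply: leq_add IHu; exact: leq_addl.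
Qed.

(** A vertical step starting above [k * N - k] after [b] vertical ones has more than [k (N - b - 1)]
    horizontal steps after it, and the resulting rectangle with [b + 1] rows has at least [N]
    boxes. *)
Lemma tails_top w : isbox 1 k N w -> (area w < N)%N ->
  all (fun t : int => t + k%:Z <= (k * N)%N%:Z) (tails w).
Proof.
move=> bw aw; apply/allP => t /tail_split[u [v [wE tE]]].
rewrite leNgt; apply/negP => tN.
have := area_cat_true u v; rewrite -wE => av.
case/andP: bw; rewrite wE !count_cat /= => /eqP h1 /eqP h2.
set b := count_mem true u in tE av h1; set c := count_mem false u in tE h2.
set d := count_mem false v in av h2.
have bN : (b < N)%N by lia.
have cb : (c < k * b.+1)%N by rewrite mulnS; move: tN tE; rewrite /top; lia.
have dN : (N - b <= d)%N.
  have : (k * (N - b.+1) < d)%N by rewrite mulnBr; lia.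
  have le : (N - b.+1 <= k * (N - b.+1))%N by rewrite leq_pmull.
  by lia.
have : (b.+1 * (N - b) <= b.+1 * d)%N by rewrite leq_mul2l dN orbT.
have : (N - b + b <= b.+1 * (N - b))%N by rewrite mulSn leq_add2l leq_pmulr // subn_gt0.
by lia.
Qed.

(** The vertical step following [i] vertical ones starts at [x + k i] minus the number of horizontal
    steps before it, and the numbers of horizontal steps after the vertical ones sum up to the
    area. *)
Lemma sum_tails w (x : int) :
  \sum_(t <- atails (up k) (down 1%N) w x) t =
  x * (count_mem true w)%:Z - (count_mem true w * count_mem false w)%N%:Z
  + (area w)%:Z + (k * 'C(count_mem true w, 2))%N%:Z.
Proof.
elim: w x => [|[] w IHw] x; first by rewrite /= big_nil mulr0 mul0n muln0 subrr.
  rewrite area_cons /= big_cons IHw add0n add1n mul1n binS bin1 /up.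
  by rewrite mulSn mulnDr !PoszD intS !PoszM; ring.
rewrite area_cons /= IHw add0n add1n /down.
by rewrite mulnS !PoszD !PoszM; ring.
Qed.

Lemma tails_le_mono w (y z : int) : y <= z -> (tails_le w y <= tails_le w z)%N.
Proof. by move=> yz; apply: sub_count => t /le_trans; apply. Qed.

Lemma sum_divn_succ M : (\sum_(0 <= i < k * M) (i %/ k).+1 = k * 'C(M.+1, 2))%N.
Proof.
elim: M => [|M IHM]; first by rewrite muln0 big_geq // bin_small // muln0.
rewrite mulnS addnC (@big_cat_nat _ _ _ (k * M)) ?leq_addr //= IHM.
rewrite [in RHS]binS bin1 mulnDr; congr (_ + _)%N.
rewrite -{1}[(k * M)%N]add0n big_addn addKn.
rewrite big_nat (eq_bigr (fun=> M.+1)).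
  by rewrite -big_nat sum_nat_const_nat subn0.
by move=> i /andP[_ ik]; rewrite addnC mulnC divnMDl // divn_small ?addn0.
Qed.

(** * The Hilbert function of a diagram as a good sequence *)

Section Diagram.
Variable w : bitseq.
Hypothesis w_box : isbox 1 k N w.
Hypothesis w_top : all (fun t : int => t + k%:Z <= (k * N)%N%:Z) (tails w).
Hypothesis N_gt0 : (0 < N)%N.

Let H := word_hseq w.

Lemma dval_word (z : int) : - k%:Z <= z < (k * N)%N%:Z ->
  dval H z = (z %/ k%:Z)%Z + 1 - (tails_le w z)%:Z.
Proof.
have [z0|z0] := ltP z 0.
  move=> zk; rewrite dval_lt0 // tails_le_lt0 // subr0.
  have := divzBr1 (z + k%:Z) k_gt0; rewrite addrK => ->.
  by rewrite divz_small ?subrK //; lia.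
case: z z0 => // m _ /andP[_ mN]; rewrite /= word_hseqE.
have -> : (m < k * N)%N by lia.
by rewrite divz_nat; have := tails_le_bound m w_box; lia.
Qed.

Lemma dval_word_big (z : int) : (k * N)%N%:Z <= z -> dval H z = 0.
Proof. by case: z => // m mN; rewrite /= word_hseqE ltnNge -lez_nat mN. Qed.

Lemma tails_le_big (z : int) : (k * N)%N%:Z - k%:Z <= z -> tails_le w z = N.
Proof.
move=> zN; rewrite /tails_le (eq_in_count (a2 := predT)).
  by rewrite count_predT size_atails; case/andP: w_box => /eqP -> _; rewrite mul1n.
by move=> t /(allP w_top) tN; rewrite /at_most /=; lia.
Qed.

Lemma eta_word_lt (i : int) : Defs.eta k H < i -> i < (k * N)%N%:Z -> (0 < tails_le w i)%N.
Proof.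
move=> ei iN; rewrite lt0n; apply/negP => /eqP ti.
have e1 : -1 <= Defs.eta k H by apply: eta_geN1.
have [_ /(_ i)] := is_eta_eta H k_gt0.
suff fi : full_upto k H i by move=> /(_ fi); lia.
split=> [|j /andP[j1 ji]]; first by lia.
rewrite dval_word; last by lia.
have -> : tails_le w j = 0%N by apply/eqP; rewrite -leqn0 -ti tails_le_mono.
by rewrite subr0.
Qed.

Lemma word_good : good k H.
Proof.
move=> i ei; have e1 : -1 <= Defs.eta k H by apply: eta_geN1.
have kN : (k <= k * N)%N by rewrite leq_pmulr.
have dge j : 0 <= dval H j by apply: dval_ge0.
have [iN|iN] := ltP (i + 1) (k * N)%N%:Z; last first.
  rewrite /adiff (dval_word_big iN) dge; split=> //.
  by have := dge i; have := tau_ge0 k i; lia.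
split.
  rewrite /adiff !dval_word; try lia.
  rewrite divz_tau //; have := tails_le_mono w (_ : i <= i + 1); lia.
(* Some vertical step starts at or below [i + 1], so the walk descends from [i + 2] to [i + 1], and
   [heads_count] gives a strict increase. *)
have t0 : (0 < tails_le w (i + 1))%N by apply: eta_word_lt => //; lia.
rewrite !dval_word; try lia.
rewrite divzBr1 //.
suff : (tails_le w (i + 1 - k%:Z) < tails_le w (i + 1))%N by lia.
rewrite -(heads_count (i + 1) w_box) -addn1 leq_add2l -has_count has_pred1.
by apply: crossing; rewrite ?has_count // /top; lia.
Qed.

Lemma hsize_word : hsize H = area w.
Proof.
rewrite (@hsizeE _ (k * N)); last by move=> i iN; rewrite word_hseqE ltnNge iN.
suff : (\sum_(0 <= i < k * N) H i + \sum_(0 <= i < k * N) tails_le w i%:Z)%N%:Z =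
       (area w)%:Z + (\sum_(0 <= i < k * N) tails_le w i%:Z)%N%:Z by lia.
rewrite -big_split /= big_nat (eq_bigr (fun i => (i %/ k).+1)); last first.
  move=> i /andP[_ iN]; rewrite word_hseqE iN subnK //; exact: tails_le_bound.
rewrite -big_nat sum_divn_succ.
(* A vertical step starting at [t] is counted in [tails_le w i] for the [k * N - t] values of [i]
   from [t] on. *)
have -> : (\sum_(0 <= i < k * N) tails_le w i%:Z)%N%:Z =
    \sum_(t <- tails w) ((k * N)%N%:Z - t).
  rewrite /tails_le -/(tails w); have := w_top; have := tails_ge0 w_box.
  elim: (tails w) => [|t l IHl] /=; first by rewrite big1 ?big_nil.
  move=> /andP[t0 l0] /andP[tN lN]; rewrite big_split big_cons PoszD IHl //; congr (_ + _).
  case: t t0 tN => // t _ tN.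
  rewrite (@big_cat_nat _ _ _ t) //=; last by lia.
  rewrite big_nat big1 ?add0n; last first.
    by move=> i /andP[_ it]; rewrite /at_most lez_nat leqNgt it.
  rewrite big_nat (eq_bigr (fun=> 1%N)); last first.
    by move=> i /andP[ti _]; rewrite /at_most lez_nat ti.
  by rewrite -big_nat sum_nat_const_nat muln1 subzn //; lia.
rewrite sumrB sum_tails; case/andP: w_box => /eqP -> /eqP ->.
have -> : \sum_(t <- tails w) (k * N)%N%:Z = (N * (k * N))%N%:Z.
  rewrite big_const_seq count_predT size_atails iter_addr_0.
  by case/andP: w_box => /eqP -> _; rewrite mul1n -mulr_natl natz -PoszM.
rewrite /top !mul1n [in LHS]binS bin1.
have e2 : (N * N = 2 * 'C(N, 2) + N)%N.
  by have := mul_bin_diag N 1; rewrite bin1 => <-; rewrite addnC -mulnS prednK.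
have e3 : (N * (k * N) = k * 'C(N, 2) + k * 'C(N, 2) + k * N)%N.
  by rewrite mulnCA e2 mulnDr mulnA [(k * 2)%N]mulnC -mulnA mul2n addnn.
by rewrite -PoszM [(k * N * N)%N]mulnC subrr add0r e3 mulnDr !PoszD; ring.
Qed.
Hypothesis N_area : N = (area w).+2.

Lemma count_tails_word (y : nat) : count_mem y%:Z (tails w) = vsteps k H y.
Proof.
have HN : (hsize H).+2 = N by rewrite hsize_word N_area.
have := tails_leS w (y%:Z - 1); rewrite subrK => cy.
have [yN|Ny] := ltnP y (k * N); last first.
  rewrite /vsteps HN ltnNge Ny /=; move: cy.
  by move: (count_mem _ _) => c; rewrite !tails_le_big; lia.
have yN' : (y < k * (hsize H).+2)%N by rewrite HN.
have := vstepsE k_gt0 word_good yN'.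
rewrite !dval_word; try lia.
have := divz_tau (y%:Z - 1) k_gt0; rewrite subrK /tau subrK /= => ->.
by move: (count_mem _ _) cy => c; lia.
Qed.

Lemma count_heads_word (y : nat) : count_mem y%:Z (hts w) = htails k H y.
Proof.
have HN : (hsize H).+2 = N by rewrite hsize_word N_area.
case: y => [|m] /=.
  apply/eqP; rewrite -leqn0 leqNgt -has_count; apply/hasPn => t tw /=.
  case/andP: w_box => /eqP h1 /eqP h2.
  have [||_ _ _ /allP/(_ t tw)] := @tails_range 1 k w top 0 (2 * (k * N)%N%:Z); rewrite ?h1 ?h2 /top.
  - by lia.
  - by lia.
  by rewrite /down; lia.
have := heads_count m%:Z w_box; rewrite (_ : m%:Z + 1 = m.+1%:Z) => [cm|]; last by lia.
have [mN|Nm] := ltnP m (k * N); last first.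
  rewrite /hsteps HN ltnNge Nm /=; move: cm.
  by move: (count_mem _ _) => c; rewrite !tails_le_big; lia.
have mN' : (m < k * (hsize H).+2)%N by rewrite HN.
have := hstepsE k_gt0 word_good mN'.
rewrite !dval_word; try lia.
rewrite divzBr1 //.
by move: (count_mem _ _) cm => c; lia.
Qed.
(** In the formula of [invs_levels], the vertical steps in the window of a horizontal step [m] are
    those crossing between [m - 1] and [m], as numerous as the horizontal steps starting at [m]; the
    terms in [midphi] add -1. *)
Lemma mid_word :
  (2 * invs (midc 1 k) w = \sum_(0 <= m < k * N) hsteps k H m * (hsteps k H m).-1)%N.
Proof.
pose g (m : int) : int := (count_mem m (hts w))%:Z - 1.
have htsP m : m \in hts w -> exists2 v : nat, (v < k * N)%N & m = v.+1%:Z.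
  move=> mw; have h0 : (0 < count_mem m (hts w))%N by rewrite -has_count has_pred1.
  case: m mw h0 => [[|v]|v] mw h0.
  - by move: h0; rewrite count_heads_word.
  - exists v => //; move: h0; rewrite count_heads_word /= /hsteps.
    by rewrite hsize_word -N_area; case: ifP.
  case/andP: w_box => /eqP h1 /eqP h2.
  have [||_ _ _ /allP/(_ _ mw)] := @tails_range 1 k w top 0 (2 * (k * N)%N%:Z); rewrite ?h1 ?h2 /top.
  - by lia.
  - by lia.
  by rewrite /down; lia.
suff : (2 * invs (midc 1 k) w)%N%:Z = (\sum_(0 <= m < k * N) hsteps k H m * (hsteps k H m).-1)%N%:Z by case.
rewrite PoszM (invs_levels (midcE (ltn0Sn 0) k_gt0) (midK_sym (ltn0Sn 0) k_gt0) (midphi_step (ltn0Sn 0) k_gt0) w top).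
rewrite (box_endp w_box).
rewrite big_seq (eq_bigr g) => [|m mw]; last first.
  have [v vN mE] := htsP m mw; rewrite /g.
  have -> : \sum_(j <- atails (up k) (down 1) w top) midK 1 k (down 1 m - j) = (count_mem m (hts w))%:Z.
    have := heads_count (m - 1) w_box; rewrite subrK /tails_le => hc.
    suff : \sum_(j <- tails w) midK 1 k (down 1 m - j) + (count (at_most (m - 1 - k%:Z)) (tails w))%:Z
       = (count (at_most (m - 1)) (tails w))%:Z.
      by rewrite /tails -hc PoszD addrC => /addrI.
    elim: (tails w) => [|t l IHl]; first by rewrite big_nil.
    rewrite big_cons /= !PoszD addrACA IHl; congr (_ + _).
    by rewrite /midK /down /at_most; lia.
  congr (_ + _); rewrite /midphi !addrK.
  by rewrite !(floorS_step (ltn0Sn 0) k_gt0) mE /down /top; lia.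
rewrite -big_seq.
have -> : \sum_(m <- hts w) g m = \sum_(0 <= v < k * N) (count_mem v.+1%:Z (hts w))%:Z * g v.+1%:Z.
  move: (htsP); elim: (hts w) => [|m l IHl] lP.
    by rewrite big_nil big1 // => v _; rewrite mul0r.
  rewrite big_cons IHl; last by move=> m' m'l; apply: lP; rewrite inE m'l orbT.
  have [v vN ->] := lP m (mem_head _ _).
  under [RHS]eq_bigr do rewrite /= PoszD mulrDl.
  rewrite big_split /=; congr (_ + _).
  rewrite (bigD1_seq v) ?mem_index_iota ?iota_uniq //= eqxx mul1r.
  rewrite big1 ?addr0 // => u uv.
  by rewrite [_ == _](_ : _ = false) ?mul0r //; apply/eqP; case=> vu; rewrite vu eqxx in uv.
rewrite [RHS](big_morph Posz PoszD (erefl _)); apply: eq_bigr => m _.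
rewrite /g count_heads_word /=; case: (hsteps _ _ _) => [|h]; first by rewrite mul0r.
by rewrite /= PoszM; congr (_ * _); lia.
Qed.
End Diagram.
End WordHilbert.

(** * The class of a good sequence *)

Lemma lev_period P y : (1 < P)%N -> lev P (y + P%:Z) = lev P y.
Proof. by move=> P1; rewrite /lev rmorphD /= -pmulrn pchar_Zp // addr0. Qed.

Lemma lev_val P (v : 'I_(Zp_trunc P).+2) : lev P (v : nat)%:Z = v.
Proof. by rewrite /lev -pmulrn natr_Zp. Qed.

Lemma ltn_lev P (v : 'I_(Zp_trunc P).+2) : (1 < P)%N -> (v < P)%N.
Proof. by move=> P1; rewrite -[X in (_ < X)%N](Zp_cast P1) ltn_ord. Qed.

Lemma val_lev P (u : nat) : (u < P)%N -> (1 < P)%N -> lev P u%:Z = u :> nat.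
Proof. by move=> uP P1; have := @levK P u%:Z P1; rewrite lez_nat ltz_nat uP => /(_ isT)[]. Qed.

Lemma val_levD P c (v : 'I_(Zp_trunc P).+2) : (1 < P)%N -> (c < P)%N ->
  levD c v = (if (v + c < P)%N then v + c else v + c - P)%N :> nat.
Proof.
move=> P1 cP; have vP := ltn_lev v P1.
rewrite -{1}(lev_val v) -lev_up /up; case: ltnP => h; first by rewrite -PoszD val_lev.
have -> : v%:Z + c%:Z = (v + c - P)%N%:Z + P%:Z by lia.
by rewrite lev_period // val_lev //; lia.
Qed.

Lemma val_levB P c (v : 'I_(Zp_trunc P).+2) : (1 < P)%N -> (c < P)%N ->
  levB c v = (if c <= v then v - c else v + P - c)%N :> nat.
Proof.
move=> P1 cP; have vP := ltn_lev v P1.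
rewrite -{1}(lev_val v) -lev_down /down; case: leqP => h.
  by rewrite subzn // val_lev //; lia.
rewrite -lev_period //; have -> : v%:Z - c%:Z + P%:Z = (v + P - c)%N%:Z by lia.
by rewrite val_lev //; lia.
Qed.

Section GoodClass.
Variables (k : nat) (H : hseq).
Hypotheses (k_gt0 : (0 < k)%N) (gH : good k H).

Let e := Defs.eta k H.
Let n := hsize H.
Let N := n.+2.
Let E := vsteps k H.
Let Es := vsteps_shift k H.
Let hs := hsteps k H.
Let ht := htails k H.

Lemma sum_vsteps m : (m < k * N)%N ->
  (\sum_(0 <= j < m.+1) E j)%N%:Z = (m %/ k)%N%:Z + 1 - dval H m%:Z.
Proof.
elim: m => [|m IHm] mN.
  by rewrite big_nat1 vstepsE // dvdn0 div0n dval_lt0 //; lia.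
rewrite big_nat_recr //= PoszD IHm; last by lia.
rewrite vstepsE // divnS // PoszD.
have -> : m.+1%:Z - 1 = m%:Z by lia.
by ring.
Qed.

Lemma sum_all_vsteps : (\sum_(0 <= j < k * N) E j = N)%N.
Proof.
have kn : (k * n + k + k = k * N)%N by rewrite /N !mulnS; lia.
have lt : ((k * N).-1 < k * N)%N by lia.
have := sum_vsteps lt; rewrite prednK; last by lia.
rewrite (dval_large k_gt0 gH); last by rewrite -/n; lia.
have -> : ((k * N).-1 %/ k = N.-1)%N.
  have -> : ((k * N).-1 = N.-1 * k + k.-1)%N by rewrite /N /= !mulnS mulnC; lia.
  by rewrite divnMDl // divn_small ?addn0 // prednK.
by rewrite /N /=; lia.
Qed.

Lemma sum_all_hsteps : (\sum_(0 <= m < k * N) hs m = k * N)%N.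
Proof.
have kn : (k * n + k + k = k * N)%N by rewrite /N !mulnS; lia.
(* The sum of [H] over the [k] levels before [M]; [hs M] is 1 minus the increment of [D] from [M] to
   [M.+1]. *)
pose D (M : nat) : int := \sum_(0 <= c < k) dval H (M%:Z - k%:Z + c%:Z).
have DS M : D M.+1 = D M - dval H (M%:Z - k%:Z) + dval H M%:Z.
  have := erefl (\sum_(0 <= c < k.+1) dval H (M%:Z - k%:Z + c%:Z)).
  rewrite {1}big_nat_recl // big_nat_recr //= addr0 -/(D M).
  have -> : \sum_(0 <= i < k) dval H (M%:Z - k%:Z + i.+1%:Z) = D M.+1.
    by apply: eq_bigr => i _; congr (dval H _); lia.
  by rewrite subrK => h; rewrite addrAC -[X in X - _]h addrC addKr.
have IH M : (M <= k * N)%N -> (\sum_(0 <= m < M) hs m)%N%:Z = M%:Z - D M.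
  elim: M => [|M IHM] MN.
    rewrite big_geq // /D big_nat big1 // => c cP.
    by rewrite dval_lt0 //; lia.
  rewrite big_nat_recr //= PoszD IHM; last by lia.
  by rewrite hstepsE // DS; lia.
suff : (\sum_(0 <= m < k * N) hs m)%N%:Z = (k * N)%N%:Z by case.
rewrite IH // [D _](_ : _ = 0) ?subr0 // /D big1 // => c _.
by rewrite (dval_large k_gt0 gH) -/n; lia.
Qed.

Lemma sum_hsteps_sq : (\sum_(0 <= m < k * N) hs m ^ 2 =
  k * \sum_(0 <= u < k * N) E u ^ 2
  + 2 * \sum_(1 <= d < k) (k - d) * \sum_(0 <= u < k * N) E u * E (u + d))%N.
Proof.
have Es0 i : (i < k)%N -> Es i = 0%N by rewrite /Es /vsteps_shift ltnNge => /negPf ->.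
have EsD u : Es (u + k) = E u by rewrite /Es /vsteps_shift leq_addl addnK.
have EsM i : (k * N + k <= i)%N -> Es i = 0%N.
  move=> Mi; have ki : (k <= i)%N by apply: leq_trans Mi; apply: leq_addl.
  by rewrite -(subnK ki) EsD /E /vsteps ifF //; lia.
have unshift (G : nat -> nat) :
    (\sum_(0 <= j < k * N + k) Es j * G j = \sum_(0 <= u < k * N) E u * G (u + k))%N.
  rewrite (@big_cat_nat _ _ _ k) ?leq_addl //= big_nat big1 => [|i /= ik]; last by rewrite Es0.
  rewrite add0n -{1}[k]add0n big_addn addnK.
  by apply: eq_bigr => u _; rewrite EsD.
have := window_sq Es0 EsM (leqnn k).
have -> : (\sum_(0 <= j < k * N + k) (\sum_(0 <= c < k) Es (j + c)) ^ 2 = \sum_(0 <= m < k * N) hs m ^ 2)%N.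
  rewrite (_ : (k * N + k = (k * N + k.-1).+1)%N); last by lia.
  rewrite big_nat_recl //= big_nat big1 => [|c ck]; last by rewrite Es0.
  rewrite add0n; under eq_bigr do rewrite -(hsteps_window k_gt0 gH).
  rewrite (@big_cat_nat _ _ _ (k * N)) ?leq_addr //= [X in (_ + X)%N]big_nat [X in (_ + X)%N]big1 ?addn0 //.
  by move=> i /andP[iN _]; rewrite /hsteps ltnNge iN.
have -> : (\sum_(0 <= j < k * N + k) Es j ^ 2 = \sum_(0 <= u < k * N) E u ^ 2)%N.
  rewrite (unshift Es); by apply: eq_bigr => u _; rewrite EsD.
move=> ->; congr (_ + 2 * _)%N; apply: eq_bigr => d _; congr muln.
rewrite (unshift (fun j => Es (j + d))); apply: eq_bigr => u _.
by rewrite addnAC EsD.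
Qed.

Lemma adiff_vsteps (j : nat) : (j < k * N)%N -> adiff k H (j%:Z - 1) = (E j)%:Z.
Proof. by move=> jN; rewrite vstepsE // /adiff /tau subrK. Qed.

Lemma adiff_tau (i : int) : (k * n)%N%:Z <= i -> adiff k H i = tau k i.
Proof.
by move=> ni; rewrite /adiff !(dval_large k_gt0 gH) //; rewrite -/n; lia.
Qed.

(* Hence the terms of [chi] beyond the support of [H] vanish. *)
Lemma tau_window (i : int) j : (0 < j < k)%N -> 0 < tau k i -> tau k (i + j%:Z) = 0.
Proof.
move=> /andP[j0 jk]; rewrite /tau addrAC; case di: (k%:Z %| i + 1)%Z => // _.
rewrite rpredDl // (_ : (k%:Z %| j%:Z)%Z = (k %| j)%N); last by [].
by case: (boolP (k %| j)%N) => // /dvdn_leq; lia.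
Qed.

(** By [sum_hsteps_sq] the squares give the quadratic part of [chi]; the linear parts match because
    the [hs m] sum up to [k * N], which is [k] times the sum of the [E u]. *)
Lemma chi_hsteps : 2 * chi k H = (\sum_(0 <= m < k * N) hs m * (hs m).-1)%N%:R.
Proof.
have kn : (k * n + k + k = k * N)%N by rewrite /N !mulnS; lia.
have e1 : -1 <= e := eta_geN1 H k_gt0.
pose r := [seq j%:Z - 1 | j <- iota 0 (k * N)] : seq int.
have rP (i : int) : i \in r = (-1 <= i) && (i < (k * N)%N%:Z - 1).
  apply/mapP/idP => [[j jN ->]|/andP[i1 iN]]; first by move: jN; rewrite mem_iota; lia.
  by exists (absz (i + 1)); [rewrite mem_iota; lia|lia].
rewrite /chi (@fsbig_seq_support _ _ _ _ _ r); last 3 first.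
- by rewrite map_inj_uniq ?iota_uniq // => x y /addIr [].
- move=> i /= ei; rewrite rP => ir.
  have iN : (k * n)%N%:Z <= i by lia.
  rewrite adiff_tau //; have [ti|ti] := posnP (absz (tau k i)).
    by move/eqP: ti; rewrite absz_eq0 => /eqP ->; rewrite mul0r.
  rewrite big_nat big1 ?addr0 => [|j jk]; last first.
    rewrite adiff_tau; last by lia.
    by rewrite tau_window ?mulr0 //; lia.
  have -> : tau k i = 1 by move: ti; rewrite /tau; case: (_ %| _)%Z.
  by rewrite subrr mulr0 mulr0.
- move=> i ir ei; rewrite adiff_full ?mul0r //.
  by move: ir ei; rewrite rP /= -/e => /andP[-> _] /negP; rewrite -ltNge.
rewrite big_map -[X in iota _ X]subn0 -/(index_iota 0 (k * N)) big_distrr /=.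
have -> : (\sum_(0 <= m < k * N) hs m * (hs m).-1)%N%:R =
    (\sum_(0 <= m < k * N) hs m ^ 2)%N%:R - k%:R * (\sum_(0 <= u < k * N) E u)%N%:R :> rat.
  apply/eqP; rewrite eq_sym subr_eq -natrM -natrD eqr_nat sum_all_vsteps -[X in (_ + X)%N]sum_all_hsteps.
  rewrite -big_split; apply/eqP/eq_bigr => m _ /=.
  by case: (hs m) => // h; rewrite /= -mulnn mulnS addnC.
have -> : (\sum_(0 <= m < k * N) hs m ^ 2 =
    \sum_(0 <= u < k * N) (k * E u ^ 2 + 2 * (E u * \sum_(1 <= d < k) (k - d) * E (u + d))))%N.
  rewrite sum_hsteps_sq big_split /= -!big_distrr /=; congr (_ + 2 * _)%N.
  under [RHS]eq_bigr do rewrite big_distrr /=.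
  rewrite [RHS]exchange_big /=; apply: eq_bigr => d _.
  by rewrite big_distrr /=; apply: eq_bigr => u _; rewrite mulnCA.
rewrite !natr_sum mulr_sumr -sumrB big_nat [RHS]big_nat; apply: eq_bigr => j /= jN.
rewrite adiff_vsteps //; have [->|Ej] := posnP (E j).
  by rewrite mul0r mulr0 mul0n exp0n // !muln0 mulr0 subrr.
have -> : \sum_(1 <= d < k) (k - d)%:R * (adiff k H (j%:Z - 1 + d%:Z))%:~R =
    (\sum_(1 <= d < k) (k - d) * E (j + d))%N%:R :> rat.
  rewrite natr_sum; apply: eq_big_nat => d dk.
  rewrite natrM; congr (_ * _).
  rewrite addrAC -PoszD; have [jd|jd] := ltnP (j + d) (k * N); first by rewrite adiff_vsteps.
  (* Beyond the cutoff [E] is 0 whereas [adiff] is [tau]; but [E j] is positive, so [j] is a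
     multiple of [k] and [tau] vanishes in the rest of the window. *)
  have tj : 0 < tau k (j%:Z - 1).
    by rewrite -adiff_tau ?adiff_vsteps //; lia.
  rewrite adiff_tau; last by lia.
  rewrite PoszD addrAC tau_window // /E /vsteps ifF //; lia.
move: (\sum_(1 <= d < k) _)%N => S'.
rewrite -mulnn !natrD !natrM -!pmulrn.
by move: (E j)%:R k%:R S'%:R => x y z; field.
Qed.

Let P := period 1 k N.
Let aT := @levD P k.
Let aT' := @levB P k.
Let bT := @levB P 1.
Let bT' := @levD P 1.
Let root := lev P (1 * k * N)%N%:Z.
Let A (v : 'I_(Zp_trunc P).+2) := E v.
Let B (v : 'I_(Zp_trunc P).+2) := ht v.

Let P1 : (1 < P)%N. Proof. by rewrite /P /period; lia. Qed.
Let kP : (k < P)%N. Proof. by rewrite /P /period; lia. Qed.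
Let PE : P = (2 * (k * N) + k + 3)%N. Proof. by rewrite /P /period mul1n; lia. Qed.

Let E_big u : (k * N <= u)%N -> E u = 0%N.
Proof. by rewrite /E /vsteps leqNgt => /negPf ->. Qed.
Let hs_big u : (k * N <= u)%N -> hs u = 0%N.
Proof. by rewrite /hs /hsteps leqNgt => /negPf ->. Qed.

Let A'E v : A (aT' v) = Es v.
Proof.
rewrite /A /Es /vsteps_shift val_levB //; case: leqP => // vk.
by rewrite E_big //; have := PE; lia.
Qed.

Let B'E v : B (bT' v) = hs v.
Proof.
rewrite /B /ht val_levD //; case: ltnP => h; first by rewrite addn1.
have vP := ltn_lev v P1.
have -> : (v + 1 - P = 0)%N by lia.
by rewrite hs_big //; lia.
Qed.

Let cl : closed_cls aT' bT' A B.
Proof. by move=> v; rewrite A'E B'E steps_balance. Qed.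

Let sum_ord (f : nat -> nat) m : (m <= P)%N -> (forall i, (m <= i)%N -> f i = 0%N) ->
  (\sum_(v < (Zp_trunc P).+2) f v = \sum_(0 <= i < m) f i)%N.
Proof.
move=> mP f0; rewrite -(big_mkord xpredT) Zp_cast // (@big_cat_nat _ _ _ m) //=.
by rewrite [X in (_ + X)%N]big_nat [X in (_ + X)%N]big1 ?addn0 // => i /andP[mi _]; apply: f0.
Qed.

Let tot : nedges A B = (1 * N + k * N)%N.
Proof.
rewrite /nedges big_split /= /A /B (@sum_ord E (k * N)) ?sum_all_vsteps; try by (have := PE; lia).
  rewrite (@sum_ord ht (k * N).+1); last 2 first.
  - by have := PE; lia.
  - by case=> // i; rewrite ltnS => /hs_big.
  by rewrite big_nat_recl //= sum_all_hsteps mul1n.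
exact: E_big.
Qed.

Let rootE : root = (k * N)%N :> nat.
Proof. by rewrite /root val_lev ?mul1n //; have := PE; lia. Qed.

Let eN : e < (k * n)%N%:Z. Proof. exact: eta_lt. Qed.
Let knN : (k * n + k + k = k * N)%N. Proof. by rewrite /N !mulnS; lia. Qed.

Let inner (u : nat) : bool := (e < u%:Z) && (u < k * N)%N.

Let outer0 u : ~~ inner u -> u != (k * N)%N -> (Es u = 0 /\ hs u = 0)%N.
Proof.
rewrite /inner negb_and -leNgt -leqNgt => /orP[ue|Nu] uN.
  rewrite /hs hsteps_small // /Es /vsteps_shift; split=> //.
  by case: leqP => // ku; rewrite vsteps_small //; lia.
rewrite hs_big //; split=> //.
have := steps_balance k_gt0 gH u; rewrite -/(vsteps_shift k H u) -/E -/hs -/ht -/Es.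
rewrite (hs_big Nu) (E_big Nu) addn0 add0n => ->.
by case: u Nu uN => // u Nu uN /=; apply: hs_big; lia.
Qed.

Let Es_gt0 u : (0 < Es u)%N -> (k <= u)%N.
Proof. by rewrite /Es /vsteps_shift; case: ifP. Qed.

Let tails (w : bitseq) : seq int := atails (up k) (down 1) w (1 * k * N)%N%:Z.
Let hts (w : bitseq) : seq int := btails (up k) (down 1) w (1 * k * N)%N%:Z.

Lemma incls_counts w : isbox 1 k N w ->
  incls aT bT A B w root <->
  forall y : nat, (y < P)%N ->
    count_mem y%:Z (tails w) = E y /\ count_mem y%:Z (hts w) = ht y.
Proof.
move=> bw; have bP (y : nat) : (y < P)%N -> 0 <= y%:Z < P%:Z by lia.
split=> [cw y yP|cw].
  have [/eqP cA /eqP cB] := andP (forallP cw (lev P y%:Z)).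
  move: cA cB; rewrite /A /B val_lev // => <- <-.
  by rewrite (count_atails_lev (ltn0Sn 0) k_gt0 bw (bP y yP)) (count_btails_lev (ltn0Sn 0) k_gt0 bw (bP y yP)).
apply/forallP => v; have vP := ltn_lev v P1; have [cA cB] := cw v vP.
rewrite -(lev_val v) (count_atails_lev (ltn0Sn 0) k_gt0 bw (bP v vP)) (count_btails_lev (ltn0Sn 0) k_gt0 bw (bP v vP)).
by rewrite lev_val /A /B -cA -cB !eqxx.
Qed.

Lemma incls_box w : incls aT bT A B w root -> isbox 1 k N w.
Proof.
move=> cw; rewrite /isbox -(size_atails aT bT w root) -(size_btails aT bT w root).
rewrite -!sum_count_mem.
have -> : (\sum_v count_mem v (atails aT bT w root) = \sum_v A v)%N.
  by apply: eq_bigr => v _; have [/eqP] := andP (forallP cw v).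
have -> : (\sum_v count_mem v (btails aT bT w root) = \sum_v B v)%N.
  by apply: eq_bigr => v _; have [_ /eqP] := andP (forallP cw v).
rewrite /A /B (@sum_ord E (k * N)) ?sum_all_vsteps ?mul1n ?eqxx //; last by (have := PE; lia).
rewrite (@sum_ord ht (k * N).+1) ?big_nat_recl //= ?sum_all_hsteps //; first by (have := PE; lia).
by case=> // i; rewrite ltnS => /hs_big.
Qed.

(** Counts and [H] determine each other: [H] is obtained from the partial sums of [E], and
    [count_tails_word] and [count_heads_word] recover the counts. *)
Lemma incls_good w :
  incls aT bT A B w root = [&& isbox 1 k N w, area w == n & word_hseq k N w == H].
Proof.
apply/idP/and3P => [cw|[bw /eqP aw /eqP wH]]; last first.
  apply/(incls_counts bw) => y yP.
  have N_area : N = (area w).+2 by rewrite aw.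
  have wt : all (fun t : int => t + k%:Z <= (k * N)%N%:Z) (tails w).
    by apply: tails_top => //; rewrite N_area.
  by rewrite /tails /hts (count_tails_word k_gt0 bw wt) // (count_heads_word k_gt0 bw wt) // wH.
have bw := incls_box cw; have cnt := iffLR (incls_counts bw) cw.
have t0 := tails_ge0 k_gt0 bw.
have tE (t : nat) : t%:Z \in tails w -> (0 < E t)%N.
  move=> tw; have tP : (t < P)%N.
    case/andP: (bw) => /eqP h1 /eqP h2.
    have [||/allP/(_ _ tw) + _ _ _] := @tails_range 1 k w (1 * k * N)%N%:Z 0 (2 * (k * N)%N%:Z); rewrite ?h1 ?h2.
    - by lia.
    - by lia.
    by have := PE; lia.
  by have [<- _] := cnt t tP; rewrite -has_count has_pred1.
have wt : all (fun t : int => t + k%:Z <= (k * N)%N%:Z) (tails w).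
  apply/allP => t tw; have := allP t0 t tw.
  case: t tw => // t tw _; have Et := tE t tw.
  have [tn|nt] := leqP t (k * n); first by lia.
  move: Et; rewrite /E vsteps_big // lt0b => /andP[/dvdnP[c cE] tN].
  have cN : (c < N)%N by rewrite -(ltn_pmul2l k_gt0) mulnC -cE.
  have : (k * c.+1 <= k * N)%N by rewrite leq_pmul2l.
  by rewrite mulnS mulnC -cE; lia.
have tl (m : nat) : (m < k * N)%N -> tails_le k N w m%:Z = (\sum_(0 <= j < m.+1) E j)%N.
  elim: m => [|m IHm] mN.
    rewrite big_nat1; have [|<- _] := cnt 0%N; first by (have := PE; lia).
    by have := tails_leS N k_gt0 w (-1); rewrite (tails_le_lt0 k_gt0 bw).
  rewrite big_nat_recr //= -IHm; last by lia.
  have [|<- _] := cnt m.+1; first by (have := PE; lia).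
  have := tails_leS N k_gt0 w m%:Z; rewrite (_ : m%:Z + 1 = m.+1%:Z); last by lia.
  by move=> <-.
have wH : word_hseq k N w = H.
  apply/fsfunP => m; rewrite word_hseqE; case: ltnP => mN; last first.
    suff : dval H m%:Z = 0 by case.
    by apply: (dval_large k_gt0 gH); rewrite -/n; lia.
  have := sum_vsteps mN; rewrite -tl //= -addn1; move: (H m) => h; lia.
split=> //; last by rewrite wH.
by rewrite -(hsize_word k_gt0 bw wt) // wH.
Qed.
Variables (F : fieldType) (q : F).
Hypothesis q0 : q != 0.
Hypothesis q1 : forall n, (0 < n)%N -> 1 - q ^+ n != 0.

(** On an inner level [w], column [w] is the indicator of the levels above [e] and up to [w]; the
    other columns are those of the identity. *)
Let S : 'M[F]_((Zp_trunc P).+2) := \matrix_(u, w)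
  ((u == w) || [&& (e < (u : nat)%:Z)%R, u <= w & w < k * N])%N%:R.

(** Multiplying by the unitriangular [S] makes the matrix lower triangular: for inner [v < w] all
    levels reached from [v] lie in the indicator of column [w] and the coefficients of row [v] sum
    to zero, while for [v = w] the level [v + 1] drops out and [1 - q ^+ hs v] remains. *)
Lemma det_good : \det (lap q bT' aT' (B \o bT') (A \o aT') root) =
  \prod_(v < (Zp_trunc P).+2 | inner v) (1 - q ^+ hs v).
Proof.
have detS : \det S = 1.
  rewrite -det_tr det_trig ?big1 // => [i _|].
    by rewrite !mxE eqxx.
  apply/is_trig_mxP => i j ij; rewrite !mxE -val_eqE /=.
  by rewrite gtn_eqF //= [(j <= i)%N]leqNgt ij andbF.
set M := lap _ _ _ _ _ _.
have MvE (v u : 'I_(Zp_trunc P).+2) : M v u =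
    if (v == root) || (u == root) || (hs v + Es v == 0)%N then (v == u)%:R else
    (1 - q ^+ (hs v + Es v)) * (v == u)%:R - (1 - q ^+ hs v) * (bT' v == u)%:R
    - q ^+ hs v * (1 - q ^+ Es v) * (aT' v == u)%:R.
  by rewrite mxE [(B \o bT') v]B'E [(A \o aT') v]A'E.
have rowE (v w : 'I_(Zp_trunc P).+2) : inner v ->
   (M *m S) v w = (1 - q ^+ (hs v + Es v)) * S v w
      - (if bT' v == root then 0 else (1 - q ^+ hs v) * S (bT' v) w)
      - (if aT' v == root then 0 else q ^+ hs v * (1 - q ^+ Es v) * S (aT' v) w).
  move=> iv; have vroot : (v == root) = false.
    by apply/eqP => vr; move: iv; rewrite vr /inner rootE ltnn andbF.
  have hs0 : (0 < hs v)%N by case/andP: iv => ev vN; apply: hsteps_gt0.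
  have pt (t : 'I_(Zp_trunc P).+2) (c : F) :
      \sum_u (if u == root then 0 else c * (t == u)%:R) * S u w = if t == root then 0 else c * S t w.
    rewrite (bigD1 t) //= eqxx big1 ?addr0; last first.
      by move=> u ut; rewrite [t == u]eq_sym (negPf ut) mulr0 if_same mul0r.
    by case: ifP => _; rewrite ?mul0r ?mulr1.
  have := pt v (1 - q ^+ (hs v + Es v)).
  rewrite vroot => <-; rewrite -(pt (bT' v) (1 - q ^+ hs v)) -(pt (aT' v) (q ^+ hs v * (1 - q ^+ Es v))).
  rewrite -!sumrB [LHS]mxE; apply: eq_bigr => u _.
  rewrite -!mulrBl; congr (_ * _).
  rewrite MvE vroot gtn_eqF ?addn_gt0 ?hs0 // orbF.
  case: eqP => [->|_] //=; last by rewrite vroot !subr0.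
have rowE0 (v w : 'I_(Zp_trunc P).+2) : ~~ inner v -> (M *m S) v w = S v w.
  move=> iv; rewrite mxE (bigD1 v) //= big1 => [|u uv]; rewrite MvE.
    have [vr|vr] := eqVneq v root; first by rewrite /= eqxx mul1r addr0.
    have [|-> ->] := outer0 iv; last by rewrite orbT eqxx mul1r addr0.
    by apply: contra vr => /eqP vN; apply/eqP/val_inj; rewrite /= vN rootE.
  have [vr|vr] := eqVneq v root; first by rewrite /= eq_sym (negPf uv) mul0r.
  have [|-> ->] := outer0 iv; last by rewrite orbT eq_sym (negPf uv) mul0r.
  by apply: contra vr => /eqP vN; apply/eqP/val_inj; rewrite /= vN rootE.
have valb (v : 'I_(Zp_trunc P).+2) : inner v -> bT' v = v.+1 :> nat.
  by move=> /andP[_ vN]; rewrite val_levD // addn1; case: ltnP => //; have := PE; lia.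
have Sinner (v w : 'I_(Zp_trunc P).+2) : inner v -> (v <= w)%N -> (w < k * N)%N -> S v w = 1.
  by move=> /andP[ev vN] vw wN; rewrite mxE ev vw wN orbT.
have back (v w : 'I_(Zp_trunc P).+2) : inner v -> (v <= w)%N -> (w < k * N)%N ->
    (1 - q ^+ Es v) * S (aT' v) w = 1 - q ^+ Es v.
  move=> iv vw wN; have [-> | Ev] := posnP (Es v); first by rewrite expr0 subrr mul0r.
  have kv := Es_gt0 Ev.
  have av : aT' v = (v - k)%N :> nat by rewrite val_levB // kv.
  have ev : e < (v - k)%N%:Z.
    rewrite ltNge; apply/negP => h; move: Ev; rewrite /Es /vsteps_shift kv.
    by rewrite vsteps_small.
  rewrite Sinner ?mulr1 //; last by rewrite av; lia.
  by rewrite /inner av ev /=; case/andP: iv => _; lia.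
have aroot (v : 'I_(Zp_trunc P).+2) : inner v -> (0 < Es v)%N -> (aT' v == root) = false.
  move=> /andP[_ vN] Ev; apply/eqP => /(congr1 (@nat_of_ord _)); rewrite rootE.
  have kv := Es_gt0 Ev.
  by rewrite val_levB // kv; lia.
have -> : \det M = \det (M *m S) by rewrite det_mulmx detS mulr1.
rewrite det_trig.
  rewrite [RHS]big_mkcond; apply: eq_bigr => v _.
  case: ifP => iv; last by rewrite rowE0 ?iv // mxE eqxx.
  have vN : (v < k * N)%N by case/andP: iv.
  rewrite rowE // Sinner // mulr1.
  have -> : S (bT' v) v = 0.
    have bv : (bT' v == v) = false.
      by apply/eqP => /(congr1 (@nat_of_ord _)); rewrite valb //; lia.
    by rewrite mxE bv valb // ltnn andbF.
  rewrite mulr0 if_same subr0 -mulrA back //.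
  have [Ev|Ev] := posnP (Es v); last first.
    by rewrite aroot // exprD; move: (q ^+ hs v) (q ^+ Es v) => x y; ring.
  by rewrite Ev expr0 addn0 subrr mulr0 if_same subr0.
apply/is_trig_mxP => v w vw; case iv: (inner v); last first.
  rewrite rowE0 ?iv // mxE -val_eqE /= ltn_eqF //=.
  case inr: [&& _, _ & _] => //; case/and3P: inr => ev _ wN.
  by move: iv; rewrite /inner ev (ltn_trans vw).
rewrite rowE //; have [wN|wN] := ltnP w (k * N).
  rewrite Sinner ?(ltnW vw) // mulr1 -mulrA back ?(ltnW vw) //.
  have -> : (bT' v == root) = false.
    by apply/eqP => /(congr1 (@nat_of_ord _)); rewrite rootE valb //; lia.
  have -> : S (bT' v) w = 1.
    have bvE := valb _ iv.
    apply: Sinner => //; rewrite bvE //.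
    by case/andP: iv => ev vN; rewrite /inner (leq_ltn_trans vw wN) andbT; lia.
  have [Ev|Ev] := posnP (Es v); last first.
    by rewrite aroot // exprD; move: (q ^+ hs v) (q ^+ Es v) => x y; ring.
  by rewrite Ev expr0 addn0 subrr mulr0 if_same subr0 mulr1 subrr.
have Sout (u : 'I_(Zp_trunc P).+2) : S u w = (u == w)%:R.
  by rewrite mxE [(w < _)%N]ltnNge wN !andbF orbF.
have vN : (v < k * N)%N by case/andP: iv.
have -> : S v w = 0 by rewrite Sout -val_eqE /= ltn_eqF.
(* For [w] at least [k * N], the level [v + 1] can equal [w] only at the root, whose column is
   removed. *)
have -> : (if bT' v == root then 0 else (1 - q ^+ hs v) * S (bT' v) w) = 0.
  case: ifPn => // br; rewrite Sout; case: eqP => [bw|_]; last by rewrite mulr0.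
  case/negP: br; rewrite bw; apply/eqP/ord_inj; rewrite rootE.
  have wE := valb _ iv; rewrite bw in wE.
  by apply/eqP; rewrite eqn_leq wN andbT wE.
have [Ev|Ev] := posnP (Es v); first by rewrite Ev expr0 subrr !mulr0 !mul0r if_same !subr0.
have kv := Es_gt0 Ev.
have -> : S (aT' v) w = 0.
  rewrite Sout; case: eqP => // /(congr1 (@nat_of_ord _)).
  by rewrite val_levB // kv; lia.
by rewrite !mulr0 if_same !subr0.
Qed.

Definition qbin (a b : nat) : F := qfac q (a + b) / (qfac q a * qfac q b).

Lemma clsum_good :
  \sum_(w <- words (1 * N + k * N) | incls aT bT A B w root)
    q ^+ tailinv bT' aT' (conj w) root =
  \prod_(0 <= u < k * N | e < u%:Z) qbin (Es u) (hs u).-1.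
Proof.
have aK : cancel aT aT' by exact: levDK.
have aK' : cancel aT' aT by exact: levBK.
have bK : cancel bT bT' by exact: levBK.
have bK' : cancel bT' bT by exact: levDK.
rewrite (clsum_conj_walk q aK aK' bK bK' _ _ cl).
have cl' := closed_cls_conj aK bK cl.
have bal : balanced bT' aT' (B \o bT') (A \o aT') root root.
  by move=> v; rewrite (indegE bK' bK aK' aK) cl'.
have tot' : nedges (B \o bT') (A \o aT') = (1 * N + k * N)%N.
  by rewrite -tot; apply: eq_bigr => v _; rewrite /= addnC cl.
have := q_best q bal tot'; rewrite det_good.
have qf0 m : qfac q m != 0 by exact: qfac_neq0.
have ef0 : efac q (B \o bT') (A \o aT') != 0.
  by apply/prodf_neq0 => v _; rewrite mulf_neq0.
move=> best; apply: (mulIf ef0); rewrite {}best.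
have -> : \prod_(0 <= u < k * N | e < u%:Z) qbin (Es u) (hs u).-1 =
    \prod_(v < (Zp_trunc P).+2) (if inner v then qbin (Es v) (hs v).-1 else 1).
  rewrite -(big_mkord xpredT (fun v => if inner v then qbin (Es v) (hs v).-1 else 1)).
  have kNP : (k * N <= P)%N by have := PE; lia.
  rewrite Zp_cast // [RHS](@big_cat_nat _ _ _ (k * N)) //=.
  rewrite [X in _ = _ * X]big_nat [X in _ = _ * X]big1 ?mulr1; last first.
    by move=> i /andP[iN _]; rewrite /inner ltnNge iN andbF.
  rewrite big_mkcond big_nat [RHS]big_nat; apply: eq_bigr => i /andP[_ iN].
  by rewrite /inner iN andbT.
have nroot : inner root = false by rewrite /inner rootE ltnn andbF.
(* At the root one vertical step and no horizontal step ends, so that its vertex and edge factors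
   cancel. *)
have hsr : hs root = 0%N by rewrite rootE hs_big.
have Esr : Es root = 1%N.
  rewrite rootE /Es /vsteps_shift ifT; last by rewrite -[X in (X <= _)%N]muln1 leq_pmul2l.
  rewrite vsteps_big //; last by rewrite -/n; lia.
  have -> : (k %| k * N - k)%N by rewrite dvdn_sub // dvdn_mulr.
  by have -> : (k * N - k < k * N)%N by lia.
rewrite /efac -big_split [RHS](bigD1 root) // /vfac -mulrA; congr (_ * _).
  rewrite /= B'E A'E hsr Esr nroot mul1r.
  have -> : qfac q 0 = 1 by rewrite /qfac big_geq.
  by rewrite mul1r.
have -> : \prod_(v < (Zp_trunc P).+2 | inner v) (1 - q ^+ hs v) =
    \prod_(v < (Zp_trunc P).+2 | v != root) (if inner v then 1 - q ^+ hs v else 1).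
  by rewrite big_mkcond (bigD1 root) //= nroot mul1r.
rewrite -big_split; apply: eq_bigr => v vr /=.
rewrite B'E A'E; case: ifPn => iv.
  (* At an inner level the factor [1 - q ^+ hs v] of the determinant cancels the last factor of
     [qfac q (hs v)], leaving a q-binomial coefficient. *)
  have hs0 : (0 < hs v)%N by case/andP: iv => ev vN; apply: hsteps_gt0.
  have -> : (hs v + Es v).-1 = (Es v + (hs v).-1)%N by lia.
  rewrite /qbin (qfac_pred q hs0).
  have := qf0 (Es v); have := qf0 (hs v).-1.
  move: (qfac q (Es v + _)) (qfac q (Es v)) (qfac q (hs v).-1) (1 - q ^+ hs v) => x y z t z0 y0.
  by field; rewrite y0 z0.
have [|-> ->] := outer0 iv; last by rewrite /qfac big_geq // !mulr1.
by apply: contra vr => /eqP vN; apply/eqP/ord_inj; rewrite vN rootE.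
Qed.
Lemma qbin0n m : qbin 0 m = 1.
Proof.
have z : qfac q 0 = 1 by rewrite /qfac big_geq.
by rewrite /qbin add0n z mul1r divff // qfac_neq0.
Qed.

Lemma qbinn0 m : qbin m 0 = 1.
Proof.
have z : qfac q 0 = 1 by rewrite /qfac big_geq.
by rewrite /qbin addn0 z mulr1 divff // qfac_neq0.
Qed.

(** Putting [u = j + k] passes from the final to the starting levels of vertical steps. The factors
    with [u < k] are 1 since no vertical step ends there, those with [j >= k * N - k] since [H]
    vanishes there. *)
Lemma prod_qbin : \prod_(0 <= u < k * N | e < u%:Z) qbin (Es u) (hs u).-1 =
  \prod_(0 <= j < k * N) qbin (E j) (absz (dval H j%:Z - dval H (j%:Z + k%:Z))%R).
Proof.
have kN : (k <= k * N)%N by lia.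
have EsD u : Es (u + k) = E u by rewrite /Es /vsteps_shift leq_addl addnK.
transitivity (\prod_(0 <= u < k * N) qbin (Es u) (hs u).-1).
  rewrite big_mkcond; apply: eq_bigr => u _; case: ltP => // ue.
  rewrite /Es /vsteps_shift; case: ifP => ku; last by rewrite qbin0n.
  by rewrite vsteps_small ?qbin0n // -/e; lia.
rewrite (@big_cat_nat _ _ _ k) // big_nat big1 ?mul1r; last first.
  by move=> u uk; rewrite /Es /vsteps_shift ifF ?qbin0n //; lia.
rewrite [RHS](@big_cat_nat _ _ _ (k * N - k)) ?leq_subr //.
rewrite [X in _ = _ * X]big_nat [X in _ = _ * X]big1 ?mulr1; last first.
  by move=> j jN; rewrite !(dval_large k_gt0 gH) ?qbinn0 // -/n; lia.
rewrite (@big_addn _ _ _ 0 (k * N) k) [LHS]mul1r; apply: eq_big_nat => j jN; rewrite EsD.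
have [h|h] := ltP e (j%:Z + k%:Z); last first.
  by rewrite /E vsteps_small ?qbin0n // -/e; lia.
congr qbin; have jk : (j + k < k * N)%N by lia.
have := hstepsE k_gt0 gH jk; rewrite -/hs PoszD addrK.
have := dval_back k_gt0 gH h; rewrite addrK.
by move: (hs _) => x; lia.
Qed.
End GoodClass.

(** * Summation over the good sequences *)

Lemma qvar_neq0 : qvar != 0.
Proof. by rewrite /qvar tofrac_eq0 polyX_eq0. Qed.

Lemma qvar_expn_neq1 n : (0 < n)%N -> 1 - qvar ^+ n != 0.
Proof.
move=> n0; rewrite /qvar -tofracXn -tofrac1 -tofracB tofrac_eq0.
apply/eqP => /(congr1 (fun p : {poly rat} => p.[0])) /eqP.
by rewrite !hornerE expr0n gtn_eqF // subr0 oner_eq0.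
Qed.

Lemma Gprod_vsteps k (H : hseq) : (0 < k)%N -> good k H ->
  Gprod k H = \prod_(0 <= j < k * (hsize H).+2)
    Gq (vsteps k H j) (absz (dval H j%:Z - dval H (j%:Z + k%:Z))%R).
Proof.
move=> k0 gH; have e1 := eta_geN1 H k0.
have kn : (k * hsize H + k + k = k * (hsize H).+2)%N by rewrite !mulnS; lia.
pose r := [seq j%:Z - 1 | j <- iota 0 (k * (hsize H).+2)] : seq int.
have rP (i : int) : i \in r = (-1 <= i) && (i < (k * (hsize H).+2)%N%:Z - 1).
  apply/mapP/idP => [[j jN ->]|/andP[i1 iN]]; first by move: jN; rewrite mem_iota; lia.
  by exists (absz (i + 1)); [rewrite mem_iota; lia|lia].
rewrite /Gprod (@fsbig_seq_support _ _ _ _ _ r); last 3 first.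
- by rewrite map_inj_uniq ?iota_uniq // => x y /addIr [].
- move=> i /= ei; rewrite rP => ir.
  rewrite !(dval_large k0 gH) ?subrr; first last; [by lia|by lia|].
  exact: (qbinn0 qvar_expn_neq1).
- move=> i ir ei; rewrite (adiff_full k0); first exact: (qbin0n qvar_expn_neq1).
  by move: ir ei; rewrite rP /= => /andP[-> _] /negP; rewrite -ltNge.
rewrite big_map -[X in iota _ X]subn0 -/(index_iota 0 _).
apply: eq_big_nat => j /andP[_ jN].
by rewrite (adiff_vsteps k0 gH jN) subrK.
Qed.

(** [hminus] counts the [midc] boxes, whose number is [chi k H] throughout the class, and the
    [headc] boxes, which the BEST formula evaluates on the reversed walks. *)
Lemma class_sum k (H : hseq) : (0 < k)%N -> good k H ->
  \sum_(w <- words (1 * (hsize H).+2 + k * (hsize H).+2) |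
       [&& isbox 1 k (hsize H).+2 w, area w == hsize H & word_hseq k (hsize H).+2 w == H])
    qvar ^+ invs (hminus 1 k) w = Gprod k H * qvar ^ Num.floor (chi k H).
Proof.
move=> k0 gH; rewrite (Gprod_vsteps k0 gH).
have := prod_qbin k0 gH qvar_neq0 qvar_expn_neq1.
rewrite -(clsum_good k0 gH qvar_neq0 qvar_expn_neq1) => <-.
rewrite big_distrl /=; apply: eq_big => w; first by rewrite (incls_good k0 gH).
move=> /and3P[bw /eqP aw /eqP wH].
rewrite (tailinv_conj_box (ltn0Sn 0) k0 bw) (invs_hminus (hsize H).+2 (ltn0Sn 0) k0) exprD mulrC.
congr (_ * _); have N_area : (hsize H).+2 = (area w).+2 by rewrite aw.
have wt := tails_top k0 bw (_ : (area w < (hsize H).+2)%N).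
have := mid_word k0 bw (wt _) (ltn0Sn _) N_area; rewrite wH => mid.
have -> : chi k H = (invs (midc 1 k) w)%:R.
  have two0 : (2 : rat) != 0 by [].
  apply: (mulfI two0); rewrite (chi_hsteps k0 gH) -mid ?natrM // aw.
  by rewrite ltnW.
by rewrite (intrKfloor (Posz _)).
Qed.

Local Open Scope classical_set_scope.
Local Open Scope ring_scope.

Theorem theorem1p6 (k : nat) (hk : (0 < k)%N) :
  exists2 S : fps Qq,
    fps_has_sum [set H : hseq | good k H]
      (fun H => fpsC (Gprod k H * qvar ^ Num.floor (chi k H)) * 't ^+ hsize H)
      S &
    fps_cvg_to
      (fun N => \prod_(1 <= i < N.+1) (1 / (1 - fpsC qvar * 't ^+ i)))
      S.
Proof.
(* The coefficients count the diagrams of area [n] by their nonempty rows; a box of side [n]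
   contains them all. *)
exists (Fps (fun n => wsum qvar rowc n n n)) => [n|n]; last first.
  exists n => m nm; rewrite -[LHS]/(fcoef (partition_fps qvar m) n).
  by rewrite -(wsum_rowc qvar m (leqnn n)) [LHS]wsum_large.
(* [N] is the bound used for the steps of a sequence of size [n], and [s] lists the Hilbert
   functions of the diagrams of area [n]. *)
pose N := n.+2; pose W := [seq w <- words (1 * N + k * N) | isbox 1 k N w && (area w == n)].
pose s := undup [seq word_hseq k N w | w <- W].
pose c H := Gprod k H * qvar ^ Num.floor (chi k H).
have coefE H : fcoef (fpsC (c H) * 't ^+ hsize H) n = c H * (n == hsize H)%:R.
  by rewrite fcoefCM fcoefXn.
have csum H : good k H -> hsize H = n ->
    c H = \sum_(w <- W | word_hseq k N w == H) qvar ^+ invs (hminus 1 k) w.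
  move=> gH Hn; rewrite /c -class_sum // Hn big_filter_cond /=.
  by apply: eq_bigl => w; rewrite andbA.
(* A good sequence of size [n] outside [s] has an empty class, so by [csum] its weight is an empty
   sum. *)
have out H : good k H -> H \notin s -> c H * (n == hsize H)%:R = 0.
  move=> gH Hs; case: eqP => [Hn|_]; last by rewrite mulr0.
  rewrite csum // big_seq_cond big1 ?mul0r // => w /andP[wW /eqP wH].
  by case/negP: Hs; rewrite mem_undup -wH map_f.
have sP H : H \in s -> good k H /\ hsize H = n.
  rewrite mem_undup => /mapP[w]; rewrite mem_filter => /andP[/andP[bw /eqP aw] _] ->.
  have aN : (area w < N)%N by rewrite aw ltnW.
  have wt := tails_top hk bw aN.
  by split; [apply: word_good|rewrite hsize_word].
split.
  apply: (@sub_finite_set _ _ [set` s]) => [H [gH]|]; last exact: finite_seq.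
  rewrite coefE => cH; apply/negPn/negP => Hs; exact: (cH (out H gH Hs)).
rewrite (@fsbig_seq_support _ _ _ _ _ s) ?undup_uniq //; last 2 first.
- by move=> H gH Hs; rewrite coefE out.
- by move=> H /sP[].
rewrite big_seq (eq_bigr (fun H => \sum_(w <- W | word_hseq k N w == H) qvar ^+ invs (hminus 1 k) w)); last first.
  by move=> H /sP[gH Hn]; rewrite coefE Hn eqxx mulr1 csum.
(* Each word of [W] is counted for exactly one sequence of [s], its own Hilbert function. *)
rewrite -big_seq (exchange_big_dep xpredT) //=.
rewrite (eq_big_seq (fun w => qvar ^+ invs (hminus 1 k) w)) => [|w wW]; last first.
  rewrite -big_filter (_ : [seq _ <- s | _] = [:: word_hseq k N w]) ?big_seq1 //.
  have ws : word_hseq k N w \in s by rewrite mem_undup map_f.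
  rewrite (eq_filter (a2 := pred1 (word_hseq k N w))); last by move=> H; rewrite /= eq_sym.
  by rewrite filter_pred1_uniq ?undup_uniq.
rewrite big_filter wsum_box.
have nN : (n <= N)%N by rewrite /N; lia.
rewrite wsum_large ?mul1n ?(leq_trans nN) ?leq_pmull //.
(* The grid of fractions has to be fine enough for area [n] and to contain the slope [k]. *)
apply: (wsum_hminus qvar_neq0 qvar_expn_neq1 (K := maxn n k)).
- exact: leq_maxl.
- by rewrite leq_max hk orbT.
- by rewrite leq_max hk orbT.
by rewrite hk leq_maxr.
Qed.
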